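(* Let $p\geq 3$. (i) If $0<\beta<\beta_p$, then $W$ and $T$ are indistinguishable, i.e. $\lim_{N\to\infty} d_{TV}(W,T)=0$, and weak recovery of $u$ is impossible: for every random probability measure $\mu_N$ on $\Omega_N^s\times\mathscr B(S_N)$ and every constant $c>0$, $$\lim_{N\to\infty}\mathbb P\Big(\int_{S_N}|\langle u,\tau\rangle|\,\mu_N(T,d\tau)\geq c\Big)=0.$$ (ii) If $\beta>\beta_p$, then $W$ and $T$ are distinguishable, i.e. $\lim_{N\to\infty}d_{TV}(W,T)=1$, and weak recovery of $u$ is possible: there exist random probability measures $\mu_N$ on $\Omega_N^s\times\mathscr B(S_N)$ and a constant $c>0$ such that $$\lim_{N\to\infty}\mathbb P\Big(\int_{S_N}|\langle u,\tau\rangle|\,\mu_N(T,d\tau)\geq c\Big)=1.$$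
   Context: Fix $p\ge 3$ and $N\ge1$. Let $\Omega_N=\bigotimes_{j=1}^p\mathbb R^N$ be the space of real tensors $Y=(y_{i_1,\dots,i_p})_{1\le i_1,\dots,i_p\le N}$, with inner product $\langle Y,Y'\rangle=\sum_{i_1,\dots,i_p}y_{i_1,\dots,i_p}y'_{i_1,\dots,i_p}$; for $\tau\in\mathbb R^N$, $\tau^{\otimes p}\in\Omega_N$ has entries $\tau_{i_1}\cdots\tau_{i_p}$. For a permutation $\pi$ of $\{1,\dots,p\}$, $Y^\pi$ has entries $y_{i_{\pi(1)},\dots,i_{\pi(p)}}$; $\Omega_N^s$ is the space of symmetric tensors ($Y=Y^\pi$ for all $\pi$). Let $Y$ have i.i.d. $N(0,2/N)$ entries and $W=\frac1{p!}\sum_{\pi}Y^\pi$. Let $S_N=\{\pm1/\sqrt N\}^N$, let $u$ be uniform on $S_N$, independent of $W$, and for $\beta\ge0$ let $T=W+\beta u^{\otimes p}$. $d_{TV}(W,T)=\sup_{A\in\mathscr B(\Omega_N^s)}|\mathbb P(W\in A)-\mathbb P(T\in A)|$. A random probability measure on $\Omega_N^s\times\mathscr B(S_N)$ is a map $\mu_N:\Omega_N^s\times\mathscr B(S_N)\to[0,1]$ such that $\mu_N(\cdot,A)$ is Borel measurable for each $A$ and $\mu_N(w,\cdot)$ is a probability measure on $S_N$ for each $w$. Pure $p$-spin model: $\Sigma_N=\{-1,1\}^N$, $(g_{i_1,\dots,i_p})$ i.i.d. standard Gaussians, $H_N(\sigma)=N^{-(p-1)/2}\sum_{1\le i_1,\dots,i_p\le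 N}g_{i_1,\dots,i_p}\sigma_{i_1}\cdots\sigma_{i_p}$, and free energy $F_N(\beta)=\frac1N\log\sum_{\sigma\in\Sigma_N}2^{-N}\exp\big(\tfrac{\beta}{\sqrt2}H_N(\sigma)\big)$. It is known that $F_N(\beta)$ converges a.s. to a nonrandom limit $F(\beta)$, and $F(\beta)\le\beta^2/4$ for all $\beta\ge0$. Let $\mathcal R=\{\beta>0:F(\beta)=\beta^2/4\}$ and $\beta_p=\max\mathcal R$ (the critical temperature). *)

(* Defs.v *)
From HB Require Import structures.
From mathcomp Require Import all_boot all_order all_algebra all_fingroup.
From mathcomp Require Import all_classical all_reals all_analysis.
Unset Printing Implicit Defensive.
Import Order.TTheory GRing.Theory Num.Theory.
Import numFieldNormedType.Exports.
Local Open Scope classical_set_scope.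
Local Open Scope ring_scope.

Definition idx (p N : nat) := {ffun 'I_p -> 'I_N}.

Definition tensor (R : Type) (p N : nat) := idx p N -> R.

Definition tperm {R : Type} {p N : nat} (Y : tensor R p N) (pi : 'S_p)
  : tensor R p N := fun i => Y [ffun j => i (pi j)].

Definition sym_tensor {R : Type} (p N : nat) : set (tensor R p N) :=
  [set Y | forall pi : 'S_p, tperm Y pi = Y].

Definition symmetrize {R : realType} {p N : nat} (Y : tensor R p N)
  : tensor R p N := fun i => (p`!%:R)^-1 * \sum_(pi : 'S_p) tperm Y pi i.

Definition outer {R : realType} (p : nat) {N : nat} (x : 'I_N -> R)
  : tensor R p N := fun i => \prod_(j < p) x (i j).

(* Borel sigma-algebra on Omega_N = R^{N^p}: generated by the coordinates *)
Definition tmeasurable {R : realType} (p N : nat) : set (set (tensor R p N)) :=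
  <<s [set (fun Y : tensor R p N => Y i) @^-1` B | i in [set: idx p N] &
        B in [set B : set R | measurable B]] >>.

Definition spin (N : nat) := {ffun 'I_N -> bool}.

Definition sgn {R : realType} (b : bool) : R := if b then 1 else -1.

(* the point of S_N (or of Sigma_N after scaling) coded by s *)
Definition vecS {R : realType} {N : nat} (s : spin N) : 'I_N -> R :=
  fun i => sgn (s i) / Num.sqrt (N%:R).

Definition dotv {R : realType} {N : nat} (x y : 'I_N -> R) : R :=
  \sum_(i < N) x i * y i.

Definition Pr {R : realType} {d} {Om : measurableType d}
  (P : probability Om R) (A : set Om) : R := fine (P A).

(* X has law N(0, s^2) (s = standard deviation) *)
Definition centered_gaussian {R : realType} {d} {Om : measurableType d}
  (P : probability Om R) (X : Om -> R) (s : R) : Prop :=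
  measurable_fun setT X /\
  forall B : set R, measurable B -> P (X @^-1` B) = normal_prob 0 s B.

Definition indep_family {R : realType} {d} {Om : measurableType d}
  (P : probability Om R) {I : finType} (X : I -> Om -> R) : Prop :=
  forall A : I -> set R, (forall i, measurable (A i)) ->
    P (\bigcap_(i in [set: I]) (X i @^-1` A i)) =
    (\prod_(i : I) P (X i @^-1` A i))%E.

Definition embed_idx {p N : nat} (i : idx p N) : {ffun 'I_p -> nat} :=
  [ffun j => nat_of_ord (i j)].

Definition HN {R : realType} (p N : nat) (g : {ffun 'I_p -> nat} -> R)
  (sigma : spin N) : R :=
  (Num.sqrt (N%:R) ^+ (p - 1))^-1 *
  \sum_(i : idx p N) g (embed_idx i) * \prod_(j < p) sgn (sigma (i j)).

Definition FN {R : realType} (p N : nat) (g : {ffun 'I_p -> nat} -> R)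
  (beta : R) : R :=
  (N%:R)^-1 * ln (\sum_(sigma : spin N)
                     (2 ^- N) * expR (beta / Num.sqrt 2 * @HN R p N g sigma)).

(* (g_i) i.i.d. standard Gaussians: every finite subfamily is independent
   and each g_i is N(0,1) *)
Definition iid_std_gaussian_array {R : realType} {d} {Om : measurableType d}
  (P : probability Om R) (p : nat) (g : {ffun 'I_p -> nat} -> Om -> R) : Prop :=
  (forall i, centered_gaussian P (g i) 1) /\
  (forall N : nat, indep_family P (fun i : idx p N => g (embed_idx i))).

Definition is_free_energy_limit {R : realType} {d} {Om : measurableType d}
  (P : probability Om R) (p : nat) (g : {ffun 'I_p -> nat} -> Om -> R)
  (F : R -> R) : Prop :=
  forall beta : R, 0 <= beta ->
    {ae P, forall w, (fun N : nat => @FN R p N (fun i => g i w) beta) @ \oo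
                       --> F beta}.

Definition is_critical_temperature {R : realType} (F : R -> R) (bp : R) : Prop :=
  (0 < bp /\ F bp = bp ^+ 2 / 4) /\
  (forall b, 0 < b -> F b = b ^+ 2 / 4 -> b <= bp).

Definition spiked_model {R : realType} {d} {Om : measurableType d}
  (P : probability Om R) (p : nat)
  (Y : forall N : nat, Om -> tensor R p N) (u : forall N : nat, Om -> spin N)
  : Prop :=
  forall N : nat, (0 < N)%N ->
    (forall i : idx p N,
        centered_gaussian P (fun w => Y N w i) (Num.sqrt (2 / N%:R))) /\
    (forall s : spin N, measurable [set w | u N w = s]) /\
    (forall s : spin N, P [set w | u N w = s] = ((2 ^- N : R))%:E) /\
    (forall (A : idx p N -> set R) (B : set (spin N)),
        (forall i, measurable (A i)) ->
        P [set w | (forall i, A i (Y N w i)) /\ B (u N w)] =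
        ((\prod_(i : idx p N) P [set w | A i (Y N w i)]) *
          P [set w | B (u N w)])%E).

Definition Wt {R : realType} {d} {Om : measurableType d} {p : nat}
  (Y : forall N : nat, Om -> tensor R p N) (N : nat) (w : Om) : tensor R p N :=
  symmetrize (Y N w).

Definition Tt {R : realType} {d} {Om : measurableType d} {p : nat}
  (beta : R) (Y : forall N : nat, Om -> tensor R p N)
  (u : forall N : nat, Om -> spin N) (N : nat) (w : Om) : tensor R p N :=
  fun i => Wt Y N w i + beta * outer p (vecS (u N w)) i.

Definition dTV {R : realType} {d} {Om : measurableType d}
  (P : probability Om R) (p N : nat) (X1 X2 : Om -> tensor R p N) : R :=
  sup [set r : R | exists A : set (tensor R p N),
         [/\ tmeasurable p N A, A `<=` sym_tensor p N &
             r = `| Pr P (X1 @^-1` A) - Pr P (X2 @^-1` A) |] ].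

(* random probability measure on Omega_N^s x B(S_N) (S_N finite, all its
   subsets are Borel) *)
Definition random_prob_measure {R : realType} (p N : nat)
  (mu : tensor R p N -> set (spin N) -> R) : Prop :=
  (forall (A : set (spin N)) (B : set R), measurable B ->
      tmeasurable p N (sym_tensor p N `&` (fun w => mu w A) @^-1` B)) /\
  (forall w, sym_tensor p N w ->
      (forall A, 0 <= mu w A <= 1) /\ mu w setT = 1 /\
      (forall A B, A `&` B = set0 -> mu w (A `|` B) = mu w A + mu w B)).

Definition overlap_integral {R : realType} {p N : nat}
  (mu : tensor R p N -> set (spin N) -> R) (t : tensor R p N) (s : spin N) : R :=
  \sum_(tau : spin N) `| dotv (vecS s) (vecS tau) | * mu t [set tau].

(* Main.v *)
(** Let [L] be the likelihood ratio of the observation [T] with respect to the pure noise [W].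
    It is the normalized partition function of the p-spin model (the "evidence" of the spike),
    so that [F_N = (ln L) / N + beta^2 / 4], and [dTV W T] is the mean of the positive part of
    [1 - L].

    Above the critical temperature [F < beta^2 / 4], and Gaussian concentration shows that [L] is
    exponentially small under [W] and exponentially large under [T].  This separates the two
    laws.  Spins of overlap at most [eps] with the planted spin contribute only
    [exp (beta^2 N eps / 2)] to [L], so a sample of the posterior (Gibbs) measure has a positive
    overlap with it.

    At the critical temperature [L] is not exponentially small under [W], which forces
    [psi = E_T (ln L)] to be sublinear in [N].  By the Nishimori identity [psi] is nondecreasing
    in the inverse temperature, so it is sublinear for all smaller ones as well.  Now let [beta]
    be subcritical, [beta < b' < bp], and suppose that the spins whose overlap with the planted
    one lies in [[v, 5 v / 4)] carry a part of [L] that is not exponentially small, while larger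
    overlaps are already excluded.  By the Nishimori identity two independent spins of this shell
    have overlap at most about [5 v / 4]; Gaussian integration by parts then shows that the
    logarithm of this part grows linearly in [N] between [beta] and [b'], against the
    sublinearity of [psi] at [b'].  Descending from [v > 1], every overlap bounded away from 0 is
    exponentially unlikely.  As [p >= 3], the remaining overlaps have an exponential moment
    tending to 1, and a truncated second moment argument gives [L -> 1] in mean.  Two posterior
    samples then have vanishing overlap, and by Cauchy-Schwarz so does any estimator with the
    planted spin. *)
Require Import Defs.
From HB Require Import structures.
From mathcomp Require Import all_boot all_order all_algebra all_fingroup.
From mathcomp Require Import all_classical all_reals all_analysis.
From mathcomp Require Import measurable_realfun lebesgue_integral_fubini.
From mathcomp Require Import ring lra.
Import Order.TTheory GRing.Theory Num.Theory.
Import numFieldNormedType.Exports.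
Local Open Scope classical_set_scope.
Local Open Scope ring_scope.

(** * One-dimensional Gaussian measure *)

(** Concentration rests on the bound E e^{lF} E e^{-lF} <= e^{l^2 b^2 M} for a log-partition
    function F, whose product form tensorizes over the coordinates. Separate Lipschitz constants per
    coordinate lose nothing, because the modulus of [coef t i] does not depend on the spin [t] and
    its squares sum to [snr]. No integral is differentiated: integration by parts and the
    monotonicity of [psi] are inequalities on finite increments with quadratic errors. The planted
    spin can be fixed at [base]: sign changes of the noise coordinates preserve the Gaussian law and
    move [base] to any spin. The second moment of [L] may be dominated by rare pairs of large
    overlap, so these must be excluded before it is used. On a shell that starts at [v] with pair
    overlaps at most [v'], the mean log-evidence grows at rate [b * (2 * v - v')] per unit of [snr],
    to first order: the planted tilt and the energy together give [2 * v], the mutual overlaps take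
    [v']. The rate is positive for [v' < 2 * v], so a fixed geometric ratio works and finitely many
    shells suffice. Pair overlaps are controlled only on a shell that carries enough of [L], hence a
    dichotomy at each shell. *)

Section density.
Context d (T : measurableType d) (R : realType).
Variables (mu nu : {measure set T -> \bar R}) (k : T -> R).
Hypotheses (mk : measurable_fun setT k) (k0 : forall x, 0 <= k x).
Hypothesis nuE : forall A, measurable A -> nu A = (\int[mu]_(x in A) (k x)%:E)%E.
Local Open Scope ereal_scope.
Import HBNNSimple.

(** Simple functions reduce the claim to the hypothesis on sets, and monotone convergence passes to
    [f]. *)
Lemma ge0_integral_density (f : T -> \bar R) :
  measurable_fun setT f -> (forall x, 0 <= f x) ->
  \int[nu]_x f x = \int[mu]_x (f x * (k x)%:E).
Proof.
move=> mf f0; pose f_ := nnsfun_approx measurableT mf.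
have mfk n : measurable_fun setT (fun x => ((f_ n x)%:E * (k x)%:E)).
  by apply: emeasurable_funM; apply/measurable_EFinP.
transitivity (limn (fun n => \int[nu]_x (f_ n x)%:E)).
  rewrite -monotone_convergence//.
  - by apply: eq_integral => x _; apply/esym/cvg_lim => //; apply: cvg_nnsfun_approx.
  - by move=> n; exact/measurable_EFinP/measurable_funTS.
  - by move=> *; rewrite lee_fin.
  - by move=> x _ m n mn; rewrite lee_fin; exact/lefP/nd_nnsfun_approx.
transitivity (limn (fun n => \int[mu]_x ((f_ n x)%:E * (k x)%:E))); last first.
  rewrite -monotone_convergence//.
  - apply: eq_integral => x _; apply/cvg_lim => //.
    by apply: cvgeZr; [|exact: cvg_nnsfun_approx].
  - by move=> n x _; rewrite -EFinM lee_fin mulr_ge0.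
  - by move=> x _ m n mn; rewrite -!EFinM lee_fin ler_wpM2r//; exact/lefP/nd_nnsfun_approx.
apply/congr_lim/funext => n.
under eq_integral do rewrite fimfunE -fsumEFin//.
rewrite ge0_integral_fsum//; last 2 first.
  - by move=> y; exact/measurable_EFinP/measurable_funM.
  - by move=> y x _; rewrite nnfun_muleindic_ge0.
transitivity (\int[mu]_x (\sum_(y \in range (f_ n)) ((y * \1_(f_ n @^-1` [set y]) x)%:E * (k x)%:E))); last first.
  apply: eq_integral => x _; rewrite (fimfunE (f_ n) x) -fsumEFin// ge0_mule_fsuml//.
  by move=> y; rewrite nnfun_muleindic_ge0.
rewrite ge0_integral_fsum//; last 2 first.
  - by move=> y; apply: emeasurable_funM; apply/measurable_EFinP => //; exact/measurable_funM.
  - by move=> y x _; rewrite mule_ge0// ?nnfun_muleindic_ge0// lee_fin.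
apply: eq_fsbigr => r _; rewrite integralZl_indic_nnsfun// integral_indic//= setIT nuE//.
rewrite integral_mkcond.
have [r0|r0] := ltP r 0%R.
  rewrite preimage_nnfun0// [X in _ * X]integral0_eq; last by move=> x _; rewrite patch_set0.
  by rewrite mule0 integral0_eq// => x _; rewrite indic0 mulr0 mul0e.
rewrite -ge0_integralZl//; last 2 first.
- by apply/(measurable_restrictT _ _).1 => //; apply/measurable_EFinP; exact: measurable_funTS.
- by move=> x _; rewrite erestrict_ge0// => y _; rewrite lee_fin.
apply: eq_integral => x _; rewrite patchE indicE.
by case: ifPn => [xA|xA]; rewrite ?xA ?(negbTE xA) ?mulr1 ?mulr0 ?mul0e ?mule0.
Qed.

End density.

Lemma measurable_fun_invr_gt0 d (T : measurableType d) (R : realType) (f : T -> R) :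
  measurable_fun setT f -> (forall x, 0 < f x) ->
  measurable_fun setT (fun x => (f x)^-1).
Proof.
move=> mf f0; rewrite (_ : (fun x => _) = (fun x => expR (- ln (f x)))); last first.
  by apply/funext => x; rewrite expRN lnK// posrE.
apply: measurableT_comp => //; apply: measurableT_comp => //.
exact: (measurableT_comp (@measurable_ln R)).
Qed.

Section normal1.
Context (R : realType).
Local Notation gam := (normal_prob (0:R) (1:R)).
Local Notation mu := (@lebesgue_measure R).

Lemma integral_gauss1 (f : R -> \bar R) : measurable_fun setT f ->
  (forall x, 0 <= f x)%E ->
  (\int[gam]_x f x = \int[mu]_x (f x * (normal_pdf 0 1 x)%:E))%E.
Proof.
move=> mf f0; apply: (ge0_integral_density _ _ _ mu) => //.
- exact: measurable_normal_pdf.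
- exact: normal_pdf_ge0.
Qed.

Lemma lebesgue_measureD (c : R) (A : set R) : measurable A ->
  pushforward mu ((fun x : R => x + c) : _ -> measurableTypeR R) A = mu A.
Proof.
move=> mA; apply/esym/lebesgue_measure_unique => //=.
  exact: measurable_funD.
move=> _ _ [[a b]] _ <-.
rewrite /pushforward (_ : _ @^-1` _ = `]a - c, b - c]%classic); last first.
  by apply/seteqP; split => x /=; rewrite !in_itv/= ltrBlDr lerBrDr.
rewrite !lebesgue_measure_itv/= !lte_fin ltrD2r; congr (if _ then _ else _).
by rewrite -!EFinB; congr EFin; ring.
Qed.

Lemma ge0_integral_lebesgueD (c : R) (f : R -> \bar R) : measurable_fun setT f ->
  (forall x, 0 <= f x)%E -> (\int[mu]_x f ((x : R) + c)%R = \int[mu]_x f x)%E.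
Proof.
move=> mf f0.
pose phi : R -> measurableTypeR R := fun x => x + c.
transitivity (\int[pushforward mu phi]_x f x)%E.
  by rewrite ge0_integral_pushforward//; exact: measurable_funD.
apply: eq_measure_integral => [|mp B mB _]; first exact: measurable_funD.
exact: (lebesgue_measureD c).
Qed.

Lemma ge0_integral_lebesgueN (f : R -> \bar R) : measurable_fun setT f ->
  (forall x, 0 <= f x)%E -> (\int[mu]_x f (- (x : R))%R = \int[mu]_x f x)%E.
Proof.
move=> mf f0.
transitivity (\int[pushforward mu (-%R : R -> measurableTypeR R)]_x f x)%E.
  by rewrite ge0_integral_pushforward//; exact: measurable_oppr.
apply: eq_measure_integral => B mB _.
exact: lebesgue_measureN.
Qed.

Lemma ge0_integral_lebesgue_affine (chi c : R) (f : R -> \bar R) :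
  chi ^+ 2 = 1 -> measurable_fun setT f ->
  (forall x, 0 <= f x)%E -> (\int[mu]_x f (chi * (x : R) + c)%R = \int[mu]_x f x)%E.
Proof.
move=> /eqP; rewrite sqrf_eq1 => /orP[] /eqP -> mf f0.
  by under eq_integral do rewrite mul1r; exact: ge0_integral_lebesgueD.
under eq_integral do rewrite mulN1r.
rewrite (ge0_integral_lebesgueN (fun x => f (x + c)))//; last first.
  by apply: measurableT_comp => //; exact: measurable_funD.
exact: ge0_integral_lebesgueD.
Qed.

(** Cameron-Martin formula combined with a sign. The translation produces the likelihood ratio of a
    planted signal, the sign [chi] the gauge symmetry, and completing the square treats both at
    once. *)
Lemma normal01_affine (chi c : R) (f : R -> \bar R) :
  chi ^+ 2 = 1 -> measurable_fun setT f -> (forall x, 0 <= f x)%E ->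
  (\int[gam]_x f (chi * (x : R) + c)%R =
   \int[gam]_x (f x * (expR (c * (x : R) - c ^+ 2 / 2))%:E))%E.
Proof.
move=> chi2 mf f0.
have maff : measurable_fun setT (fun x : R => chi * x + c).
  by apply: measurable_funD => //; exact: measurable_funM.
have mexp : measurable_fun setT (fun x : R => (expR (c * x - c ^+ 2 / 2))%:E).
  apply/measurable_EFinP; apply: measurableT_comp => //.
  by apply: measurable_funB => //; exact: measurable_funM.
have mfe := emeasurable_funM mf mexp.
have mpdf : measurable_fun setT (fun x : R => (normal_pdf 0 1 x)%:E).
  by apply/measurable_EFinP; exact: measurable_normal_pdf.
have mfp := emeasurable_funM mfe mpdf.
rewrite integral_gauss1//; last exact: measurableT_comp.
rewrite integral_gauss1//; last first.
- by move=> x; rewrite mule_ge0// lee_fin expR_ge0.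
pose F (y : R) := (f y * (expR (c * y - c ^+ 2 / 2))%:E * (normal_pdf 0 1 y)%:E)%E.
have F0 y : (0 <= F y)%E by rewrite !mule_ge0// lee_fin ?expR_ge0// normal_pdf_ge0.
transitivity (\int[mu]_x F (chi * (x : R) + c)%R)%E; last first.
  exact: (ge0_integral_lebesgue_affine chi c F chi2 mfp F0).
rewrite /F.
apply: eq_integral => x _; rewrite -muleA -EFinM; congr (_ * _%:E)%E.
rewrite !normal_pdfE ?oner_eq0//= mulrCA; congr (_ * _).
rewrite /normal_fun -expRD; congr expR.
have -> : (x - 0) ^+ 2 = (chi * (x : R)) ^+ 2 by rewrite exprMn chi2 mul1r subr0.
by rewrite expr1n; lra.
Qed.

Lemma normal01_expR (c : R) : (\int[gam]_x (expR (c * (x : R)))%:E = (expR (c ^+ 2 / 2))%:E)%E.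
Proof.
have mexp : measurable_fun setT (fun x : R => (expR (c * x - c ^+ 2 / 2))%:E).
  apply/measurable_EFinP; apply: measurableT_comp => //.
  by apply: measurable_funB => //; exact: measurable_funM.
have H := normal01_affine 1 c (cst 1%E) (expr1n _ _) (measurable_cst _) (fun=> lee01).
have H1 : (\int[gam]_x (expR (c * (x:R) - c ^+ 2 / 2))%:E = 1)%E.
  transitivity (\int[gam]_x (cst 1%E (x : R) * (expR (c * (x:R) - c ^+ 2 / 2))%:E))%E.
    by apply: eq_integral => x _; rewrite mul1e.
  by rewrite -H integral_cst//= probability_setT mule1.
rewrite -[RHS]mule1 -H1 -ge0_integralZl//.
by apply: eq_integral => x _; rewrite -EFinM -expRD; congr (expR _)%:E; ring.
Qed.

(** The standard density times [expR (x ^+ 2 / 4)] is [Num.sqrt 2] times the centered normal density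
    of variance 2. *)
Lemma normal01_expR_sqr : (\int[gam]_x (expR ((x : R) ^+ 2 / 4))%:E = (Num.sqrt 2)%:E)%E.
Proof.
have s20 : Num.sqrt 2 != 0 :> R by rewrite sqrtr_eq0 -ltNge.
have mexp : measurable_fun setT (fun x : R => (expR (x ^+ 2 / 4))%:E).
  by apply/measurable_EFinP; apply: measurableT_comp => //; exact: measurable_funM.
rewrite integral_gauss1//.
have E := integral_normal_pdf (0:R) (Num.sqrt 2).
transitivity ((Num.sqrt 2)%:E * \int[mu]_x (normal_pdf 0 (Num.sqrt 2) x)%:E)%E; last first.
  by rewrite E mule1.
have m2 : measurable_fun setT (fun x : R => (normal_pdf 0 (Num.sqrt 2) x)%:E).
  by apply/measurable_EFinP; exact: measurable_normal_pdf.
have p0 x : (0 <= (normal_pdf 0 (Num.sqrt 2) x)%:E)%E.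
  by rewrite lee_fin normal_pdf_ge0.
rewrite -ge0_integralZl; [|exact: measurableT|exact: m2|by move=> x _; exact: p0|by rewrite lee_fin sqrtr_ge0].
apply: eq_integral => x _; rewrite -!EFinM; congr _%:E.
rewrite !normal_pdfE ?oner_eq0//= mulrCA [RHS]mulrA; congr (_ * _); last first.
  rewrite /normal_fun -expRD; congr expR.
  rewrite subr0 sqr_sqrtr// expr1n (_ : 2 *+ 2 = 4); last by rewrite -mulrnA.
  by lra.
rewrite /normal_peak sqr_sqrtr// expr1n mul1r -mulrnAr sqrtrM// invfM.
by rewrite mulrA divff// mul1r.
Qed.

End normal1.

Section gauss1.
Context (R : realType).

(** A copy of [normal_prob 0 1] carried by [R] with its own measurable structure, over which tuples
    and products of real coordinates are formed. *)
Definition gauss1 : set R -> \bar R := normal_prob 0 1.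

Let gauss1_0 : gauss1 set0 = 0%E. Proof. exact: (measure0 (normal_prob (0:R) 1)). Qed.
Let gauss1_ge0 A : (0 <= gauss1 A)%E. Proof. exact: (measure_ge0 (normal_prob (0:R) 1)). Qed.
Let gauss1_sigma : semi_sigma_additive gauss1.
Proof. exact: (@measure_semi_sigma_additive _ _ _ (normal_prob (0:R) 1)). Qed.
HB.instance Definition _ := isMeasure.Build _ R _ gauss1 gauss1_0 gauss1_ge0 gauss1_sigma.
Let gauss1_setT : gauss1 setT = 1%E. Proof. exact: (probability_setT (normal_prob (0:R) 1)). Qed.
HB.instance Definition _ := @Measure_isProbability.Build _ _ R gauss1 gauss1_setT.

Lemma gauss1D (f g : R -> \bar R) : (forall x, 0 <= f x)%E -> measurable_fun setT f ->
  (forall x, 0 <= g x)%E -> measurable_fun setT g ->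
  (\int[gauss1]_x (f x + g x) = \int[gauss1]_x f x + \int[gauss1]_x g x)%E.
Proof. by move=> f0 mf g0 mg; rewrite ge0_integralD. Qed.

Lemma gauss1Zl (c : \bar R) (f : R -> \bar R) : measurable_fun setT f ->
  (forall x, 0 <= f x)%E -> (0 <= c)%E ->
  (\int[gauss1]_x (c * f x) = c * \int[gauss1]_x f x)%E.
Proof. by move=> mf f0 c0; rewrite ge0_integralZl. Qed.

Lemma gauss1Zr (c : \bar R) (f : R -> \bar R) : measurable_fun setT f ->
  (forall x, 0 <= f x)%E -> (0 <= c)%E ->
  (\int[gauss1]_x (f x * c) = \int[gauss1]_x f x * c)%E.
Proof. by move=> mf f0 c0; rewrite ge0_integralZr. Qed.

(* The measurable structures of R and of measurableTypeR R are not convertible,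
   so integrals are transported along the identity. *)
Lemma integral_gauss1E (f : R -> \bar R) : measurable_fun setT f -> (forall x, 0 <= f x)%E ->
  (\int[gauss1]_x f x = \int[normal_prob (0:R) 1]_x f x)%E.
Proof.
move=> mf f0.
pose phi : measurableTypeR R -> R := fun x => x.
have mphi : measurable_fun setT phi.
  by move=> _ B mB; rewrite setTI; exact: mB.
transitivity (\int[pushforward (normal_prob (0:R) 1) phi]_x f x)%E; last first.
  by rewrite ge0_integral_pushforward.
by apply: eq_measure_integral.
Qed.

Lemma gauss1_affine (chi c : R) (f : R -> \bar R) :
  chi ^+ 2 = 1 -> measurable_fun setT f -> (forall x, 0 <= f x)%E ->
  (\int[gauss1]_x f (chi * x + c)%R =
   \int[gauss1]_x (f x * (expR (c * x - c ^+ 2 / 2))%:E))%E.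
Proof.
move=> chi2 mf f0; rewrite !integral_gauss1E.
- exact: normal01_affine.
- apply: emeasurable_funM => //; apply/measurable_EFinP; apply: measurableT_comp => //.
  by apply: measurable_funB => //; exact: measurable_funM.
- by move=> x; rewrite mule_ge0// lee_fin expR_ge0.
- apply: measurableT_comp => //.
  by apply: measurable_funD => //; exact: measurable_funM.
- by [].
Qed.

Lemma gauss1_expR (c : R) : (\int[gauss1]_x (expR (c * x))%:E = (expR (c ^+ 2 / 2))%:E)%E.
Proof.
rewrite integral_gauss1E.
- exact: normal01_expR.
- by apply/measurable_EFinP; apply: measurableT_comp => //; exact: measurable_funM.
- by move=> x; rewrite lee_fin expR_ge0.
Qed.

Lemma gauss1_expR_sqr : (\int[gauss1]_x (expR (x ^+ 2 / 4))%:E = (Num.sqrt 2)%:E)%E.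
Proof.
rewrite integral_gauss1E.
- exact: normal01_expR_sqr.
- by apply/measurable_EFinP; apply: measurableT_comp => //; exact: measurable_funM.
- by move=> x; rewrite lee_fin expR_ge0.
Qed.

(* Symmetrization: twice the left-hand side is
   the double integral of h x / h y + h y / h x = 2 cosh (ln h x - ln h y). *)
Lemma gauss1_lip (b : R) (h : R -> \bar R) : measurable_fun setT h ->
  (forall x, 0 < h x < +oo)%E ->
  (forall x y, h x <= h y * (expR (b * `|x - y|))%:E)%E ->
  (\int[gauss1]_x h x * \int[gauss1]_x (fine (h x))^-1%:E <= (expR (b ^+ 2))%:E)%E.
Proof.
move=> mh h0 hb.
pose k x := fine (h x).
have hk x : h x = (k x)%:E.
  have /andP[h1 h2] := h0 x; rewrite /k fineK//.
  by rewrite ge0_fin_numE// ltW.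
have k0 x : 0 < k x by rewrite -lte_fin -hk; have /andP[] := h0 x.
have mk : measurable_fun setT k by apply: measurableT_comp.
have mki : measurable_fun setT (fun x => (k x)^-1).
  exact: measurable_fun_invr_gt0.
have kb x y : k x <= k y * expR (b * `|x - y|).
  by rewrite -lee_fin EFinM -!hk.
(* With [t = k x / k y] between [E^-1] and [E], the sum [t + t^-1] is at most [E + E^-1]. The latter
   is even in [x - y], so the modulus disappears and the bound splits into exponentials that
   integrate separately in [x] and [y]. *)
have bound x y : k x * (k y)^-1 + k y * (k x)^-1 <=
    expR (b * x) * expR (- b * y) + expR (- b * x) * expR (b * y).
  set E := expR (b * `|x - y|); have E0 : 0 < E := expR_gt0 _.
  have -> : expR (b * x) * expR (- b * y) + expR (- b * x) * expR (b * y) = E + E^-1.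
    rewrite -!expRD /E -expRN; have [xy|/ltW xy] := leP 0 (x - y).
      by rewrite ger0_norm//; congr (expR _ + expR _); ring.
    by rewrite ler0_norm// [LHS]addrC; congr (expR _ + expR _); ring.
  have tE : k x / k y <= E by rewrite ler_pdivrMr// mulrC.
  have tE' : E^-1 <= k x / k y.
    by rewrite ler_pdivlMr// ler_pdivrMl// mulrC -/E (le_trans (kb y x))// distrC.
  rewrite -(invf_div (k x)); set t := k x / k y in tE tE' *.
  have t0 : 0 < t by rewrite divr_gt0.
  have tE1 : 1 <= t * E by rewrite -ler_pdivrMr// div1r.
  rewrite -subr_ge0 (_ : _ - _ = (E - t) * (t * E - 1) / (t * E)); last first.
    by field; rewrite !gt_eqF.
  apply: divr_ge0; first by rewrite mulr_ge0// subr_ge0.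
  by rewrite ltW// mulr_gt0.
set A := (\int[gauss1]_x h x)%E; set B := (\int[gauss1]_x _)%E.
have mE c : measurable_fun setT (fun x : R => (expR (c * x))%:E).
  by apply/measurable_EFinP; apply: measurableT_comp => //; exact: measurable_funM.
have mkE : measurable_fun setT (fun x => (k x)%:E) by apply/measurable_EFinP.
have mkiE : measurable_fun setT (fun x => (k x)^-1%:E) by apply/measurable_EFinP.
have AE : A = (\int[gauss1]_x (k x)%:E)%E by apply: eq_integral => x _; rewrite hk.
have A0 : (0 <= A)%E by rewrite AE; apply: integral_ge0 => x _; rewrite lee_fin ltW.
have B0 : (0 <= B)%E.
  by apply: integral_ge0 => x _; rewrite lee_fin invr_ge0 ltW//; exact: k0.
have kge0 x : (0 <= (k x)%:E)%E by rewrite lee_fin ltW.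
have kige0 x : (0 <= (k x)^-1%:E)%E by rewrite lee_fin invr_ge0 ltW.
have mcM (c : \bar R) (f : R -> \bar R) : measurable_fun setT f ->
    measurable_fun setT (fun x => (c * f x)%E).
  by move=> mf; apply: emeasurable_funM => //; exact: measurable_cst.
have mMc (c : \bar R) (f : R -> \bar R) : measurable_fun setT f ->
    measurable_fun setT (fun x => (f x * c)%E).
  by move=> mf; apply: emeasurable_funM => //; exact: measurable_cst.
have L1 x : (\int[gauss1]_y ((k x)%:E * (k y)^-1%:E + (k x)^-1%:E * (k y)%:E) =
    (k x)%:E * B + (k x)^-1%:E * A)%E.
  rewrite gauss1D//; do ?[by move=> y; rewrite mule_ge0|exact: mcM].
  by rewrite !gauss1Zl// -AE.
have R1 x : (\int[gauss1]_y ((expR (b * x))%:E * (expR (- b * y))%:E +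
    (expR (- b * x))%:E * (expR (b * y))%:E) =
    (expR (b * x))%:E * (expR (b ^+ 2 / 2))%:E +
    (expR (- b * x))%:E * (expR (b ^+ 2 / 2))%:E)%E.
  rewrite gauss1D//; do ?[by move=> y; rewrite mule_ge0// lee_fin expR_ge0|exact: mcM].
  by rewrite !gauss1Zl// !gauss1_expR sqrrN.
have L2 : (A * B + A * B =
    \int[gauss1]_x ((k x)%:E * B + (k x)^-1%:E * A))%E.
  rewrite gauss1D//; do ?[by move=> y; rewrite mule_ge0|exact: mMc].
  by rewrite !gauss1Zr// -AE (muleC B).
have R2 : ((expR (b ^+ 2) + expR (b ^+ 2))%:E =
    \int[gauss1]_x ((expR (b * x))%:E * (expR (b ^+ 2 / 2))%:E +
    (expR (- b * x))%:E * (expR (b ^+ 2 / 2))%:E))%E.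
  rewrite gauss1D//; do ?[by move=> y; rewrite mule_ge0// lee_fin expR_ge0|exact: mMc].
  rewrite !gauss1Zr// !gauss1_expR sqrrN -EFinM -EFinD -expRD.
  by congr (_ + _)%:E; congr expR; field.
have leR : (A * B + A * B <= (expR (b ^+ 2) + expR (b ^+ 2))%:E)%E.
  rewrite L2 R2; apply: ge0_le_integral => //.
  - by move=> x _; rewrite adde_ge0// mule_ge0.
  - by apply: emeasurable_funD; exact: mMc.
  - by apply: emeasurable_funD; exact: mMc.
  move=> x _; rewrite -L1 -R1; apply: ge0_le_integral => //.
  - by move=> y _; rewrite adde_ge0// mule_ge0.
  - by apply: emeasurable_funD; exact: mcM.
  - by apply: emeasurable_funD; exact: mcM.
  by move=> y _; rewrite -!EFinM -!EFinD lee_fin (mulrC (k x)^-1) bound.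
(* Cancelling the factor 2 needs a finite product, since an infinite one would equal its double. *)
have : (A * B \is a fin_num)%E.
  rewrite ge0_fin_numE ?mule_ge0//; rewrite ltNge; apply/negP; rewrite leye_eq => /eqP AB.
  by move: leR; rewrite AB.
move=> /fineK AB; rewrite -AB in leR *.
by move: leR; rewrite -EFinD !lee_fin; lra.
Qed.
End gauss1.

Lemma integral_gt0 d (T : measurableType d) (R : realType) (P : probability T R)
  (f : T -> \bar R) : measurable_fun setT f -> (forall x, 0 < f x)%E ->
  (0 < \int[P]_x f x)%E.
Proof.
move=> mf f0; rewrite lt0e integral_ge0 ?andbT => [|x _]; last exact: ltW.
apply/eqP => If0.
have /(ae_eq_integral_abs P measurableT mf) : (\int[P]_x `|f x| = 0)%E.
  by rewrite -[RHS]If0; apply: eq_integral => x _; rewrite gee0_abs// ltW.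
move=> [N [mN N0 sub]].
have NT : N = setT.
  apply/seteqP; split => // x _; apply: sub => /= /(_ I) /= fx0.
  by have := f0 x; rewrite fx0 ltxx.
have : (1 <= 0 :> \bar R)%E by rewrite -[leRHS]N0 NT -(@probability_setT _ _ _ P).
by rewrite leNgt lte01.
Qed.

(** * Product Gaussian measure on tuples *)

Section gaussn.
Context (R : realType).
Local Notation gam := (@gauss1 R).

Definition cons_pair n (z : R * n.-tuple R) : n.+1.-tuple R := [tuple of z.1 :: z.2].

Lemma measurable_cons_pair n : measurable_fun setT (@cons_pair n).
Proof. exact: measurable_cons. Qed.

HB.instance Definition _ n := isMeasurableFun.Build _ _ _ _ (@cons_pair n)
  (@measurable_cons_pair n).

(** A recursion on the first coordinate, so that the change of variables and the concentration bound
    both follow from dimension one by induction. *)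
Fixpoint gaussn n : probability (n.-tuple R) R :=
  match n with
  | 0 => \d_[tuple]
  | n.+1 => distribution (gam \x gaussn n)%E (@cons_pair n)
  end.

Lemma ge0_integral_gaussnS n (f : n.+1.-tuple R -> \bar R) : measurable_fun setT f ->
  (forall t, 0 <= f t)%E ->
  (\int[gaussn n.+1]_t f t = \int[gam]_x \int[gaussn n]_t f [tuple of x :: t])%E.
Proof.
move=> mf f0 /=.
rewrite ge0_integral_distribution// fubini_tonelli1//.
- exact: measurableT_comp.
- by move=> z /=.
Qed.

Lemma measurable_cons1 n (x : R) : measurable_fun setT (fun t : n.-tuple R => [tuple of x :: t]).
Proof. exact: measurable_cons. Qed.

Lemma measurable_int_gaussn n (f : n.+1.-tuple R -> \bar R) : measurable_fun setT f ->
  (forall t, 0 <= f t)%E ->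
  measurable_fun setT (fun x : R => \int[gaussn n]_t f [tuple of x :: t])%E.
Proof.
move=> mf f0.
have mF : measurable_fun setT (f \o @cons_pair n) by exact: measurableT_comp.
exact: (@measurable_fun_fubini_tonelli_F _ _ _ _ _ (gaussn n) _ mF (fun z => f0 _)).
Qed.

Definition affn n (chi c : nat -> R) (t : n.-tuple R) : n.-tuple R :=
  [tuple chi i * tnth t i + c i | i < n].
Definition linn n (c : nat -> R) (t : n.-tuple R) : R := \sum_(i < n) c i * tnth t i.

Lemma measurable_affn n chi c : measurable_fun setT (@affn n chi c).
Proof.
apply/measurable_fun_tnthP => i.
rewrite (_ : _ \o _ = fun t => chi i * tnth t i + c i); last first.
  by apply/funext => t; rewrite /= tnth_mktuple.
apply: measurable_funD => //; apply: measurable_funM => //; exact: measurable_tnth.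
Qed.

Lemma measurable_linn n c : measurable_fun setT (@linn n c).
Proof.
apply: measurable_sum => i; apply: measurable_funM => //; exact: measurable_tnth.
Qed.

Lemma affn_cons n chi c x (t : n.-tuple R) : affn n.+1 chi c [tuple of x :: t] =
  [tuple of chi 0%N * x + c 0%N :: affn n (chi \o S) (c \o S) t].
Proof.
apply: eq_from_tnth => i; rewrite tnth_mktuple.
case: (unliftP ord0 i) => [j|] ->; last by rewrite !tnth0.
by rewrite !tnthS tnth_mktuple.
Qed.

Lemma linn_cons n c x (t : n.-tuple R) : linn n.+1 c [tuple of x :: t] =
  c 0%N * x + linn n (c \o S) t.
Proof.
rewrite /linn big_ord_recl tnth0; congr (_ + _).
by apply: eq_bigr => i _; rewrite tnthS.
Qed.

Definition tbehead n (t : n.+1.-tuple R) : n.-tuple R := [tuple of behead t].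

Lemma tbehead_cons n (x : R) (t : n.-tuple R) : tbehead n [tuple of x :: t] = t.
Proof. exact: val_inj. Qed.

Lemma measurable_tbehead n : measurable_fun setT (tbehead n).
Proof. exact: measurable_behead. Qed.

(** The integral over the tail is treated by induction, the first coordinate by [gauss1_affine]. The
    parameters are sequences on [nat], so that passing to the tail is composition with [S]. *)
Lemma gaussn_affine n (chi c : nat -> R) (f : n.-tuple R -> \bar R) :
  (forall i, chi i ^+ 2 = 1) -> measurable_fun setT f -> (forall t, 0 <= f t)%E ->
  (\int[gaussn n]_t f (affn n chi c t) =
   \int[gaussn n]_t (f t * (expR (linn n c t - (\sum_(i < n) c i ^+ 2) / 2))%:E))%E.
Proof.
elim: n chi c f => [|n IH] chi c f chi2 mf f0.
  apply: eq_integral => t _.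
  rewrite /linn !big_ord0 mul0r subr0 expR0 mule1; congr f.
  by rewrite [LHS]tuple0 [RHS]tuple0.
have mexp m c' k : measurable_fun setT (fun t : m.-tuple R => (expR (linn m c' t - k))%:E).
  apply/measurable_EFinP; apply: measurableT_comp => //.
  by apply: measurable_funB => //; exact: measurable_linn.
have mfa : measurable_fun setT (fun t => f (affn n.+1 chi c t)).
  exact: measurableT_comp mf (measurable_affn _ _ _).
have mfe : measurable_fun setT (fun t => (f t * (expR (linn n.+1 c t -
    (\sum_(i < n.+1) c i ^+ 2) / 2))%:E)%E).
  exact: emeasurable_funM mf (mexp _ _ _).
have fe0 t : (0 <= f t * (expR (linn n.+1 c t - (\sum_(i < n.+1) c i ^+ 2) / 2))%:E)%E.
  by rewrite mule_ge0// lee_fin expR_ge0.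
rewrite (ge0_integral_gaussnS _ _ mfa)// (ge0_integral_gaussnS _ _ mfe fe0).
under eq_integral do under eq_integral do rewrite affn_cons.
pose g (x : R) (t : n.-tuple R) := (f [tuple of x :: t] * (expR (linn n (c \o S) t - (\sum_(i < n) (c \o S) i ^+ 2) / 2))%:E)%E.
(* [f1] attaches the factor of the tail to a function of the whole tuple, which makes the partial
   integral measurable in [x]. *)
pose f1 (t : n.+1.-tuple R) := (f t * (expR (linn n (c \o S) (tbehead n t) - (\sum_(i < n) (c \o S) i ^+ 2) / 2))%:E)%E.
have mf1 : measurable_fun setT f1.
  apply: emeasurable_funM => //.
  apply: (measurableT_comp (mexp n (c \o S) _)); exact: measurable_tbehead.
have f1E (x : R) (t : n.-tuple R) : f1 [tuple of x :: t] = g x t.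
  by rewrite /f1 /g tbehead_cons.
have f10 t : (0 <= f1 t)%E by rewrite mule_ge0// lee_fin expR_ge0.
have mc1 (h : n.+1.-tuple R -> \bar R) x : measurable_fun setT h ->
    measurable_fun setT (fun t : n.-tuple R => h [tuple of x :: t]).
  by move=> mh; exact: measurableT_comp mh (measurable_cons1 n x).
transitivity (\int[gam]_x (\int[gaussn n]_t f1 [tuple of (chi 0%N * x + c 0%N)%R :: t]))%E.
  apply: eq_integral => x _.
  have mfx := mc1 f (chi 0%N * x + c 0%N) mf.
  rewrite (IH (chi \o S) (c \o S) _ (fun i => chi2 i.+1) mfx (fun t => f0 _)).
  by apply: eq_integral => t _; rewrite f1E.
have mG := measurable_int_gaussn _ f1 mf1 f10.
pose G1 (x : R) := (\int[gaussn n]_t f1 [tuple of x :: t])%E.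
have G10 x : (0 <= G1 x)%E by apply: integral_ge0 => t _; exact: f10.
have GE := gauss1_affine _ (chi 0%N) (c 0%N) G1 (chi2 0%N) mG G10.
apply: (eq_trans GE).
apply: eq_integral => x _.
rewrite -ge0_integralZr; [|exact: measurableT|exact: mc1|by move=> t _; exact: f10|by rewrite lee_fin expR_ge0].
apply: eq_integral => t _; rewrite f1E /g -muleA -EFinM -expRD linn_cons big_ord_recl.
by congr (_ * (expR _)%:E)%E; rewrite mulrDl /=; ring.
Qed.

Lemma gaussn_box n (A : nat -> set R) : (forall i, measurable (A i)) ->
  gaussn n [set t | forall i : 'I_n, A i (tnth t i)] = (\prod_(i < n) gam (A i))%E.
Proof.
elim: n A => [|n IH] A mA.
  by rewrite big_ord0 (_ : [set t | _] = setT) ?probability_setT//; apply/seteqP; split => // t _ [].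
set B := [set t | forall i : 'I_n, (A \o S) i (tnth t i)].
have mB : measurable B.
  rewrite (_ : B = \bigcap_(i in [set: 'I_n]) (fun t => tnth t i) @^-1` (A i.+1)).
    apply: fin_bigcap_measurable => // i _; rewrite -[X in measurable X]setTI.
    exact: measurable_tnth.
  by apply/seteqP; split => [t H i _|t H i]; apply: H.
transitivity ((gam \x gaussn n)%E (A 0%N `*` B)).
  rewrite /= /distribution /pushforward; congr (_ \x _)%E.
  apply/seteqP; split => [[x t] /= H|[x t] /= [Hx Ht] i].
    split; first by have := H ord0; rewrite tnth0.
    by move=> i; have := H (lift ord0 i); rewrite tnthS.
  by case: (unliftP ord0 i) => [j|] ->; rewrite ?tnth0// tnthS; exact: Ht.
rewrite big_ord_recl product_measure1E//; congr (_ * _)%E.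
exact: (IH (A \o S) (fun i => mA i.+1)).
Qed.

(** Tensorization. At each value of the first coordinate the induction gives [H x * K x <= E'],
    where [H] and [K] are the partial integrals of [h] and of its inverse. So the integral of [K] is
    at most [E'] times that of the inverse of [H], and [gauss1_lip] applies to [H]. *)
Lemma gaussn_lip n (b : nat -> R) (h : n.-tuple R -> \bar R) : measurable_fun setT h ->
  (forall t, 0 < h t < +oo)%E ->
  (forall s t, h s <= h t * (expR (\sum_(i < n) b i * `|tnth s i - tnth t i|))%:E)%E ->
  (\int[gaussn n]_t h t * \int[gaussn n]_t (fine (h t))^-1%:E <=
    (expR (\sum_(i < n) b i ^+ 2))%:E)%E.
Proof.
elim: n b h => [|n IH] b h mh h0 hb.
  have hf t : h t = (fine (h t))%:E.
    have /andP[h1 h2] := h0 t; by rewrite fineK// ge0_fin_numE// ltW.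
  have fh0 t : 0 < fine (h t) by rewrite -lte_fin -hf; have /andP[] := h0 t.
  have mih : measurable_fun setT (fun t => (fine (h t))^-1%:E).
    by apply/measurable_EFinP; apply: measurable_fun_invr_gt0 => //; exact: measurableT_comp.
  rewrite /= integral_dirac// integral_dirac// diracT !mul1e hf -EFinM mulfV ?gt_eqF//.
  by rewrite big_ord0 expR0.
have hf t : h t = (fine (h t))%:E.
  have /andP[h1 h2] := h0 t; by rewrite fineK// ge0_fin_numE// ltW.
have fh0 t : 0 < fine (h t) by rewrite -lte_fin -hf; have /andP[] := h0 t.
have mfh : measurable_fun setT (fun t => fine (h t)) by exact: measurableT_comp.
have mih : measurable_fun setT (fun t => (fine (h t))^-1%:E).
  by apply/measurable_EFinP; exact: measurable_fun_invr_gt0.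
have h1 t : (0 <= h t)%E by have /andP[/ltW] := h0 t.
have ih0 t : (0 <= (fine (h t))^-1%:E)%E by rewrite lee_fin invr_ge0 ltW.
have mc1 (g : n.+1.-tuple R -> \bar R) x : measurable_fun setT g ->
    measurable_fun setT (fun t : n.-tuple R => g [tuple of x :: t]).
  by move=> mg; exact: measurableT_comp mg (measurable_cons1 n x).
rewrite (ge0_integral_gaussnS _ _ mh h1) (ge0_integral_gaussnS _ _ mih ih0).
pose H (x : R) := (\int[gaussn n]_t h [tuple of x :: t])%E.
pose K (x : R) := (\int[gaussn n]_t (fine (h [tuple of x :: t]))^-1%:E)%E.
set E' := expR (\sum_(i < n) b i.+1 ^+ 2).
have HK x : (H x * K x <= E'%:E)%E.
  apply: (IH (b \o S) (fun t => h [tuple of x :: t])); first exact: mc1.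
    by move=> t; exact: h0.
  move=> s t; have := hb [tuple of x :: s] [tuple of x :: t].
  rewrite big_ord_recl !tnth0 subrr normr0 mulr0 add0r.
  by under eq_bigr do rewrite !tnthS.
have H0 x : (0 < H x)%E.
  apply: (integral_gt0 _ _ _ (gaussn n) _ (mc1 _ x mh)) => t.
  by have /andP[] := h0 [tuple of x :: t].
have K0 x : (0 < K x)%E.
  apply: (integral_gt0 _ _ _ (gaussn n) _ (mc1 _ x mih)) => t.
  by rewrite lte_fin invr_gt0.
have Hoo x : (H x < +oo)%E.
  rewrite ltey; apply/eqP => Hx; have := HK x.
  by rewrite Hx gt0_mulye.
have Hf x : H x = (fine (H x))%:E by by rewrite fineK// ge0_fin_numE// ltW.
have fH0 x : 0 < fine (H x) by rewrite -lte_fin -Hf.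
have mH : measurable_fun setT H := measurable_int_gaussn _ _ mh h1.
have mK : measurable_fun setT K := measurable_int_gaussn _ _ mih ih0.
have KH x : (K x <= E'%:E * (fine (H x))^-1%:E)%E.
  have := HK x; rewrite {1}Hf => HKx.
  have -> : K x = ((fine (H x))^-1%:E * ((fine (H x))%:E * K x))%E.
    by rewrite muleA -EFinM mulVf ?gt_eqF// mul1e.
  by rewrite muleC lee_wpmul2r// lee_fin invr_ge0 ltW.
(* Integrating out the other coordinates preserves the multiplicative Lipschitz bound in the first
   one. *)
have Hlip x y : (H x <= H y * (expR (b 0%N * `|x - y|))%:E)%E.
  rewrite -ge0_integralZr; [|exact: measurableT|exact: mc1|by move=> t _; exact: h1|by rewrite lee_fin expR_ge0].
  apply: ge0_le_integral; first exact: measurableT.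
  - by move=> t _; exact: h1.
  - exact: mc1.
  - by apply: emeasurable_funM; [exact: mc1|exact: measurable_cst].
  move=> t _; have := hb [tuple of x :: t] [tuple of y :: t].
  rewrite big_ord_recl !tnth0 big1 ?addr0// => i _.
  by rewrite !tnthS subrr normr0 mulr0.
have mHi : measurable_fun setT (fun x => (fine (H x))^-1%:E).
  apply/measurable_EFinP; apply: measurable_fun_invr_gt0 => //.
  exact: measurableT_comp.
have L1 := gauss1_lip _ (b 0%N) H mH (fun x => introT andP (conj (H0 x) (Hoo x))) Hlip.
apply: (@le_trans _ _ (\int[gam]_x H x * (E'%:E * \int[gam]_x (fine (H x))^-1%:E))%E).
  apply: lee_wpmul2l; first by apply: integral_ge0 => x _; exact: (ltW (H0 x)).
  rewrite -ge0_integralZl; [|exact: measurableT|exact: mHi|by move=> x _; rewrite lee_fin invr_ge0 (ltW (fH0 x))|by rewrite lee_fin expR_ge0].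
  apply: ge0_le_integral; first exact: measurableT.
  - by move=> x _; exact: (ltW (K0 x)).
  - exact: mK.
  - by apply: emeasurable_funM; [exact: measurable_cst|exact: mHi].
  - by move=> x _; exact: KH.
rewrite muleCA big_ord_recl addrC expRD EFinM.
by apply: lee_wpmul2l; [rewrite lee_fin expR_ge0|exact: L1].
Qed.

End gaussn.

(** * Gaussian vectors *)

Section vectors.
Context (R : realType) (I : finType).

(** Literally the generating family in [tmeasurable], so that on tensors the two notions of
    measurability agree by conversion. *)
Definition coord_sets : set (set (I -> R)) :=
  [set (fun Y : I -> R => Y i) @^-1` B | i in [set: I] & B in [set B : set R | measurable B]].

Definition vect := g_sigma_algebraType coord_sets.

Definition boxes : set (set vect) :=
  [set [set x : vect | forall i, A i (x i)] | A in [set A : I -> set R | forall i, measurable (A i)]].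

Lemma measurable_coord (i : I) : measurable_fun setT (fun x : vect => x i).
Proof.
move=> _ B mB; rewrite setTI; apply: sub_sigma_algebra.
by exists i => //; exists B.
Qed.

Lemma measurable_vectP d (T : measurableType d) (f : T -> vect) :
  (forall i, measurable_fun setT (fun t => f t i)) -> measurable_fun setT f.
Proof.
move=> mf; apply: (@measurability _ _ T vect setT f coord_sets erefl) => _ [_ [i _ [B mB <-]] <-].
exact: (mf i measurableT B mB).
Qed.

Lemma measurable_box (A : I -> set R) : (forall i, measurable (A i)) ->
  measurable [set x : vect | forall i, A i (x i)].
Proof.
move=> mA; rewrite (_ : [set x : vect | _] = \bigcap_(i in [set: I]) (fun x : vect => x i) @^-1` (A i)).
  apply: fin_bigcap_measurable => // i _; rewrite -[X in measurable X]setTI.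
  exact: measurable_coord.
by apply/seteqP; split => [t H i _|t H i]; apply: H.
Qed.

Lemma boxes_generate : <<s boxes >> = <<s coord_sets >>.
Proof.
apply/seteqP; split; apply: smallest_sub; do ?exact: smallest_sigma_algebra.
  by move=> _ [A mA <-]; exact: measurable_box.
move=> _ [i _ [B mB <-]]; apply: sub_sigma_algebra.
exists (fun j => if j == i then B else setT) => /= [j|]; first by case: ifP.
apply/seteqP; split => [x /= /(_ i)|x /= xB j]; first by rewrite eqxx.
by case: eqP => // ->.
Qed.

(** Boxes are stable under intersection, contain the whole space and generate the sigma-algebra. *)
Lemma boxes_unique (m1 m2 : {measure set vect -> \bar R}) : (m1 setT < +oo)%E ->
  (forall A : I -> set R, (forall i, measurable (A i)) ->
    m1 [set x : vect | forall i, A i (x i)] = m2 [set x : vect | forall i, A i (x i)]) ->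
  forall E, measurable E -> m1 E = m2 E.
Proof.
move=> m1oo H E mE.
have BT : boxes setT.
  by exists (fun=> setT) => //; apply/seteqP; split.
apply: (g_sigma_algebra_measure_unique boxes _ (fun=> setT)) => //.
- by move=> _ [A mA <-]; exact: measurable_box.
- by apply/seteqP; split => // x _; exists 0%N.
- move=> _ _ [A mA <-] [B mB <-]; exists (fun i => A i `&` B i).
    by move=> i; exact: measurableI.
  by apply/seteqP; split => x /= => [H0|[H1 H2] i]; [split=> i; have [] := H0 i|split].
- by move=> _ [A mA <-]; exact: H.
- by rewrite boxes_generate.
Qed.

Definition tup_vect (t : #|I|.-tuple R) : vect := fun i => tnth t (enum_rank i).

Lemma measurable_tup_vect : measurable_fun setT tup_vect.
Proof. by apply: measurable_vectP => i; exact: measurable_tnth. Qed.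

HB.instance Definition _ := isMeasurableFun.Build _ _ _ _ tup_vect measurable_tup_vect.

Definition gauss : probability vect R := distribution (gaussn R #|I|) tup_vect.

Lemma gauss_tup (f : vect -> \bar R) : measurable_fun setT f -> (forall x, 0 <= f x)%E ->
  (\int[gauss]_x f x = \int[gaussn R #|I|]_t f (tup_vect t))%E.
Proof.
by move=> mf f0; rewrite ge0_integral_distribution.
Qed.

(* Coordinates of vect are indexed by I, those of tuples by nat. *)
Definition natf (c0 : R) (c : I -> R) (k : nat) : R :=
  if insub k is Some o then c (enum_val (o : 'I_#|I|)) else c0.

Lemma natfE c0 c (i : 'I_#|I|) : natf c0 c i = c (enum_val i).
Proof. by rewrite /natf valK. Qed.

Lemma sum_natf c0 (c : I -> R) (F : R -> 'I_#|I| -> R) (G : I -> R) :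
  (forall i, F (c i) (enum_rank i) = G i) ->
  \sum_(k < #|I|) F (natf c0 c k) k = \sum_i G i.
Proof.
move=> FG; rewrite (reindex (@enum_rank I))/=; last first.
  by exists enum_val => i _; [exact: enum_rankK|exact: enum_valK].
by apply: eq_bigr => i _; rewrite natfE enum_rankK FG.
Qed.

Lemma gauss_affine (chi c : I -> R) (f : vect -> \bar R) :
  (forall i, chi i ^+ 2 = 1) -> measurable_fun setT f -> (forall x, 0 <= f x)%E ->
  (\int[gauss]_x f (fun i => chi i * x i + c i)%R =
   \int[gauss]_x (f x * (expR (\sum_i c i * x i - (\sum_i c i ^+ 2) / 2))%:E))%E.
Proof.
move=> chi2 mf f0.
have maff : measurable_fun setT ((fun x i => chi i * x i + c i) : vect -> vect).
  apply: measurable_vectP => i; apply: measurable_funD => //.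
  by apply: measurable_funM => //; exact: measurable_coord.
have mexp : measurable_fun setT (fun x : vect => (expR (\sum_i c i * x i - (\sum_i c i ^+ 2) / 2))%:E).
  apply/measurable_EFinP; apply: measurableT_comp => //; apply: measurable_funB => //.
  by apply: measurable_sum => i; apply: measurable_funM => //; exact: measurable_coord.
have mfa : measurable_fun setT (fun x : vect => f (fun i => chi i * x i + c i)%R).
  exact: (measurableT_comp mf maff).
have mft : measurable_fun setT (f \o tup_vect) by exact: measurableT_comp.
rewrite (gauss_tup _ mfa)// (gauss_tup _ (emeasurable_funM mf mexp)); last first.
  by move=> x; rewrite mule_ge0// lee_fin expR_ge0.
have chi2' i : natf 1 chi i ^+ 2 = 1.
  by rewrite /natf; case: insub => [k|]; rewrite ?chi2// expr1n.
have E := gaussn_affine R #|I| (natf 1 chi) (natf 0 c) _ chi2' mft (fun t => f0 _).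
transitivity (\int[gaussn R #|I|]_t (f \o tup_vect) (affn _ _ (natf 1 chi) (natf 0 c) t))%E.
  apply: eq_integral => t _ /=; congr (f _); apply/funext => i.
  by rewrite /tup_vect tnth_mktuple !natfE enum_rankK.
apply: (eq_trans E); apply: eq_integral => t _.
have -> : linn R #|I| (natf 0 c) t = \sum_i c i * tup_vect t i.
  by rewrite /linn; apply: (sum_natf 0 c (fun y k => y * tnth t k)).
by rewrite (sum_natf 0 c (fun y k => y ^+ 2) (fun i => c i ^+ 2)).
Qed.

Lemma gauss_lip (b : I -> R) (h : vect -> R) : measurable_fun setT h ->
  (forall x, 0 < h x) ->
  (forall x y : vect, h x <= h y * expR (\sum_i b i * `|x i - y i|)) ->
  (\int[gauss]_x (h x)%:E * \int[gauss]_x (h x)^-1%:E <= (expR (\sum_i b i ^+ 2))%:E)%E.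
Proof.
move=> mh h0 hb.
have mhE : measurable_fun setT (fun x => (h x)%:E) by exact/measurable_EFinP.
have mhi : measurable_fun setT (fun x => (h x)^-1%:E).
  by apply/measurable_EFinP; exact: measurable_fun_invr_gt0.
rewrite (gauss_tup _ mhE); last by move=> x; rewrite lee_fin ltW.
rewrite (gauss_tup _ mhi); last by move=> x; rewrite lee_fin invr_ge0 ltW.
have -> : \sum_i b i ^+ 2 = \sum_(k < #|I|) natf 0 b k ^+ 2.
  by apply/esym; exact: (sum_natf 0 b (fun y k => y ^+ 2)).
apply: (gaussn_lip R #|I| (natf 0 b) (fun t => (h (tup_vect t))%:E)).
- exact: (measurableT_comp mhE measurable_tup_vect).
- by move=> t; rewrite lte_fin h0 ltry.
move=> s t; rewrite -EFinM lee_fin (sum_natf 0 b (fun y k => y * `|tnth s k - tnth t k|) 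
  (fun i => b i * `|tup_vect s i - tup_vect t i|))//.
Qed.

Lemma gauss_box (A : I -> set R) : (forall i, measurable (A i)) ->
  gauss [set x : vect | forall i, A i (x i)] = (\prod_i gauss1 R (A i))%E.
Proof.
move=> mA.
pose A' k := if insub k is Some o then A (enum_val (o : 'I_#|I|)) else setT.
have mA' k : measurable (A' k) by rewrite /A'; case: insub.
have A'E (i : 'I_#|I|) : A' i = A (enum_val i) by rewrite /A' valK.
transitivity (gaussn R #|I| [set t | forall i : 'I_#|I|, A' i (tnth t i)]).
  rewrite /gauss /distribution /pushforward; apply: (congr1 (gaussn R #|I|)).
  apply/seteqP; split => t /= H i; rewrite ?A'E.
    by have := H (enum_val i); rewrite /tup_vect enum_valK.
  by have := H (enum_rank i); rewrite A'E enum_rankK.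
rewrite gaussn_box// (reindex (@enum_rank I))/=; last first.
  by exists enum_val => i _; [exact: enum_rankK|exact: enum_valK].
by apply: eq_bigr => i _; rewrite A'E enum_rankK.
Qed.

(** The factor [c] lets the law of the noise be identified on an event of probability [c], which
    will be a given value of the planted spin. *)
Lemma gauss_unique (nu : {measure set vect -> \bar R}) (c : {nonneg R}) :
  (forall A : I -> set R, (forall i, measurable (A i)) ->
    nu [set x : vect | forall i, A i (x i)] = (c%:num%:E * \prod_i gauss1 R (A i))%E) ->
  forall E, measurable E -> nu E = (c%:num%:E * gauss E)%E.
Proof.
move=> H E mE.
apply: (boxes_unique nu (mscale c gauss)) => //.
  have := H (fun=> setT) (fun=> measurableT).
  rewrite (_ : [set x : vect | _] = setT); last by apply/seteqP.
  move=> ->; rewrite big1 ?mule1 ?ltry// => i _; exact: probability_setT.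
by move=> A mA; rewrite H// -(gauss_box A mA).
Qed.

End vectors.

Notation ind b := (((b%R) : bool)%:R).

(** * Functions of exponential growth and their Gaussian means *)

Section tame.
Context (R : realType) (I : finType).
Notation V := (vect R I).
Notation G := (gauss R I).

(** Since [fine] sends an infinite integral to 0, linearity and monotonicity are stated for [tame]
    functions. *)
Definition mean (f : V -> R) : R := fine (\int[G]_x (f x)%:E)%E.

Definition l1norm (x : V) : R := \sum_i `|x i|.

Lemma l1norm_ge0 x : 0 <= l1norm x.
Proof. by apply: sumr_ge0 => i _. Qed.

Lemma measurable_l1norm : measurable_fun setT l1norm.
Proof.
apply: measurable_sum => i; apply: measurableT_comp => //.
exact: measurable_coord.
Qed.

(** An algebra of integrable functions. It contains the exponentials of linear forms, and its
    stability under sums and products replaces separate integrability proofs. *)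
Definition tame (f : V -> R) : Prop := measurable_fun setT f /\
  exists2 C, 0 <= C & forall x, `|f x| <= C * expR (C * l1norm x).

Lemma tame_measurable f : tame f -> measurable_fun setT f.
Proof. by case. Qed.

Lemma measurable_lin (c : I -> R) : measurable_fun setT (fun x : V => \sum_i c i * x i).
Proof.
by apply: measurable_sum => i; apply: measurable_funM => //; exact: measurable_coord.
Qed.

Lemma gauss_expR_lin (c : I -> R) :
  (\int[G]_x (expR (\sum_i c i * x i))%:E = (expR ((\sum_i c i ^+ 2) / 2))%:E)%E.
Proof.
have H := gauss_affine R I (fun=> 1) c (cst 1%E) (fun=> expr1n _ _) (measurable_cst _) (fun=> lee01).
have me : measurable_fun setT (fun x : V => (expR (\sum_i c i * x i - (\sum_i c i ^+ 2) / 2))%:E).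
  apply/measurable_EFinP; apply: measurableT_comp => //; apply: measurable_funB => //.
  exact: measurable_lin.
transitivity ((expR ((\sum_i c i ^+ 2) / 2))%:E *
    \int[G]_x (cst 1%E x * (expR (\sum_i c i * x i - (\sum_i c i ^+ 2) / 2))%:E))%E.
  rewrite -ge0_integralZl; [|exact: measurableT|by apply: emeasurable_funM|
    by move=> x _; rewrite mul1e lee_fin expR_ge0|by rewrite lee_fin expR_ge0].
  by apply: eq_integral => x _; rewrite mul1e -EFinM -expRD; congr (expR _)%:E; ring.
by rewrite -H integral_cst//= probability_setT !mule1.
Qed.

(** The exponential of a modulus is at most the sum of its two signed versions. Expanding the
    product over coordinates leaves one exponential of a linear form per sign pattern, each with an
    explicit Gaussian mean. *)
Lemma expR_l1norm_le C x : 0 <= C -> expR (C * l1norm x) <=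
  \sum_(e : {ffun I -> bool}) expR (\sum_i C * (-1) ^+ e i * x i).
Proof.
move=> C0; rewrite /l1norm mulr_sumr expR_sum.
apply: (@le_trans _ _ (\prod_i \sum_(e : bool) expR (C * (-1) ^+ e * x i))).
  apply: ler_prod => i _; rewrite expR_ge0/= big_bool /= expr1 expr0 mulrN1 mulr1 mulNr.
  have [xi|/ltW xi] := leP 0 (x i).
    by rewrite ger0_norm// lerDr expR_ge0.
  by rewrite ler0_norm// mulrN lerDl expR_ge0.
rewrite bigA_distr_bigA/=; apply: ler_sum => e _.
by rewrite -expR_sum.
Qed.

Lemma integral_expR_l1norm C : 0 <= C -> (\int[G]_x (expR (C * l1norm x))%:E < +oo)%E.
Proof.
move=> C0.
have me (e : {ffun I -> bool}) : measurable_fun setT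
    (fun x : V => (expR (\sum_i C * (-1) ^+ e i * x i))%:E).
  by apply/measurable_EFinP; apply: measurableT_comp => //; exact: (measurable_lin (fun i => _)).
apply: (@le_lt_trans _ _ (\int[G]_x (\sum_(e : {ffun I -> bool})
    (expR (\sum_i C * (-1) ^+ e i * x i))%:E))%E).
  apply: ge0_le_integral => //.
  - apply/measurable_EFinP; apply: measurableT_comp => //.
    by apply: measurable_funM => //; exact: measurable_l1norm.
  - by apply: emeasurable_sum => e; exact: me.
  by move=> x _; rewrite sumEFin lee_fin expR_l1norm_le.
rewrite ge0_integral_sum//.
under eq_bigr do rewrite gauss_expR_lin.
by rewrite sumEFin ltry.
Qed.

Lemma tame_integrable f : tame f -> G.-integrable setT (EFin \o f).
Proof.
move=> [mf [C C0 fC]]; apply/integrableP; split; first exact/measurable_EFinP.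
have mC : measurable_fun setT (fun x : V => (expR (C * l1norm x))%:E).
  apply/measurable_EFinP; apply: measurableT_comp => //.
  by apply: measurable_funM => //; exact: measurable_l1norm.
apply: (@le_lt_trans _ _ (C%:E * \int[G]_x (expR (C * l1norm x))%:E)%E).
  rewrite -ge0_integralZl//.
  apply: ge0_le_integral => //.
  - by apply: measurableT_comp => //; exact/measurable_EFinP.
  - by apply: emeasurable_funM => //; exact: measurable_cst.
  by move=> x _ /=; rewrite -EFinM lee_fin.
by apply: lte_mul_pinfty => //; exact: integral_expR_l1norm.
Qed.

Lemma tame_bound (f : V -> R) c : measurable_fun setT f -> (forall x, `|f x| <= c) -> tame f.
Proof.
move=> mf fc; split => //; exists (Num.max 0 c); first by rewrite le_max lexx.
move=> x; apply: (le_trans (fc x)).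
apply: (@le_trans _ _ (Num.max 0 c)); first by rewrite le_max lexx orbT.
rewrite ler_peMr ?le_max ?lexx// -expR0 ler_expR mulr_ge0 ?l1norm_ge0//.
by rewrite le_max lexx.
Qed.

Lemma tame_cst c : tame (cst c).
Proof. by apply: (tame_bound _ `|c|). Qed.

Lemma tame_le (f g : V -> R) : measurable_fun setT f -> tame g -> (forall x, `|f x| <= `|g x|) -> tame f.
Proof.
move=> mf [mg [C C0 gC]] fg; split => //; exists C => // x.
exact: le_trans (fg x) (gC x).
Qed.

Lemma tameD f g : tame f -> tame g -> tame (fun x => f x + g x).
Proof.
move=> [mf [C C0 fC]] [mg [D D0 gD]]; split; first exact: measurable_funD.
exists (C + D) => [|x]; first exact: addr_ge0.
apply: (le_trans (ler_normD _ _)); rewrite mulrDl; apply: lerD.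
  apply: (le_trans (fC x)); apply: ler_wpM2l => //; rewrite ler_expR.
  by rewrite ler_wpM2r ?l1norm_ge0// lerDl.
apply: (le_trans (gD x)); apply: ler_wpM2l => //; rewrite ler_expR.
by rewrite ler_wpM2r ?l1norm_ge0// lerDr.
Qed.

Lemma tameM f g : tame f -> tame g -> tame (fun x => f x * g x).
Proof.
move=> [mf [C C0 fC]] [mg [D D0 gD]]; split; first exact: measurable_funM.
exists (C * D + C + D) => [|x]; first by rewrite !addr_ge0 ?mulr_ge0.
rewrite normrM; apply: (@le_trans _ _ ((C * expR (C * l1norm x)) * (D * expR (D * l1norm x)))).
  by apply: ler_pM.
rewrite mulrACA -expRD -mulrDl; apply: ler_pM; rewrite ?mulr_ge0 ?expR_ge0//.
  by rewrite -addrA lerDl addr_ge0.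
by rewrite ler_expR ler_wpM2r ?l1norm_ge0// -addrA lerDr mulr_ge0.
Qed.

Lemma tameZ c f : tame f -> tame (fun x => c * f x).
Proof. by move=> tf; apply: tameM => //; exact: tame_cst. Qed.

Lemma tameN f : tame f -> tame (fun x => - f x).
Proof.
move=> tf; have := tameZ (-1) f tf; congr tame; by apply/funext => x; rewrite mulN1r.
Qed.

Lemma tameB f g : tame f -> tame g -> tame (fun x => f x - g x).
Proof. by move=> tf tg; apply: tameD => //; exact: tameN. Qed.

Lemma tame_sum (J : Type) (s : seq J) (P : pred J) (f : J -> V -> R) :
  (forall j, tame (f j)) -> tame (fun x => \sum_(j <- s | P j) f j x).
Proof.
move=> tf; elim: s => [|j s IH].
  under eq_fun do rewrite big_nil; exact: tame_cst.
under eq_fun do rewrite big_cons.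
by case: (P j) => //; apply: tameD.
Qed.

Lemma lin_l1norm (c : I -> R) x : `|\sum_i c i * x i| <= (\sum_i `|c i|) * l1norm x.
Proof.
apply: (le_trans (ler_norm_sum _ _ _)); rewrite mulr_sumr; apply: ler_sum => i _.
rewrite normrM ler_wpM2r//; rewrite (bigD1 i)//= lerDl; exact: sumr_ge0.
Qed.

Lemma tame_expR_lin (c : I -> R) k : tame (fun x => expR (\sum_i c i * x i + k)).
Proof.
split.
  apply: measurableT_comp => //; apply: measurable_funD => //; exact: measurable_lin.
exists (expR k + \sum_i `|c i|) => [|x].
  by rewrite addr_ge0 ?expR_ge0//; exact: sumr_ge0.
rewrite ger0_norm ?expR_ge0// expRD mulrC; apply: ler_pM; rewrite ?expR_ge0//.
  by rewrite lerDl; exact: sumr_ge0.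
rewrite ler_expR; apply: (le_trans (ler_norm _)); apply: (le_trans (lin_l1norm _ _)).
by rewrite ler_wpM2r ?l1norm_ge0// lerDr expR_ge0.
Qed.

Lemma tame_lin (c : I -> R) : tame (fun x => \sum_i c i * x i).
Proof.
split; first exact: measurable_lin.
exists (1 + \sum_i `|c i|) => [|x]; first by rewrite addr_ge0//; exact: sumr_ge0.
have S0 : 0 <= \sum_i `|c i| by exact: sumr_ge0.
have n0 := l1norm_ge0 x.
apply: (le_trans (lin_l1norm _ _)).
apply: (@le_trans _ _ (1 * expR ((1 + \sum_i `|c i|) * l1norm x))).
  rewrite mul1r (le_trans _ (expR_ge1Dx _))// mulrDl mul1r addrA lerDr.
  exact: addr_ge0.
by rewrite ler_wpM2r ?expR_ge0// lerDl.
Qed.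

Lemma mean_ge0 f : (forall x, 0 <= f x) -> 0 <= mean f.
Proof.
by move=> f0; apply: fine_ge0; apply: integral_ge0 => x _; rewrite lee_fin.
Qed.

Lemma meanE f : tame f -> (\int[G]_x (f x)%:E = (mean f)%:E)%E.
Proof.
by move=> tf; rewrite fineK//; apply: integrable_fin_num => //; exact: tame_integrable.
Qed.

Lemma mean_cst c : mean (fun=> c) = c.
Proof. by rewrite /mean integral_cst//= probability_setT mule1. Qed.

Lemma meanD f g : tame f -> tame g -> mean (fun x => f x + g x) = mean f + mean g.
Proof.
move=> tf tg; apply: EFin_inj; rewrite -meanE; last exact: tameD.
under eq_integral do rewrite EFinD.
rewrite (@integralD _ _ _ G _ measurableT (EFin \o f) (EFin \o g)); [|exact: tame_integrable..].
by rewrite EFinD -!meanE.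
Qed.

Lemma meanZ c f : tame f -> mean (fun x => c * f x) = c * mean f.
Proof.
move=> tf; apply: EFin_inj; rewrite -meanE; last exact: tameZ.
under eq_integral do rewrite EFinM.
rewrite (@integralZl _ _ _ G _ measurableT (EFin \o f)); last exact: tame_integrable.
by rewrite EFinM -meanE.
Qed.

Lemma meanN f : tame f -> mean (fun x => - f x) = - mean f.
Proof.
move=> tf; rewrite -mulN1r -meanZ//; congr mean; apply/funext => x; by rewrite mulN1r.
Qed.

Lemma meanB f g : tame f -> tame g -> mean (fun x => f x - g x) = mean f - mean g.
Proof. by move=> tf tg; rewrite meanD ?meanN//; exact: tameN. Qed.

Lemma mean_sum (J : Type) (s : seq J) (P : pred J) (f : J -> V -> R) :
  (forall j, tame (f j)) ->
  mean (fun x => \sum_(j <- s | P j) f j x) = \sum_(j <- s | P j) mean (f j).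
Proof.
move=> tf; elim: s => [|j s IH].
  rewrite big_nil -[RHS](mean_cst 0); congr mean; apply/funext => x; by rewrite big_nil.
rewrite big_cons -IH; case: ifP => Pj.
  rewrite -meanD//; last exact: tame_sum.
  by congr mean; apply/funext => x; rewrite big_cons Pj.
by congr mean; apply/funext => x; rewrite big_cons Pj.
Qed.

Lemma le_mean f g : tame f -> tame g -> (forall x, f x <= g x) -> mean f <= mean g.
Proof.
move=> tf tg fg; rewrite -subr_ge0 -meanB//; apply: mean_ge0 => x.
by rewrite subr_ge0.
Qed.

Lemma mean_affine (chi c : I -> R) (f : V -> R) :
  (forall i, chi i ^+ 2 = 1) -> measurable_fun setT f -> (forall x, 0 <= f x) ->
  mean (fun x => f (fun i => chi i * x i + c i)) =
  mean (fun x => f x * expR (\sum_i c i * x i - (\sum_i c i ^+ 2) / 2)).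
Proof.
move=> chi2 mf f0; congr fine.
by have := gauss_affine R I chi c (EFin \o f) chi2; apply => //; exact/measurable_EFinP.
Qed.

Lemma measurable_indb (b : V -> bool) : measurable_fun setT b -> measurable_fun setT (fun x => (b x)%:R : R).
Proof.
move=> mb; rewrite (_ : (fun x => _) = (fun x => if b x then 1 else 0)).
  exact: measurable_fun_ifT.
by apply/funext => x; case: (b x).
Qed.

Lemma tame_indb (b : V -> bool) : measurable_fun setT b -> tame (fun x => (b x)%:R).
Proof.
move=> mb; apply: (tame_bound _ 1); first exact: measurable_indb.
by move=> x; case: (b x); rewrite ?normr1 ?normr0.
Qed.

Lemma mean_prob (b : V -> bool) : measurable_fun setT b ->
  (mean (fun x => (b x)%:R))%:E = G [set x | b x].
Proof.
move=> mb; rewrite -meanE; last exact: tame_indb.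
have mB : measurable [set x | b x].
  by rewrite -[X in measurable X]setTI; exact: mb.
rewrite -[X in _ = G X]setIT -integral_indic//.
apply: eq_integral => x _; rewrite indicE; case: (boolP (b x)) => bx.
  by rewrite mem_set.
by rewrite memNset//; exact/negP.
Qed.

End tame.

Arguments mean {R I} f.
Arguments tame {R I} f.
Arguments l1norm {R I} x.

(** * Gibbs measures and concentration of the free energy *)

Section real_inequalities.
Context (R : realType).
Implicit Types x y t : R.

Lemma expR_sub1_le y : expR y - 1 <= y * expR y.
Proof.
have := expR_ge1Dx (- y); rewrite -(ler_pM2r (expR_gt0 y)) -expRD addNr expR0.
by rewrite mulrDl mul1r; lra.
Qed.

Lemma expR_taylor2 y : expR y <= 1 + y + y ^+ 2 * expR `|y|.
Proof.
have h1 := expR_sub1_le y; have h2 := expR_ge1Dx y.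
have [y0|/ltW y0] := leP 0 y.
  rewrite ger0_norm//.
  have : y * (expR y - 1) <= y * (y * expR y) by rewrite ler_wpM2l.
  by rewrite mulrBr mulr1 mulrA -expr2; lra.
have : y * (expR y - 1) <= y * y by rewrite ler_wnM2l//; lra.
have : y ^+ 2 * 1 <= y ^+ 2 * expR `|y|.
  by rewrite ler_wpM2l ?sqr_ge0// -expR0 ler_expR.
by rewrite mulrBr mulr1 -expr2; lra.
Qed.

Lemma ln_le_sub1 t : 0 < t -> ln t <= t - 1.
Proof.
by move=> t0; have := expR_ge1Dx (ln t); rewrite lnK ?posrE//; lra.
Qed.

Lemma ind_le (c : bool) y : 0 <= y -> (c -> 1 <= y) -> ind c <= y.
Proof. by case: c => // y0 /(_ isT). Qed.

Lemma ler_eps_linear x y C : (forall e, 0 < e <= 1 -> x <= y + e * C) -> x <= y.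
Proof.
move=> H; apply/ler_addgt0Pr => d d0.
have [C0|C0] := leP C 0.
  have := H 1; rewrite ltr01 lexx mul1r => /(_ isT) h; lra.
pose e := Num.min 1 (d / C).
have e0 : 0 < e by rewrite lt_min ltr01 divr_gt0.
have e1 : e <= 1 by rewrite ge_min lexx.
have : e * C <= d by rewrite -ler_pdivlMr// ge_min lexx orbT.
have := H e; rewrite e0 e1 => /(_ isT); lra.
Qed.

End real_inequalities.

(* Gaussian Hamiltonians [ham t x = \sum_i coef t i * x i] with covariance [snr * ovl];
   [act] and [chi] are the gauge symmetry that moves any planted spin to [base]. *)
Record spin_model (R : realType) (I Sp : finType) := SpinModel {
  coef : Sp -> I -> R;
  amp : I -> R;
  snr : R;
  ovl : Sp -> Sp -> R;
  act : Sp -> Sp -> Sp;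
  chi : Sp -> I -> R;
  base : Sp;
  coef_dot : forall t s, \sum_i coef t i * coef s i = snr * ovl t s;
  ovl_diag : forall t, ovl t t = 1;
  ovl_le1 : forall t s, `|ovl t s| <= 1;
  snr_gt0 : 0 < snr;
  coef_abs : forall t i, `|coef t i| = amp i;
  sum_amp : \sum_i amp i ^+ 2 = snr;
  act_base : forall u, act u base = u;
  act_inj : forall u, injective (act u);
  ovl_act : forall u t s, ovl (act u t) (act u s) = ovl t s;
  coef_act : forall u t i, coef (act u t) i = chi u i * coef t i;
  chi_sqr : forall u i, chi u i ^+ 2 = 1
}.

Arguments coef {R I Sp}.
Arguments amp {R I Sp}.
Arguments snr {R I Sp}.
Arguments ovl {R I Sp}.
Arguments act {R I Sp}.
Arguments chi {R I Sp}.
Arguments base {R I Sp}.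

Section gibbs.
Context (R : realType) (I Sp : finType) (m : spin_model R I Sp).
Local Notation a := (coef m).
Local Notation alpha := (amp m).
Local Notation M := (snr m).
Local Notation rho := (ovl m).
Let aa := coef_dot _ _ _ m.
Let rho1 := ovl_diag _ _ _ m.
Let rho_le1 := ovl_le1 _ _ _ m.
Let M0 := snr_gt0 _ _ _ m.
Let a_abs := coef_abs _ _ _ m.
Let sum_alpha := sum_amp _ _ _ m.
Notation V := (vect R I).
Implicit Types (k : Sp -> R) (b : R) (x : V) (t s : Sp).

Definition ham t x : R := \sum_i a t i * x i.
(** The weights [k] are arbitrary so that the evidence, the planted evidence and its restriction to
    a range of overlaps are all instances, with the tilt placed in [k]. *)
Definition Z k b x : R := \sum_t k t * expR (b * ham t x).
Definition wgt k b x t : R := k t * expR (b * ham t x) / Z k b x.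
Definition gav k b (f : Sp -> R) x : R := \sum_t wgt k b x t * f t.
Definition shift b t x : V := fun i => x i + b * a t i.
Definition proper k := (forall t, 0 <= k t) /\ exists t, 0 < k t.

Lemma ham_shift b t s x : ham s (shift b t x) = ham s x + b * M * rho s t.
Proof.
rewrite /ham /shift -mulrA -aa mulr_sumr -big_split/=; apply: eq_bigr => i _; ring.
Qed.

Lemma tame_ham t : tame (ham t).
Proof. exact: tame_lin. Qed.

Lemma tame_expR_ham b t : tame (fun x => expR (b * ham t x)).
Proof.
have := tame_expR_lin R I (fun i => b * a t i) 0; congr tame; apply/funext => x.
by rewrite addr0 /ham mulr_sumr; congr expR; apply: eq_bigr => i _; rewrite mulrA.
Qed.

Lemma tame_Z k b : tame (Z k b).
Proof. by apply: tame_sum => t; apply: tameZ; exact: tame_expR_ham. Qed.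

Lemma Z_shift k b c t x : Z k b (shift c t x) = Z (fun s => k s * expR (b * c * M * rho s t)) b x.
Proof.
apply: eq_bigr => s _; rewrite ham_shift -[RHS]mulrA -expRD; congr (_ * expR _); ring.
Qed.

Lemma Z_gt0 k b x : proper k -> 0 < Z k b x.
Proof.
move=> [k0 [t kt]]; rewrite /Z (bigD1 t)//= ltr_pwDl ?mulr_gt0 ?expR_gt0//.
by apply: sumr_ge0 => s _; rewrite mulr_ge0 ?expR_ge0.
Qed.

Lemma measurable_lnZ k b : measurable_fun setT (fun x => ln (Z k b x)).
Proof.
exact: (measurableT_comp (@measurable_ln R) (tame_measurable _ _ _ (tame_Z k b))).
Qed.

(** From above [ln z <= z - 1]; from below a single term of positive weight, whose linear exponent
    is absorbed by a square. *)
Lemma tame_lnZ k b : proper k -> tame (fun x => ln (Z k b x)).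
Proof.
move=> pk; have [k0 [t kt]] := pk.
have tt : tame (fun x => Z k b x + (`|ln (k t)| + (b * ham t x) * (b * ham t x) + 1)).
  apply: tameD; first exact: tame_Z.
  apply: tameD; last exact: tame_cst.
  apply: tameD; first exact: tame_cst.
  by apply: tameM; apply: tameZ; exact: tame_ham.
apply: (tame_le _ _ _ _ (measurable_lnZ k b) tt) => x.
have Z0 := Z_gt0 k b x pk.
have h1 := ln_le_sub1 _ _ Z0.
have h2 : ln (k t) + b * ham t x <= ln (Z k b x).
  rewrite -ler_expR lnK ?posrE// expRD lnK ?posrE//.
  by rewrite /Z (bigD1 t)//= lerDl; apply: sumr_ge0 => s _; rewrite mulr_ge0 ?expR_ge0.
set y := b * ham t x in h2 *.
have y2 : - y <= y * y + 1 by have := sqr_ge0 (y + 1 / 2); rewrite expr2; lra.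
have y0 : 0 <= y * y by rewrite -expr2 sqr_ge0.
have l0 := normr_ge0 (ln (k t)).
have l1 : - `|ln (k t)| <= ln (k t) by rewrite lerNl -normrN ler_norm.
rewrite [leRHS]ger0_norm; last by lra.
by rewrite ler_norml; lra.
Qed.

Lemma ham_lip t (x y : V) : `|ham t x - ham t y| <= \sum_i alpha i * `|x i - y i|.
Proof.
rewrite /ham -sumrB; apply: (le_trans (ler_norm_sum _ _ _)); apply: ler_sum => i _.
by rewrite -mulrBr normrM a_abs.
Qed.

(** All terms of the sum satisfy the same bound, because the modulus of [coef t i] is [amp i] for
    every spin. The coordinate constants [|b| * amp i] have squares summing to [b ^+ 2 * M]. *)
Lemma lnZ_lip k b (x y : V) : proper k ->
  ln (Z k b x) <= ln (Z k b y) + `|b| * \sum_i alpha i * `|x i - y i|.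
Proof.
move=> pk; have [k0 _] := pk.
rewrite -ler_expR expRD !lnK ?posrE ?Z_gt0//.
rewrite /Z mulr_suml; apply: ler_sum => t _; rewrite -mulrA -expRD.
rewrite ler_wpM2l// ler_expR.
have : b * (ham t x - ham t y) <= `|b| * \sum_i alpha i * `|x i - y i|.
  apply: (le_trans (ler_norm _)); rewrite normrM ler_wpM2l//; exact: ham_lip.
by rewrite mulrBr; lra.
Qed.

Lemma lambda_lnZ_lip k b l (x y : V) : proper k ->
  l * ln (Z k b x) <= l * ln (Z k b y) + `|l| * (`|b| * \sum_i alpha i * `|x i - y i|).
Proof.
move=> pk.
have h1 := lnZ_lip k b x y pk; have h2 := lnZ_lip k b y x pk.
have E : \sum_i alpha i * `|y i - x i| = \sum_i alpha i * `|x i - y i|.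
  by apply: eq_bigr => i _; rewrite distrC.
rewrite E in h2; set D := `|b| * _ in h1 h2 *.
have : `|l * (ln (Z k b x) - ln (Z k b y))| <= `|l| * D.
  by rewrite normrM ler_wpM2l// ler_norml; lra.
by move/(le_trans (ler_norm _)); rewrite mulrBr; lra.
Qed.

Lemma tame_expR_lnZ k b l : proper k -> tame (fun x => expR (l * ln (Z k b x))).
Proof.
move=> pk.
have al0 i : 0 <= alpha i.
  by have [t _] := pk.2; rewrite -(a_abs t).
pose A := `|l| * `|b| * \sum_i alpha i.
have A0 : 0 <= A by rewrite !mulr_ge0//; exact: sumr_ge0.
split.
  apply: measurableT_comp => //; apply: measurable_funM => //; exact: measurable_lnZ.
exists (expR (l * ln (Z k b (fun=> 0))) + A) => [|x].
  by rewrite addr_ge0 ?expR_ge0.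
rewrite ger0_norm ?expR_ge0//.
apply: (@le_trans _ _ (expR (l * ln (Z k b (fun=> 0))) * expR (A * l1norm x))).
  rewrite -expRD ler_expR; apply: (le_trans (lambda_lnZ_lip k b l x (fun=> 0) pk)).
  rewrite lerD2l /A -!mulrA ler_wpM2l// ler_wpM2l// mulr_suml; apply: ler_sum => i _.
  rewrite subr0 ler_wpM2l// /l1norm (bigD1 i)//= lerDl; exact: sumr_ge0.
apply: ler_pM; rewrite ?expR_ge0//; first by rewrite lerDl.
by rewrite ler_expR ler_wpM2r ?l1norm_ge0// lerDr expR_ge0.
Qed.

Lemma mgf_lnZ k b l : proper k ->
  mean (fun x => expR (l * ln (Z k b x))) * mean (fun x => expR (- l * ln (Z k b x))) <=
  expR (l ^+ 2 * b ^+ 2 * M).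
Proof.
move=> pk; rewrite -lee_fin EFinM -!meanE; do ?exact: tame_expR_lnZ.
have -> : l ^+ 2 * b ^+ 2 * M = \sum_i (`|l| * `|b| * alpha i) ^+ 2.
  rewrite -sum_alpha mulr_sumr; apply: eq_bigr => i _.
  by rewrite !exprMn !real_normK ?num_real.
have H := gauss_lip R I (fun i => `|l| * `|b| * alpha i) (fun x => expR (l * ln (Z k b x))).
have E : (\int[gauss R I]_x (expR (- l * ln (Z k b x)))%:E =
    \int[gauss R I]_x ((expR (l * ln (Z k b x)))^-1)%:E)%E.
  by apply: eq_integral => x _; rewrite mulNr expRN.
rewrite E; apply: H.
- exact: tame_measurable (tame_expR_lnZ k b l pk).
- by move=> x; exact: expR_gt0.
move=> x y; rewrite -expRD ler_expR; apply: (le_trans (lambda_lnZ_lip k b l x y pk)).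
rewrite lerD2l !mulr_sumr; apply: ler_sum => i _; by rewrite !mulrA.
Qed.

(** After centering, the factor with [- l] is at least 1 by Jensen, so the product bound [mgf_lnZ]
    controls the other factor alone. *)
Lemma mgf_lnZ_centered k b l : proper k ->
  mean (fun x => expR (l * (ln (Z k b x) - mean (fun x => ln (Z k b x))))) <=
  expR (l ^+ 2 * b ^+ 2 * M).
Proof.
move=> pk; set mu := mean (fun x => ln _).
have tF := tame_lnZ k b pk.
have splitE l' : mean (fun x => expR (l' * (ln (Z k b x) - mu))) =
    expR (- l' * mu) * mean (fun x => expR (l' * ln (Z k b x))).
  rewrite -meanZ; last exact: tame_expR_lnZ.
  congr mean; apply/funext => x; rewrite -expRD; congr expR; ring.
have jensen : 1 <= mean (fun x => expR (- l * (ln (Z k b x) - mu))).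
  have -> : 1 = mean (fun x => 1 + - l * (ln (Z k b x) - mu)).
    rewrite meanD; [|exact: tame_cst|by apply: tameZ; apply: tameB => //; exact: tame_cst].
    rewrite mean_cst meanZ; last by apply: tameB => //; exact: tame_cst.
    rewrite meanB//; last exact: tame_cst.
    by rewrite (mean_cst _ _ mu) subrr mulr0 addr0.
  apply: le_mean => [||x]; last exact: expR_ge1Dx.
    apply: tameD; [exact: tame_cst|by apply: tameZ; apply: tameB => //; exact: tame_cst].
  have := tameZ R I (expR (- - l * mu)) _ (tame_expR_lnZ k b (- l) pk).
  congr tame; apply/funext => x; rewrite -expRD; congr expR; ring.
apply: (le_trans _ (mgf_lnZ k b l pk)).
have p0 := mean_ge0 R I (fun x => expR (l * ln (Z k b x))) (fun x => expR_ge0 _).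
rewrite splitE mulrC; apply: ler_wpM2l; first exact: p0.
move: jensen; rewrite splitE opprK => J.
rewrite -(ler_pM2l (expR_gt0 (l * mu))) (le_trans _ J)// -expRD.
by rewrite (_ : _ + _ = 0) ?expR0//; ring.
Qed.

Lemma measurable_ge (f : V -> R) c : measurable_fun setT f -> measurable_fun setT (fun x => c <= f x).
Proof. by move=> mf; exact: measurable_fun_ler. Qed.

Lemma measurable_le (f : V -> R) c : measurable_fun setT f -> measurable_fun setT (fun x => f x <= c).
Proof. by move=> mf; exact: measurable_fun_ler. Qed.

Lemma lnZ_upper_tail k b r : proper k -> b != 0 -> 0 <= r ->
  mean (fun x => ind (mean (fun x => ln (Z k b x)) + r <= ln (Z k b x))) <=
  expR (- (r ^+ 2 / (4 * b ^+ 2 * M))).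
Proof.
move=> pk b0 r0; set mu := mean (fun x => ln (Z k b x)).
have b2 : 0 < b ^+ 2 by rewrite exprn_even_gt0.
(* The minimizer of the Chernoff exponent [l ^+ 2 * b ^+ 2 * M - l * r]. *)
pose l := r / (2 * b ^+ 2 * M).
have l0 : 0 <= l.
  by apply: divr_ge0 => //; apply: ltW; do 2?apply: mulr_gt0 => //.
apply: (@le_trans _ _ (expR (- l * r) * mean (fun x => expR (l * (ln (Z k b x) - mu))))).
  have te : tame (fun x => expR (l * (ln (Z k b x) - mu))).
    have := tameZ R I (expR (- l * mu)) _ (tame_expR_lnZ k b l pk).
    congr tame; apply/funext => x; rewrite -expRD; congr expR; ring.
  rewrite -meanZ//; apply: le_mean.
  - by apply: tame_indb; apply: measurable_ge; exact: measurable_lnZ.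
  - exact: tameZ.
  move=> x; rewrite -expRD; apply: ind_le => [|h]; first exact: expR_ge0.
  rewrite -expR0 ler_expR.
  have : 0 <= l * (ln (Z k b x) - mu - r) by rewrite mulr_ge0//; lra.
  lra.
apply: (@le_trans _ _ (expR (- l * r) * expR (l ^+ 2 * b ^+ 2 * M))).
  by rewrite ler_wpM2l ?expR_ge0//; exact: mgf_lnZ_centered.
rewrite -expRD ler_expR /l.
by rewrite le_eqVlt; apply/orP; left; apply/eqP; field; rewrite (gt_eqF M0) b0.
Qed.

Lemma lnZ_lower_tail k b r : proper k -> b != 0 -> 0 <= r ->
  mean (fun x => ind (ln (Z k b x) <= mean (fun x => ln (Z k b x)) - r)) <=
  expR (- (r ^+ 2 / (4 * b ^+ 2 * M))).
Proof.
move=> pk b0 r0; set mu := mean (fun x => ln (Z k b x)).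
have b2 : 0 < b ^+ 2 by rewrite exprn_even_gt0.
pose l := r / (2 * b ^+ 2 * M).
have l0 : 0 <= l.
  by apply: divr_ge0 => //; apply: ltW; do 2?apply: mulr_gt0 => //.
apply: (@le_trans _ _ (expR (- l * r) * mean (fun x => expR (- l * (ln (Z k b x) - mu))))).
  have te : tame (fun x => expR (- l * (ln (Z k b x) - mu))).
    have := tameZ R I (expR (- - l * mu)) _ (tame_expR_lnZ k b (- l) pk).
    congr tame; apply/funext => x; rewrite -expRD; congr expR; ring.
  rewrite -meanZ//; apply: le_mean.
  - by apply: tame_indb; apply: measurable_le; exact: measurable_lnZ.
  - exact: tameZ.
  move=> x; rewrite -expRD; apply: ind_le => [|h]; first exact: expR_ge0.
  rewrite -expR0 ler_expR.
  have : 0 <= l * (mu - r - ln (Z k b x)) by rewrite mulr_ge0//; lra.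
  lra.
apply: (@le_trans _ _ (expR (- l * r) * expR (l ^+ 2 * b ^+ 2 * M))).
  by rewrite ler_wpM2l ?expR_ge0// -(sqrrN l); exact: mgf_lnZ_centered.
rewrite -expRD ler_expR /l.
by rewrite le_eqVlt; apply/orP; left; apply/eqP; field; rewrite (gt_eqF M0) b0.
Qed.

(* two-level form of the concentration, used when the mean is not controlled *)
Lemma lnZ_two_level k b mu r : proper k -> b != 0 -> 0 <= r ->
  mean (fun x => ind (mu + r <= ln (Z k b x))) * mean (fun x => ind (ln (Z k b x) <= mu)) <=
  expR (- (r ^+ 2 / (4 * b ^+ 2 * M))).
Proof.
move=> pk b0 r0.
have b2 : 0 < b ^+ 2 by rewrite exprn_even_gt0.
pose l := r / (2 * b ^+ 2 * M).
have l0 : 0 <= l.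
  by apply: divr_ge0 => //; apply: ltW; do 2?apply: mulr_gt0 => //.
have h1 : mean (fun x => ind (mu + r <= ln (Z k b x))) <=
    expR (- l * (mu + r)) * mean (fun x => expR (l * ln (Z k b x))).
  rewrite -meanZ; last exact: tame_expR_lnZ.
  apply: le_mean.
  - by apply: tame_indb; apply: measurable_ge; exact: measurable_lnZ.
  - by apply: tameZ; exact: tame_expR_lnZ.
  move=> x; rewrite -expRD; apply: ind_le => [|h]; first exact: expR_ge0.
  rewrite -expR0 ler_expR.
  have : 0 <= l * (ln (Z k b x) - (mu + r)) by rewrite mulr_ge0//; lra.
  lra.
have h2 : mean (fun x => ind (ln (Z k b x) <= mu)) <=
    expR (l * mu) * mean (fun x => expR (- l * ln (Z k b x))).
  rewrite -meanZ; last exact: tame_expR_lnZ.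
  apply: le_mean.
  - by apply: tame_indb; apply: measurable_le; exact: measurable_lnZ.
  - by apply: tameZ; exact: tame_expR_lnZ.
  move=> x; rewrite -expRD; apply: ind_le => [|h]; first exact: expR_ge0.
  rewrite -expR0 ler_expR.
  have : 0 <= l * (mu - ln (Z k b x)) by rewrite mulr_ge0//; lra.
  lra.
apply: (le_trans (ler_pM _ _ h1 h2)); do ?by apply: mean_ge0.
rewrite mulrACA; apply: (le_trans (ler_wpM2l _ (mgf_lnZ k b l pk))).
  by rewrite mulr_ge0 ?expR_ge0.
rewrite -!expRD ler_expR /l.
by rewrite le_eqVlt; apply/orP; left; apply/eqP; field; rewrite (gt_eqF M0) b0.
Qed.

(** * Gibbs averages and Gaussian integration by parts *)

Lemma wgt_ge0 k b x t : proper k -> 0 <= wgt k b x t.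
Proof.
by move=> pk; rewrite divr_ge0 ?mulr_ge0 ?expR_ge0 ?(ltW (Z_gt0 _ _ _ pk))// pk.1.
Qed.

Lemma sum_wgt k b x : proper k -> \sum_t wgt k b x t = 1.
Proof. by move=> pk; rewrite -mulr_suml divff// gt_eqF// Z_gt0. Qed.

Lemma wgt_le1 k b x t : proper k -> wgt k b x t <= 1.
Proof.
move=> pk; rewrite -(sum_wgt k b x pk) (bigD1 t)//= lerDl.
by apply: sumr_ge0 => s _; exact: wgt_ge0.
Qed.

Lemma tame_wgt k b t : proper k -> tame (fun x => wgt k b x t).
Proof.
move=> pk; apply: (tame_bound _ _ _ 1) => [|x].
  apply: measurable_funM.
    by apply: tame_measurable; apply: tameZ; exact: tame_expR_ham.
  apply: measurable_fun_invr_gt0; first exact: tame_measurable (tame_Z k b).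
  by move=> x; exact: Z_gt0.
by rewrite ger0_norm ?wgt_ge0// wgt_le1.
Qed.

Lemma tame_gav k b (f : Sp -> V -> R) : proper k -> (forall t, tame (f t)) ->
  tame (fun x => gav k b (fun t => f t x) x).
Proof.
by move=> pk tf; apply: tame_sum => t; apply: tameM => //; exact: tame_wgt.
Qed.

Lemma le_gav k b (f g : Sp -> R) x : proper k -> (forall t, 0 < k t -> f t <= g t) ->
  gav k b f x <= gav k b g x.
Proof.
move=> pk fg; apply: ler_sum => t _.
have := pk.1 t; rewrite le_eqVlt => /orP[/eqP kt|kt].
  by rewrite /wgt -kt !mul0r.
by rewrite ler_wpM2l ?wgt_ge0// fg.
Qed.

Lemma gav_cst k b c x : proper k -> gav k b (fun=> c) x = c.
Proof. by move=> pk; rewrite /gav -mulr_suml sum_wgt// mul1r. Qed.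

Lemma gavD k b f g x : gav k b (fun t => f t + g t) x = gav k b f x + gav k b g x.
Proof. by rewrite /gav -big_split/=; apply: eq_bigr => t _; rewrite mulrDr. Qed.

Lemma gavZ k b c f x : gav k b (fun t => c * f t) x = c * gav k b f x.
Proof. by rewrite /gav mulr_sumr; apply: eq_bigr => t _; rewrite mulrCA. Qed.

Lemma gav_ge0 k b f x : proper k -> (forall t, 0 <= f t) -> 0 <= gav k b f x.
Proof. by move=> pk f0; apply: sumr_ge0 => t _; rewrite mulr_ge0 ?wgt_ge0. Qed.

Lemma Z_gav k b k' b' (D : Sp -> R) x : proper k -> (forall t, k' t = k t * expR (D t)) ->
  Z k' b' x = Z k b x * gav k b (fun t => expR ((b' - b) * ham t x + D t)) x.
Proof.
move=> pk kk; rewrite /gav mulr_sumr; apply: eq_bigr => t _.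
rewrite /wgt kk mulrA (mulrC (Z k b x)) divfK ?gt_eqF ?Z_gt0// -!mulrA -!expRD.
by congr (_ * expR _); ring.
Qed.

Lemma gav_jensen k b f x : proper k -> gav k b f x <= ln (gav k b (fun t => expR (f t)) x).
Proof.
move=> pk; set mu := gav k b f x.
have h : expR mu <= gav k b (fun t => expR (f t)) x.
  apply: (@le_trans _ _ (gav k b (fun t => expR mu * (1 - mu) + expR mu * f t) x)).
    by rewrite gavD gav_cst// gavZ -/mu -mulrDr subrK mulr1.
  apply: le_gav => // t _; rewrite -mulrDr.
  have -> : expR (f t) = expR mu * expR (f t - mu) by rewrite -expRD; congr expR; ring.
  rewrite ler_wpM2l ?expR_ge0//; have := expR_ge1Dx (f t - mu); lra.
rewrite -ler_expR lnK// posrE; exact: lt_le_trans (expR_gt0 mu) h.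
Qed.

(** Cameron-Martin along the vector [b * coef t], whose squared norm is [b ^+ 2 * M] because a spin
    has overlap 1 with itself. *)
Lemma lik_mean b t (f : V -> R) : measurable_fun setT f -> (forall x, 0 <= f x) ->
  mean (fun x => f (shift b t x)) = mean (fun x => f x * expR (b * ham t x - b ^+ 2 * M / 2)).
Proof.
move=> mf f0.
have := mean_affine R I (fun=> 1) (fun i => b * a t i) f (fun=> expr1n _ _) mf f0.
under eq_fun => x. under eq_fun do rewrite mul1r. over.
move=> ->; congr mean; apply/funext => x; congr (_ * expR _).
rewrite /ham mulr_sumr; congr (_ - _ / _).
  by apply: eq_bigr => i _; rewrite mulrA.
rewrite -[M]mulr1 -(rho1 t) -aa mulr_sumr; apply: eq_bigr => i _; ring.
Qed.

Lemma wgt_shift k b e t x : proper k -> wgt k b (shift e t x) t =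
  wgt k b x t * (expR (b * e * M) / gav k b (fun s => expR (b * e * M * rho s t)) x).
Proof.
move=> pk; rewrite /wgt Z_shift.
rewrite (Z_gav k b _ b (fun s => b * e * M * rho s t))//.
rewrite ham_shift rho1 mulr1.
have -> : gav k b (fun s => expR ((b - b) * ham s x + b * e * M * rho s t)) x =
   gav k b (fun s => expR (b * e * M * rho s t)) x.
  by apply: eq_bigr => s _; rewrite subrr mul0r add0r.
have -> : expR (b * (ham t x + e * M)) = expR (b * ham t x) * expR (b * e * M).
  by rewrite -expRD; congr expR; ring.
rewrite invfM; ring.
Qed.

(** Gaussian integration by parts as an inequality. The mean of [U], a Gibbs average of likelihood
    ratios at a small parameter [e], is estimated twice: Cameron-Martin moves the shift into the
    weights and produces the pair overlap, a Taylor expansion produces [mh]. Comparing the terms of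
    first order in [e] gives the claim. *)
Lemma gibbs_ibp k b : proper k -> 0 <= b ->
  b * M * (1 - mean (fun x => gav k b (fun t => gav k b (fun s => rho s t) x) x)) <=
  mean (fun x => gav k b (fun t => ham t x) x).
Proof.
move=> pk b0.
set q12 := mean (fun x => gav k b (fun t => gav _ _ _ _) x).
set mh := mean (fun x => gav k b (fun t => ham t x) x).
(* Up to the factor 4 this dominates the second-order Taylor error of [expR (e * ham t x)], for all
   spins at once. *)
pose B x := \sum_t (expR (2 * ham t x) + expR (- 2 * ham t x)).
have tB : tame B by apply: tame_sum => t; apply: tameD; exact: tame_expR_ham.
(* Bounds the second-order error of [expR (b * e * M * rho s t)] divided by [e ^+ 2], for overlaps
   of modulus at most 1. *)
pose C1 := (b * M) ^+ 2 * expR (b * M).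
apply: (@ler_eps_linear _ _ _ (C1 + 4 * mean B)) => e /andP[e0 e1].
have bM0 : 0 <= b * M by rewrite mulr_ge0// ltW.
have bem0 : 0 <= b * e * M by rewrite !mulr_ge0// ltW.
have bem1 : b * e * M <= b * M.
  by rewrite mulrAC ler_piMr.
pose U x := \sum_t wgt k b x t * expR (e * ham t x - e ^+ 2 * M / 2).
have tU t : tame (fun x => wgt k b x t * expR (e * ham t x - e ^+ 2 * M / 2)).
  apply: tameM; first exact: tame_wgt.
  have := tameZ _ _ (expR (- (e ^+ 2 * M / 2))) _ (tame_expR_ham e t).
  by congr tame; apply/funext => x; rewrite -expRD addrC.
have tg12 : tame (fun x => gav k b (fun t => gav k b (fun s => rho s t) x) x).
  by apply: (tame_gav k b (fun t x => gav k b (fun s => rho s t) x)) => // t;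
     apply: (tame_gav k b (fun s x => rho s t)) => // s; exact: tame_cst.
have tgh : tame (fun x => gav k b (fun t => ham t x) x).
  by apply: (tame_gav k b ham) => // t; exact: tame_ham.
have lower : 1 + b * e * M * (1 - q12) - e ^+ 2 * C1 <= mean U.
  rewrite mean_sum//.
  have -> : \sum_t mean (fun x => wgt k b x t * expR (e * ham t x - e ^+ 2 * M / 2)) =
      \sum_t mean (fun x => wgt k b (shift e t x) t).
    apply: eq_bigr => t _; apply/esym.
    apply: (lik_mean e t (fun x => wgt k b x t)); first exact: tame_measurable (tame_wgt k b t pk).
    by move=> x; exact: wgt_ge0.
  pose W t x := wgt k b x t * (1 + b * e * M - b * e * M * gav k b (fun s => rho s t) x - e ^+ 2 * C1).
  have tW t : tame (W t).
    apply: tameM; first exact: tame_wgt.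
    apply: tameB; last exact: tame_cst.
    apply: tameB; first exact: tame_cst.
    apply: tameZ; apply: (tame_gav k b (fun s x => rho s t)) => // s; exact: tame_cst.
  have -> : 1 + b * e * M * (1 - q12) - e ^+ 2 * C1 = \sum_t mean (W t).
    rewrite -mean_sum//.
    have -> : (fun x => \sum_t W t x) = (fun x => (1 + b * e * M - e ^+ 2 * C1) +
      (- (b * e * M)) * gav k b (fun t => gav k b (fun s => rho s t) x) x).
      apply/funext => x; rewrite -gavZ -(gav_cst k b (1 + b * e * M - e ^+ 2 * C1) x pk) -gavD.
      apply: eq_bigr => t _; rewrite /W; congr (_ * _); ring.
    rewrite meanD; [|exact: tame_cst|exact: tameZ].
    by rewrite mean_cst meanZ// -/q12; ring.
  apply: ler_sum => t _; apply: le_mean => //.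
    have -> : (fun x => wgt k b (shift e t x) t) = (fun x => wgt k b x t *
      (expR (b * e * M) / gav k b (fun s => expR (b * e * M * rho s t)) x)).
      by apply/funext => x; exact: wgt_shift.
    apply: tameM; first exact: tame_wgt.
    have p0 x : 0 < gav k b (fun s => expR (b * e * M * rho s t)) x.
      apply: (@lt_le_trans _ _ (gav k b (fun=> expR (- (b * e * M))) x)).
        by rewrite gav_cst// expR_gt0.
      apply: le_gav => // s _; rewrite ler_expR -mulrN1 ler_wpM2l//.
      by have := rho_le1 s t; rewrite ler_norml => /andP[].
    apply: (tame_bound _ _ _ (expR (b * e * M) * expR (b * e * M))).
      apply: measurable_funM => //; apply: measurable_fun_invr_gt0 => //.
      by apply: tame_measurable; apply: (tame_gav k b (fun s x => expR (b * e * M * rho s t))) => // s; exact: tame_cst.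
    move=> x; rewrite ger0_norm ?divr_ge0 ?expR_ge0 ?(ltW (p0 _))//.
    rewrite ler_pM2l ?expR_gt0// -[leRHS]invrK -expRN lef_pV2 ?posrE ?expR_gt0//.
    rewrite -[leLHS](gav_cst k b _ x pk); apply: le_gav => // s _.
    rewrite ler_expR -mulrN1 ler_wpM2l//.
    by have := rho_le1 s t; rewrite ler_norml => /andP[].
  move=> x; rewrite wgt_shift// /W ler_wpM2l ?wgt_ge0//.
  set D := gav k b (fun s => expR _) x.
  have D0 : 0 < D.
    apply: (@lt_le_trans _ _ (gav k b (fun=> expR (- (b * e * M))) x)).
      by rewrite gav_cst// expR_gt0.
    apply: le_gav => // s _; rewrite ler_expR -mulrN1 ler_wpM2l//.
    by have := rho_le1 s t; rewrite ler_norml => /andP[].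
  have D1 : D <= 1 + b * e * M * gav k b (fun s => rho s t) x + e ^+ 2 * C1.
    rewrite -gavZ -(gav_cst k b 1 x pk) -(gav_cst k b (e ^+ 2 * C1) x pk) -!gavD.
    apply: le_gav => // s _.
    apply: (le_trans (expR_taylor2 _ _)); rewrite lerD2l.
    have rr := rho_le1 s t.
    have q1 : `|b * e * M * rho s t| <= b * M.
      rewrite normrM ger0_norm//; apply: (le_trans _ bem1).
      by rewrite -[leRHS]mulr1 ler_wpM2l.
    have q2 : (b * e * M * rho s t) ^+ 2 <= e ^+ 2 * (b * M) ^+ 2.
      have -> : (b * e * M * rho s t) ^+ 2 = (e ^+ 2 * (b * M) ^+ 2) * rho s t ^+ 2 by ring.
      apply: ler_piMr; first by rewrite mulr_ge0 ?sqr_ge0.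
      by rewrite -real_normK ?num_real// exprn_ile1.
    rewrite /C1 mulrA; apply: ler_pM => //; first exact: sqr_ge0.
    by rewrite ler_expR.
  (* The ratio [expR (b * e * M) / D] is bounded below by an affine function of [D], from
     [1 + y <= expR y] and [ln D <= D - 1]. *)
  have := expR_ge1Dx (b * e * M - ln D); rewrite expRD expRN lnK ?posrE//.
  have := ln_le_sub1 _ _ D0; lra.
have upper : mean U <= 1 + e * mh + e ^+ 2 * (4 * mean B).
  have -> : 1 + e * mh + e ^+ 2 * (4 * mean B) =
      mean (fun x => (1 + e * gav k b (fun t => ham t x) x) + e ^+ 2 * (4 * B x)).
    rewrite meanD; [|by apply: tameD; [exact: tame_cst|exact: tameZ]|by do 2 apply: tameZ].
    rewrite meanD; [|exact: tame_cst|exact: tameZ].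
    by rewrite mean_cst !meanZ//; exact: tameZ.
  apply: le_mean.
  - exact: tame_sum.
  - apply: tameD; last by do 2 apply: tameZ.
    by apply: tameD; [exact: tame_cst|exact: tameZ].
  move=> x.
  apply: (@le_trans _ _ (gav k b (fun t => (1 + e * ham t x) + e ^+ 2 * (4 * B x)) x)); last first.
    by rewrite !gavD gavZ !gav_cst.
  apply: le_gav => // t _; set y := ham t x.
  have M2 : 0 <= e ^+ 2 * M / 2 by rewrite divr_ge0// mulr_ge0 ?sqr_ge0// ltW.
  apply: (@le_trans _ _ (expR (e * y))); first by rewrite ler_expR; lra.
  apply: (le_trans (expR_taylor2 _ _)); rewrite lerD2l exprMn -mulrA ler_wpM2l ?sqr_ge0//.
  have f1 : expR `|e * y| <= expR `|y|.
    by rewrite ler_expR normrM (ger0_norm (ltW e0)) ler_piMl.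
  have f2 : y ^+ 2 <= 4 * expR `|y|.
    have g1 := expR_ge1Dx (`|y| / 2).
    have -> : expR `|y| = expR (`|y| / 2) ^+ 2.
      by rewrite -expRM_natl; congr expR; field.
    have n0 := normr_ge0 y.
    have : (`|y| / 2) ^+ 2 <= expR (`|y| / 2) ^+ 2.
      by rewrite ler_pXn2r ?nnegrE ?expR_ge0//; lra.
    by rewrite exprMn real_normK ?num_real//; lra.
  have f3 : expR `|y| * expR `|y| <= B x.
    rewrite -expRD /B (bigD1 t)//= -/y.
    apply: (@le_trans _ _ (expR (2 * y) + expR (- 2 * y))); last first.
      rewrite lerDl; apply: sumr_ge0 => s _; by rewrite addr_ge0 ?expR_ge0.
    have [y0|/ltW y0] := leP 0 y.
      by rewrite ger0_norm// (_ : y + y = 2 * y) ?lerDl ?expR_ge0//; ring.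
    by rewrite ler0_norm// (_ : - y + - y = - 2 * y) ?lerDr ?expR_ge0//; ring.
  apply: (@le_trans _ _ (4 * expR `|y| * expR `|y|)).
    by apply: ler_pM; rewrite ?sqr_ge0 ?expR_ge0.
  by rewrite -mulrA ler_pM2l.
have key : e * (b * M * (1 - q12)) <= e * (mh + e * (C1 + 4 * mean B)).
  rewrite expr2 in lower upper; move: (le_trans lower upper); lra.
by move: key; rewrite ler_pM2l.
Qed.

(** Jensen for the Gibbs measure bounds the increment of [ln Z] below by the Gibbs average of the
    added exponent [(b' - b) * ham + D]; [gibbs_ibp] then bounds the energy. *)
Lemma lnZ_growth k b k' b' (D : Sp -> R) : proper k -> 0 <= b -> b <= b' ->
  (forall t, k' t = k t * expR (D t)) ->
  (b' - b) * (b * M * (1 - mean (fun x => gav k b (fun t => gav k b (fun s => rho s t) x) x))) +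
  mean (fun x => gav k b D x) <=
  mean (fun x => ln (Z k' b' x)) - mean (fun x => ln (Z k b x)).
Proof.
move=> pk b0 bb' kk.
have pk' : proper k'.
  split=> [t|]; first by rewrite kk mulr_ge0 ?expR_ge0// pk.1.
  by have [t kt] := pk.2; exists t; rewrite kk mulr_gt0 ?expR_gt0.
have tgh : tame (fun x => gav k b (fun t => ham t x) x).
  by apply: (tame_gav k b ham) => // t; exact: tame_ham.
have tgD : tame (fun x => gav k b D x).
  by apply: (tame_gav k b (fun t x => D t)) => // t; exact: tame_cst.
apply: (@le_trans _ _ ((b' - b) * mean (fun x => gav k b (fun t => ham t x) x) + mean (fun x => gav k b D x))).
  by rewrite lerD2r ler_wpM2l ?subr_ge0//; exact: gibbs_ibp.
rewrite -meanZ// -meanD//; last exact: tameZ.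
rewrite -meanB; [|exact: tame_lnZ..].
apply: le_mean.
- by apply: tameD => //; exact: tameZ.
- by apply: tameB; exact: tame_lnZ.
move=> x; rewrite (Z_gav k b k' b' D x pk kk).
have g0 : 0 < gav k b (fun t => expR ((b' - b) * ham t x + D t)) x.
  by rewrite -(pmulr_rgt0 _ (Z_gt0 k b x pk)) -(Z_gav k b k' b' D x pk kk) Z_gt0.
have J := gav_jensen k b (fun t => (b' - b) * ham t x + D t) x pk.
rewrite gavD gavZ in J; apply: (le_trans J).
have Z0 := Z_gt0 k b x pk.
move: (gav k b _ x) (Z k b x) g0 Z0 => g z g0 z0.
by rewrite (lnM z0 g0) addrAC subrr add0r.
Qed.

End gibbs.

Arguments ham {R I Sp} m t x.
Arguments Z {R I Sp} m k b x.
Arguments wgt {R I Sp} m k b x t.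
Arguments gav {R I Sp} m k b f x.
Arguments shift {R I Sp} m b t x _.
Arguments ham_shift {R I Sp m}.
Arguments tame_ham {R I Sp m}.
Arguments tame_expR_ham {R I Sp m}.
Arguments tame_Z {R I Sp m}.
Arguments Z_shift {R I Sp m}.
Arguments Z_gt0 {R I Sp m}.
Arguments measurable_lnZ {R I Sp m}.
Arguments tame_lnZ {R I Sp m}.
Arguments ham_lip {R I Sp m}.
Arguments lnZ_lip {R I Sp m}.
Arguments lambda_lnZ_lip {R I Sp m}.
Arguments tame_expR_lnZ {R I Sp m}.
Arguments mgf_lnZ {R I Sp m}.
Arguments mgf_lnZ_centered {R I Sp m}.
Arguments lnZ_upper_tail {R I Sp m}.
Arguments lnZ_lower_tail {R I Sp m}.
Arguments lnZ_two_level {R I Sp m}.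
Arguments wgt_ge0 {R I Sp m}.
Arguments sum_wgt {R I Sp m}.
Arguments wgt_le1 {R I Sp m}.
Arguments tame_wgt {R I Sp m}.
Arguments tame_gav {R I Sp m}.
Arguments le_gav {R I Sp m}.
Arguments gav_cst {R I Sp m}.
Arguments gavD {R I Sp m}.
Arguments gavZ {R I Sp m}.
Arguments gav_ge0 {R I Sp m}.
Arguments Z_gav {R I Sp m}.
Arguments gav_jensen {R I Sp m}.
Arguments lik_mean {R I Sp m}.
Arguments wgt_shift {R I Sp m}.
Arguments gibbs_ibp {R I Sp m}.
Arguments lnZ_growth {R I Sp m}.
Arguments proper {R Sp} k.
Arguments measurable_ge {R I}.
Arguments measurable_le {R I}.

(** * The planted model *)

(** Over [n] equal steps the defects add up to [C * (b' - b) ^+ 2 / n], which tends to 0. *)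
Lemma quadratic_defect_nondecreasing (R : realType) (f : R -> R) (C : R) :
  (forall b b', 0 <= b -> b <= b' -> f b <= f b' + C * (b' - b) ^+ 2) ->
  forall b b', 0 <= b -> b <= b' -> f b <= f b'.
Proof.
move=> H b b' b0 bb'.
have step n (h : R) : 0 <= h -> f b <= f (b + n%:R * h) + n%:R * (C * h ^+ 2).
  move=> h0; elim: n => [|n IH]; first by rewrite !mul0r !addr0.
  apply: (le_trans IH).
  have nh : 0 <= n%:R * h by rewrite mulr_ge0.
  have := H (b + n%:R * h) (b + n.+1%:R * h) (addr_ge0 b0 nh).
  rewrite -natr1 (_ : b + (n%:R + 1) * h - (b + n%:R * h) = h); last by ring.
  by move=> /(_ _); rewrite !mulrDl !mul1r; lra.
apply/ler_addgt0Pr => e e0.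
have C0 := normr_ge0 (C * (b' - b) ^+ 2).
pose n := (Num.truncn (`|C * (b' - b) ^+ 2| / e)).+1.
have n0 : (0 : R) < n%:R by rewrite ltr0n.
have := step n ((b' - b) / n%:R); rewrite divr_ge0 ?subr_ge0 ?(ltW n0)// => /(_ isT).
rewrite mulrCA divff ?gt_eqF// mulr1 (addrC b) subrK => h; apply: (le_trans h).
rewrite lerD2l (_ : n%:R * _ = (C * (b' - b) ^+ 2) / n%:R); last by field; rewrite gt_eqF.
rewrite ler_pdivrMr//; apply: (le_trans (ler_norm _)); rewrite [leRHS]mulrC -ler_pdivrMr//.
by apply: ltW; rewrite /n; apply: truncnS_gt.
Qed.

Section planted.
Context (R : realType) (I Sp : finType) (m : spin_model R I Sp).
Local Notation M := (snr m).
Local Notation rho := (ovl m).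
Local Notation u0 := (base m).
Local Notation V := (vect R I).
Implicit Types (b : R) (x : V) (t s u : Sp) (S : R -> bool).

Definition unif : R := #|Sp|%:R^-1.

Lemma card_Sp_gt0 : 0 < #|Sp|%:R :> R.
Proof. by rewrite ltr0n; apply/card_gt0P; exists u0. Qed.

Lemma unif_gt0 : 0 < unif.
Proof. by rewrite invr_gt0 card_Sp_gt0. Qed.

Lemma unif_sum (c : R) : unif * (\sum_(u : Sp) c) = c.
Proof.
by rewrite sumr_const -mulr_natl mulrA mulVf ?mul1r// gt_eqF// card_Sp_gt0.
Qed.

Definition lik b t x : R := expR (b * ham m t x - b ^+ 2 * M / 2).
(** The normalization of the likelihood is included in the weight. It does not depend on the spin,
    so [wgt] is the posterior and [Z] is exactly the likelihood ratio. *)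
Definition prior b (_ : Sp) : R := unif * expR (- (b ^+ 2 * M / 2)).
Definition evid b x : R := Z m (prior b) b x.
Definition post b x t : R := wgt m (prior b) b x t.
Definition flip u x : V := fun i => chi m u i * x i.

Lemma lik_gt0 b t x : 0 < lik b t x. Proof. exact: expR_gt0. Qed.

Lemma tame_lik b t : tame (lik b t).
Proof.
have := tameZ _ _ (expR (- (b ^+ 2 * M / 2))) _ (tame_expR_ham (m := m) b t).
by congr tame; apply/funext => x; rewrite -expRD addrC.
Qed.

Lemma proper_prior b : proper (prior b).
Proof.
split=> [t|]; first by rewrite mulr_ge0 ?expR_ge0// ltW// unif_gt0.
by exists u0; rewrite mulr_gt0 ?expR_gt0// unif_gt0.
Qed.

Lemma evidE b x : evid b x = unif * \sum_t lik b t x.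
Proof.
rewrite mulr_sumr; apply: eq_bigr => t _.
by rewrite /prior /lik -mulrA -expRD addrC.
Qed.

Lemma evid_gt0 b x : 0 < evid b x.
Proof. exact: Z_gt0 (proper_prior b). Qed.

Lemma tame_evid b : tame (evid b).
Proof. exact: tame_Z. Qed.

Lemma post_evid b x t : post b x t * evid b x = unif * lik b t x.
Proof.
by rewrite /post /wgt divfK ?gt_eqF ?evid_gt0// /prior /lik -mulrA -expRD addrC.
Qed.

Lemma ham_flip u t x : ham m (act m u t) (flip u x) = ham m t x.
Proof.
apply: eq_bigr => i _; rewrite coef_act /flip mulrACA -expr2 chi_sqr mul1r//.
Qed.

Lemma reindex_act u (F : Sp -> R) : \sum_t F (act m u t) = \sum_t F t.
Proof. by rewrite [RHS](reindex_inj (act_inj _ _ _ m u)). Qed.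

Lemma evid_flip b u x : evid b (flip u x) = evid b x.
Proof.
rewrite /evid /Z -(reindex_act u); apply: eq_bigr => t _.
by rewrite ham_flip.
Qed.

Lemma post_flip b u t x : post b (flip u x) (act m u t) = post b x t.
Proof.
by rewrite /post /wgt ham_flip -!/(evid _ _) evid_flip.
Qed.

Lemma measurable_shift b t : measurable_fun setT (shift m b t).
Proof.
apply: measurable_vectP => i; apply: measurable_funD => //; exact: measurable_coord.
Qed.

Lemma flip_shift b u x : flip u (shift m b u0 x) = (fun i => chi m u i * x i + b * coef m u i).
Proof.
apply/funext => i; rewrite /flip /shift -{3}(act_base _ _ _ m u) coef_act; ring.
Qed.

(** For an equivariant [f], planting at [base] amounts to planting a uniform spin: the gauge
    symmetry of [u] keeps the law of the noise and carries [base] to [u], and Cameron-Martin then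
    turns the shift into a likelihood. *)
Lemma planted_avg b (f : V -> Sp -> R) : (forall u, measurable_fun setT (f ^~ u)) ->
  (forall x u, 0 <= f x u) -> (forall u t x, f (flip u x) (act m u t) = f x t) ->
  mean (fun x => f (shift m b u0 x) u0) =
  unif * \sum_u mean (fun x => f x u * lik b u x).
Proof.
move=> mf f0 ff; rewrite -[LHS](unif_sum); congr (_ * _); apply: eq_bigr => u _.
transitivity (mean (fun x => f (fun i => chi m u i * x i + b * coef m u i) u)).
  congr mean; apply/funext => x.
  by rewrite -flip_shift -(ff u u0) act_base.
have := mean_affine R I (chi m u) (fun i => b * coef m u i) (f ^~ u) (chi_sqr _ _ _ m u) (mf u) (f0 ^~ u).
move=> ->; congr mean; apply/funext => x; congr (_ * expR _).
rewrite /ham mulr_sumr; congr (_ - _ / _).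
  by apply: eq_bigr => i _; rewrite mulrA.
rewrite -[M]mulr1 -(ovl_diag _ _ _ m u) -coef_dot mulr_sumr; apply: eq_bigr => i _; ring.
Qed.

Lemma mean_lik b t : mean (lik b t) = 1.
Proof.
have := lik_mean (m := m) b t (cst 1) (measurable_cst _) (fun=> ler01).
rewrite mean_cst => ->; congr mean; apply/funext => x; by rewrite mul1r.
Qed.

Lemma mean_evid b : mean (evid b) = 1.
Proof.
have -> : evid b = (fun x => unif * \sum_t lik b t x) by apply/funext => x; rewrite evidE.
rewrite meanZ; last by apply: tame_sum => t; exact: tame_lik.
rewrite mean_sum; last by move=> t; exact: tame_lik.
by under eq_bigr do rewrite mean_lik; rewrite unif_sum.
Qed.

Lemma planted_evid_le b c :
  mean (fun x => ind (evid b (shift m b u0 x) <= c)) =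
  mean (fun x => ind (evid b x <= c) * evid b x).
Proof.
have mi : measurable_fun setT (fun x => ind (evid b x <= c) : R).
  by apply: measurable_indb; apply: measurable_le; exact: tame_measurable (tame_evid b).
have ti : tame (fun x => ind (evid b x <= c)).
  by apply: tame_indb; apply: measurable_le; exact: tame_measurable (tame_evid b).
rewrite (planted_avg b (fun x u => ind (evid b x <= c)))//.
- have tl u : tame (fun x => ind (evid b x <= c) * lik b u x).
    by apply: tameM => //; exact: tame_lik.
  rewrite -mean_sum// -meanZ; last exact: tame_sum.
  by congr mean; apply/funext => x; rewrite -mulr_sumr mulrCA -evidE.
- by move=> u t x; rewrite evid_flip.
Qed.

(** The evidence is the density of the planted law with respect to the null law, so integrating it
    where it is at most [c] gives at most [c]. *)
Lemma planted_evid_small b c : 0 <= c -> mean (fun x => ind (evid b (shift m b u0 x) <= c)) <= c.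
Proof.
move=> c0; rewrite planted_evid_le -[leRHS](mean_cst R I).
apply: le_mean; last 1 first.
- move=> x; case: (leP (evid b x) c) => h; rewrite ?mul1r ?mul0r//.
- apply: tameM; last exact: tame_evid.
  by apply: tame_indb; apply: measurable_le; exact: tame_measurable (tame_evid b).
- exact: tame_cst.
Qed.

Lemma null_evid_large b c : 0 < c -> mean (fun x => ind (c <= evid b x)) <= c^-1.
Proof.
move=> c0.
have -> : c^-1 = mean (fun x => c^-1 * evid b x).
  by rewrite meanZ ?mean_evid ?mulr1//; exact: tame_evid.
apply: le_mean.
- by apply: tame_indb; apply: measurable_ge; exact: tame_measurable (tame_evid b).
- by apply: tameZ; exact: tame_evid.
move=> x; apply: ind_le => [|h]; first by rewrite mulr_ge0 ?invr_ge0 ?(ltW c0) ?(ltW (evid_gt0 _ _)).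
by rewrite mulrC ler_pdivlMr// mul1r.
Qed.

(* Contribution of the spins with overlap in S to the planted evidence,
   as a function of the null noise. *)
Definition wS S b t : R := unif * ind (S (rho t u0)) * expR (b ^+ 2 * M * rho t u0 - b ^+ 2 * M / 2).
Definition evidS S b x : R := Z m (wS S b) b x.
Definition part S b x u : R := unif * \sum_t ind (S (rho t u)) * lik b t x.

Lemma evidS_shift S b x : evidS S b x = part S b (shift m b u0 x) u0.
Proof.
rewrite /part mulr_sumr; apply: eq_bigr => t _; rewrite /wS /lik ham_shift -!mulrA -expRD.
by congr (_ * (_ * expR _)); ring.
Qed.

Lemma evidS_T b x : evidS xpredT b x = evid b (shift m b u0 x).
Proof.
rewrite evidS_shift evidE /part; congr (_ * _); apply: eq_bigr => t _; by rewrite mul1r.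
Qed.

Lemma part_flip S b u t x : part S b (flip u x) (act m u t) = part S b x t.
Proof.
rewrite /part -(reindex_act u); congr (_ * _); apply: eq_bigr => s _.
by rewrite ovl_act /lik ham_flip.
Qed.

Lemma wS_ge0 S b t : 0 <= wS S b t.
Proof. by rewrite !mulr_ge0 ?expR_ge0// ltW// unif_gt0. Qed.

Lemma properS S b t : S (rho t u0) -> proper (wS S b).
Proof.
move=> St; split=> [s|]; first exact: wS_ge0.
by exists t; rewrite /wS St mulr1 mulr_gt0 ?expR_gt0// unif_gt0.
Qed.

Lemma properT b : proper (wS xpredT b).
Proof. exact: (properS xpredT b u0). Qed.

Lemma tame_evidS S b : tame (evidS S b).
Proof. exact: tame_Z. Qed.

Lemma evidS_ge0 S b x : 0 <= evidS S b x.
Proof. by apply: sumr_ge0 => t _; rewrite mulr_ge0 ?expR_ge0// wS_ge0. Qed.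

Lemma evidT_gt0 b x : 0 < evidS xpredT b x.
Proof. exact: Z_gt0 (properT b). Qed.

Lemma wgtT b x t : wgt m (wS xpredT b) b x t = post b (shift m b u0 x) t.
Proof.
rewrite /wgt /post /wgt -!/(evidS _ _ _) -!/(evid _ _) evidS_T; congr (_ / _).
rewrite /wS /prior mulr1 ham_shift -!mulrA -!expRD; congr (_ * expR _); ring.
Qed.

Lemma gavT_ind S b x : gav m (wS xpredT b) b (fun t => ind (S (rho t u0))) x =
  evidS S b x / evidS xpredT b x.
Proof.
rewrite [in RHS]/evidS [in RHS]/Z mulr_suml; apply: eq_bigr => t _.
rewrite /wgt -[Z m _ b x]/(evidS xpredT b x) mulrAC; congr (_ / _).
by rewrite /wS /=; ring.
Qed.

(** The identity [post * evid = unif * lik] turns the planted spin, averaged uniformly, into a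
    second independent posterior sample. *)
Lemma nishimori b (phi : R -> R) : (forall t s, 0 <= phi (rho t s)) ->
  mean (fun x => gav m (wS xpredT b) b (fun t => phi (rho t u0)) x) =
  mean (fun x => gav m (wS xpredT b) b (fun t => gav m (wS xpredT b) b (fun s => phi (rho t s)) x) x).
Proof.
move=> phi0.
have tp t : tame (fun x => post b x t) := tame_wgt _ _ _ (proper_prior b).
have p0 x t : 0 <= post b x t := wgt_ge0 _ _ _ _ (proper_prior b).
pose f x u := \sum_t post b x t * phi (rho t u).
pose g x (u : Sp) := \sum_t post b x t * \sum_s post b x s * phi (rho t s).
have tf u : tame (f ^~ u).
  by apply: tame_sum => t; apply: tameM => //; exact: tame_cst.
have tg u : tame (g ^~ u).
  apply: tame_sum => t; apply: tameM => //; apply: tame_sum => s.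
  by apply: tameM => //; exact: tame_cst.
transitivity (mean (fun x => f (shift m b u0 x) u0)).
  by congr mean; apply/funext => x; apply: eq_bigr => t _; rewrite wgtT.
transitivity (mean (fun x => g (shift m b u0 x) u0)); last first.
  congr mean; apply/funext => x; apply: eq_bigr => t _; rewrite wgtT; congr (_ * _).
  by apply: eq_bigr => s _; rewrite wgtT.
rewrite (planted_avg b f); last 3 first.
- by move=> u; exact: tame_measurable (tf u).
- by move=> x u; apply: sumr_ge0 => t _; rewrite mulr_ge0.
- move=> u t x; rewrite /f -(reindex_act u); apply: eq_bigr => s _.
  by rewrite post_flip ovl_act.
rewrite (planted_avg b g); last 3 first.
- by move=> u; exact: tame_measurable (tg u).
- move=> x u; apply: sumr_ge0 => t _; rewrite mulr_ge0//; apply: sumr_ge0 => s _.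
  by rewrite mulr_ge0.
- move=> u t x; rewrite /g -(reindex_act u); apply: eq_bigr => s _.
  rewrite post_flip; congr (_ * _); rewrite -(reindex_act u); apply: eq_bigr => r _.
  by rewrite post_flip ovl_act.
have tfl u : tame (fun x => f x u * lik b u x) by apply: tameM => //; exact: tame_lik.
have tgl u : tame (fun x => g x u * lik b u x) by apply: tameM => //; exact: tame_lik.
rewrite -!mean_sum// -!meanZ; [|exact: tame_sum..].
congr mean; apply/funext => x.
(* The pair average does not involve the planted spin, so the likelihoods sum to the evidence. *)
have -> : unif * \sum_u g x u * lik b u x = g x u0 * evid b x.
  by rewrite /g -mulr_sumr mulrCA -evidE.
rewrite mulr_sumr.
under eq_bigr => u _ do rewrite /f mulrCA -post_evid mulrA mulr_suml.
rewrite -mulr_suml; congr (_ * _); rewrite /g exchange_big/=; apply: eq_bigr => t _.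
rewrite mulr_sumr; apply: eq_bigr => s _; ring.
Qed.

Definition psi b : R := mean (fun x => ln (evidS xpredT b x)).

(** Under the planted law the log-evidence concentrates near [psi], so [evid <= expR (kap / 2)] is
    unlikely. Back under the null law, the range from [expR (- r)] to [expR (kap / 2)] costs a
    factor [expR r] by change of measure, and larger values are rare by Markov. *)
Lemma psi_large_null_small b kap r : b != 0 -> 0 <= kap -> kap <= psi b ->
  mean (fun x => ind (expR (- r) <= evid b x)) <=
  expR (- (kap / 2)) + expR (r - kap ^+ 2 / (16 * b ^+ 2 * M)).
Proof.
move=> b0 kap0 kpsi.
have me := tame_measurable _ _ _ (tame_evid b).
have tge c : tame (fun x => ind (c <= evid b x)).
  by apply: tame_indb; exact: measurable_ge.
have tle c : tame (fun x => ind (evid b x <= c)).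
  by apply: tame_indb; exact: measurable_le.
have tail := lnZ_lower_tail (m := m) (wS xpredT b) b (kap / 2) (properT b) b0.
have {}tail : mean (fun x => ind (evid b x <= expR (kap / 2)) * evid b x) <=
    expR (- (kap ^+ 2 / (16 * b ^+ 2 * M))).
  rewrite -planted_evid_le.
  have -> : kap ^+ 2 / (16 * b ^+ 2 * M) = (kap / 2) ^+ 2 / (4 * b ^+ 2 * M).
    by field; rewrite gt_eqF ?snr_gt0// b0.
  apply: (le_trans _ (tail _)); last by rewrite divr_ge0.
  apply: le_mean.
  - apply: tame_indb; apply: measurable_le.
    exact: measurableT_comp me (measurable_shift b u0).
  - apply: tame_indb; apply: measurable_le; exact: measurable_lnZ.
  move=> x; apply: ind_le => // h; rewrite -evidS_T in h.
  have l1 : ln (evidS xpredT b x) <= kap / 2 by rewrite -ler_expR lnK// posrE evidT_gt0.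
  have l2 : ln (evidS xpredT b x) <= psi b - kap / 2 by lra.
  have -> : (ln (Z m (wS xpredT b) b x) <=
    mean (fun x => ln (Z m (wS xpredT b) b x)) - kap / 2) = true := l2.
  by [].
apply: (@le_trans _ _ (mean (fun x => ind (expR (kap / 2) <= evid b x) +
    expR r * (ind (evid b x <= expR (kap / 2)) * evid b x)))).
  apply: le_mean => //.
    by apply: tameD => //; apply: tameZ; apply: tameM => //; exact: tame_evid.
  move=> x; apply: ind_le => [|h].
    by rewrite addr_ge0// !mulr_ge0 ?expR_ge0// ltW// evid_gt0.
  have [h2|h2] := leP (expR (kap / 2)) (evid b x).
    by rewrite lerDl !mulr_ge0 ?expR_ge0// ltW// evid_gt0.
  rewrite (ltW h2) mul1r add0r; apply: (@le_trans _ _ (expR r * expR (- r))).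
    by rewrite -expRD subrr expR0.
  by rewrite ler_wpM2l ?expR_ge0.
rewrite meanD//; last by apply: tameZ; apply: tameM => //; exact: tame_evid.
rewrite meanZ; last by apply: tameM => //; exact: tame_evid.
apply: lerD.
  rewrite expRN; apply: null_evid_large; exact: expR_gt0.
by rewrite expRD ler_wpM2l ?expR_ge0.
Qed.

(** Times [M], the mean pair overlap is the squared norm of the Gibbs average of the vectors
    [coef t]. *)
Lemma gav_ovl_ge0 k b x : proper k -> 0 <= gav m k b (fun t => gav m k b (fun s => rho t s) x) x.
Proof.
move=> pk; rewrite -(pmulr_rge0 _ (snr_gt0 _ _ _ m)).
have -> : M * gav m k b (fun t => gav m k b (fun s => rho t s) x) x =
    \sum_i (\sum_t wgt m k b x t * coef m t i) ^+ 2.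
  rewrite /gav mulr_sumr.
  under [RHS]eq_bigr => i _ do rewrite expr2 mulr_suml.
  rewrite exchange_big/=; apply: eq_bigr => t _.
  rewrite mulrCA mulr_sumr.
  under [RHS]eq_bigr => i _ do rewrite mulr_sumr.
  rewrite exchange_big/= mulr_sumr; apply: eq_bigr => s _.
  transitivity (wgt m k b x t * wgt m k b x s * (M * rho t s)); first by ring.
  by rewrite -coef_dot mulr_sumr; apply: eq_bigr => i _; ring.
by apply: sumr_ge0 => i _; exact: sqr_ge0.
Qed.

Lemma tame_gavc k b (f : Sp -> R) : proper k -> tame (gav m k b f).
Proof.
by move=> pk; apply: (tame_gav k b (fun t x => f t)) => // t; exact: tame_cst.
Qed.

Lemma tame_gav2 k b (f : Sp -> Sp -> R) : proper k ->
  tame (fun x => gav m k b (fun t => gav m k b (f t) x) x).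
Proof.
by move=> pk; apply: (tame_gav k b (fun t => gav m k b (f t))) => // t; exact: tame_gavc.
Qed.

Lemma ovlC t s : rho t s = rho s t.
Proof.
apply: (mulfI (lt0r_neq0 (snr_gt0 _ _ _ m))); rewrite -!coef_dot; apply: eq_bigr => i _.
by rewrite mulrC.
Qed.

Lemma ovl_growth k b k' b' (D : Sp -> R) : proper k -> 0 <= b -> b <= b' ->
  (forall t, k' t = k t * expR (D t)) ->
  (b' - b) * (b * M * (1 - mean (fun x => gav m k b (fun t => gav m k b (fun s => rho t s) x) x))) +
  mean (fun x => gav m k b D x) <=
  mean (fun x => ln (Z m k' b' x)) - mean (fun x => ln (Z m k b x)).
Proof.
move=> pk b0 bb' kk; apply: (le_trans _ (lnZ_growth (m := m) k b k' b' D pk b0 bb' kk)).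
suff -> : (fun x => gav m k b (fun t => gav m k b (fun s => rho t s) x) x) =
  (fun x => gav m k b (fun t => gav m k b (fun s => rho s t) x) x) by [].
apply/funext => x; apply: eq_bigr => t _; congr (_ * _); apply: eq_bigr => s _.
by rewrite ovlC.
Qed.

Lemma wS_growth S b b' t : wS S b' t =
  wS S b t * expR ((b' ^+ 2 - b ^+ 2) * M * (rho t u0 - 1 / 2)).
Proof. by rewrite /wS -!mulrA -expRD; congr (_ * (_ * expR _)); ring. Qed.

(** By [nishimori] the mean planted overlap equals the mean pair overlap [q12]. The growth bound
    becomes [(b' - b) * M * b' * q12 - M / 2 * (b' - b) ^+ 2], and [q12] is nonnegative. *)
Lemma psi_growth b b' : 0 <= b -> b <= b' -> psi b <= psi b' + M / 2 * (b' - b) ^+ 2.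
Proof.
move=> b0 bb'; have pT := properT b.
pose D t := (b' ^+ 2 - b ^+ 2) * M * (rho t u0 - 1 / 2).
have := ovl_growth _ _ _ _ D pT b0 bb' (wS_growth xpredT b b').
set q12 := mean (fun x => gav m (wS xpredT b) b (fun t => gav m (wS xpredT b) b (fun s => rho t s) x) x).
(* Overlaps are at least -1, so adding 1 meets the sign condition of [nishimori]; the 1 is removed
   again from both sides. *)
have n := nishimori b (fun r => r + 1) _.
have {n} : mean (fun x => gav m (wS xpredT b) b (fun t => rho t u0) x) = q12.
  move: n; set lhs := mean _ ; set rhs := mean _ => n.
  have l : lhs = mean (fun x => gav m (wS xpredT b) b (fun t => rho t u0) x) + 1.
    rewrite -(mean_cst R I 1) -meanD; [|exact: tame_gavc|exact: tame_cst].
    by congr mean; apply/funext => x; rewrite -[in RHS](gav_cst (m := m) _ b 1 x pT) -gavD.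
  have r : rhs = q12 + 1.
    rewrite -(mean_cst R I 1) -meanD; [|exact: tame_gav2|exact: tame_cst].
    congr mean; apply/funext => x; rewrite -[in RHS](gav_cst (m := m) _ b 1 x pT) -gavD.
    by apply: eq_bigr => t _; congr (_ * _); rewrite gavD !gav_cst.
  have : lhs = rhs.
    by apply: n => t s; have := ovl_le1 _ _ _ m t s; rewrite ler_norml; lra.
  lra.
move=> q01.
have q0 : 0 <= q12 by apply: mean_ge0 => x; exact: gav_ovl_ge0.
have -> : mean (fun x => gav m (wS xpredT b) b D x) =
    (b' ^+ 2 - b ^+ 2) * M * (q12 - 1 / 2).
  rewrite -q01 -(mean_cst R I (1 / 2)) -meanB; [|exact: tame_gavc|exact: tame_cst].
  rewrite -meanZ; last by apply: tameB; [exact: tame_gavc|exact: tame_cst].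
  congr mean; apply/funext => x; rewrite gavZ; congr (_ * _).
  by rewrite gavD gav_cst.
have h : 0 <= (b' - b) * M * b' * q12.
  by rewrite !mulr_ge0 ?subr_ge0// ?(ltW (snr_gt0 _ _ _ m))// (le_trans b0).
rewrite -/(psi b) -/(psi b') (_ : _ + _ = (b' - b) * M * b' * q12 - M / 2 * (b' - b) ^+ 2); last by field.
by move: h; move: (_ * q12) (M / 2 * _) (psi b) (psi b') => t c p p' h g; lra.
Qed.

Lemma psi_nondecreasing b b' : 0 <= b -> b <= b' -> psi b <= psi b'.
Proof. exact: quadratic_defect_nondecreasing psi_growth b b'. Qed.

Definition gavS S b (f : Sp -> R) x : R := gav m (wS S b) b f x.

(** The planted tilt contributes through [v <= rho t u0] on the set, while the energy loses the
    mutual overlap, at most [v'] apart from the mass of exceptional pairs. The term [(b' - b) / 2]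
    is what remains of the normalizations. *)
Lemma evidS_growth (S : R -> bool) (b b' v v' : R) (t0 : Sp) : 0 <= b -> b <= b' -> S (rho t0 u0) ->
  0 <= v' -> (forall t, S (rho t u0) -> v <= rho t u0) ->
  (b' - b) * M * ((b' + b) * v - (b' - b) / 2 - b * (v' +
    mean (fun x => gavS S b (fun t => gavS S b (fun s => ind (v' <= rho t s)) x) x))) <=
  mean (fun x => ln (evidS S b' x)) - mean (fun x => ln (evidS S b x)).
Proof.
move=> b0 bb' St0 v'0 Sv; have pS := properS S b t0 St0.
have bb0 : 0 <= b' - b by rewrite subr_ge0.
have M0 := snr_gt0 _ _ _ m.
pose D t := (b' ^+ 2 - b ^+ 2) * M * (rho t u0 - 1 / 2).
apply: (le_trans _ (ovl_growth _ _ _ _ D pS b0 bb' (wS_growth S b b'))).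
set q12 := mean (fun x => gav m (wS S b) b (fun t => gav m (wS S b) b (fun s => rho t s) x) x).
set th := mean _.
have q12_le : q12 <= v' + th.
  rewrite -(mean_cst R I v') -meanD; [|exact: tame_cst|exact: tame_gav2].
  apply: le_mean; [exact: tame_gav2|by apply: tameD; [exact: tame_cst|exact: tame_gav2]|].
  move=> x; apply: (@le_trans _ _ (gav m (wS S b) b (fun t =>
      v' + gavS S b (fun s => ind (v' <= rho t s)) x) x)); last first.
    by rewrite gavD gav_cst.
  apply: le_gav => // t _.
  apply: (@le_trans _ _ (gav m (wS S b) b (fun s => v' + ind (v' <= rho t s)) x)); last first.
    by rewrite gavD gav_cst.
  apply: le_gav => // s _; have [h|h] := leP v' (rho t s); last by rewrite addr0 ltW.
  have := ovl_le1 _ _ _ m t s; rewrite ler_norml => /andP[_ r1].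
  by apply: (le_trans r1); rewrite lerDr.
have D_ge : (b' ^+ 2 - b ^+ 2) * M * (v - 1 / 2) <= mean (fun x => gav m (wS S b) b D x).
  rewrite -[leLHS](mean_cst R I); apply: le_mean; [exact: tame_cst|exact: tame_gavc|].
  move=> x; rewrite -[leLHS](gav_cst (m := m) _ b _ x pS); apply: le_gav => // t wt.
  rewrite ler_wpM2l//.
    rewrite mulr_ge0 ?(ltW M0)// subr_sqr mulr_ge0//; lra.
  rewrite lerD2r; apply: Sv; move: wt; rewrite /wS.
  by case: (S (rho t u0)); rewrite // mulr0 mul0r ltxx.
have q_ge : (b' - b) * (b * M * (1 - (v' + th))) <= (b' - b) * (b * M * (1 - q12)).
  apply: ler_wpM2l => //; apply: ler_wpM2l; first by rewrite mulr_ge0// ltW.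
  by rewrite lerB.
apply: (le_trans _ (lerD q_ge D_ge)).
by rewrite le_eqVlt; apply/orP; left; apply/eqP; field.
Qed.

(** A restricted weight is at most the full weight times the ratio of the two evidences, so a pair
    average picks up the square of this ratio, outside two exceptional events. *)
Lemma gavS_pair_le S b r1 r2 (F : Sp -> Sp -> bool) t0 x : S (rho t0 u0) -> 0 < r1 -> 
  gavS S b (fun t => gavS S b (fun s => ind (F t s)) x) x <=
  (r2 / r1) ^+ 2 * gavS xpredT b (fun t => gavS xpredT b (fun s => ind (F t s)) x) x +
  (ind (evidS S b x <= r1) + ind (r2 <= evidS xpredT b x)).
Proof.
move=> St0 r10; have pS := properS S b t0 St0; have pT := properT b.
set g := gavS xpredT b _ x.
have g0 : 0 <= g by apply: gav_ge0 => // t; apply: gav_ge0 => // s; rewrite ler0n.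
have le1 : gavS S b (fun t => gavS S b (fun s => ind (F t s)) x) x <= 1.
  rewrite -[leRHS](gav_cst (m := m) _ b 1 x pS); apply: le_gav => // t _.
  rewrite -[leRHS](gav_cst (m := m) _ b 1 x pS); apply: le_gav => // s _.
  by case: (F t s).
have s0 : 0 <= (r2 / r1) ^+ 2 * g by rewrite mulr_ge0// sqr_ge0.
have [h1|h1] := leP (evidS S b x) r1.
  by apply: (le_trans le1); rewrite addrCA lerDl addr_ge0 ?ler0n.
have [h2|h2] := leP r2 (evidS xpredT b x).
  by apply: (le_trans le1); rewrite addrA lerDr addr_ge0 ?ler0n.
rewrite addr0 addr0.
have eS : 0 < evidS S b x := lt_trans r10 h1.
have eT := evidT_gt0 b x.
have ratio : evidS xpredT b x / evidS S b x <= r2 / r1.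
  apply: ler_pM; rewrite ?(ltW eT) ?invr_ge0 ?(ltW eS)// ?(ltW h2)//.
  by rewrite lef_pV2 ?posrE// ltW.
have ratio0 : 0 <= evidS xpredT b x / evidS S b x by rewrite divr_ge0 ?ltW.
have w_le t : wgt m (wS S b) b x t <=
    evidS xpredT b x / evidS S b x * wgt m (wS xpredT b) b x t.
  rewrite /wgt -[Z m (wS S b) b x]/(evidS S b x) -[Z m (wS xpredT b) b x]/(evidS xpredT b x).
  rewrite (_ : _ / _ * _ = wS xpredT b t * expR (b * ham m t x) / evidS S b x); last first.
    by field; rewrite !gt_eqF.
  apply: ler_wpM2r; first by rewrite invr_ge0 ltW.
  rewrite ler_wpM2r ?expR_ge0// /wS ler_wpM2r ?expR_ge0// ler_wpM2l ?(ltW unif_gt0)//.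
  by case: (S _).
have w0 t : 0 <= wgt m (wS S b) b x t := wgt_ge0 _ _ _ _ pS.
apply: (@le_trans _ _ ((evidS xpredT b x / evidS S b x) ^+ 2 * g)); last first.
  by rewrite ler_wpM2r// ler_pXn2r ?nnegrE// (le_trans ratio0).
set c := _ / _ in ratio0 w_le *.
have dom f : (forall t, 0 <= f t) -> gavS S b f x <= c * gavS xpredT b f x.
  move=> f0; rewrite /gavS /gav mulr_sumr; apply: ler_sum => t _.
  by rewrite mulrA ler_wpM2r.
apply: (le_trans (dom _ _)) => [t|]; first by apply: gav_ge0 => // s; rewrite ler0n.
rewrite expr2 -mulrA ler_wpM2l// /g -gavZ; apply: le_gav => // t _.
by apply: dom => s; rewrite ler0n.
Qed.

(** The posterior mass of [S] is a ratio of evidences. It is at most [r] unless the numerator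
    reaches [r ^+ 2] or the denominator is at most [r], and the latter has planted probability at
    most [r]. *)
Lemma gavT_part_le S b r : 0 < r ->
  mean (fun x => gavS xpredT b (fun t => ind (S (rho t u0))) x) <=
  mean (fun x => ind (r ^+ 2 <= evidS S b x)) + (r + r).
Proof.
move=> r0.
have t1 : tame (fun x => ind (r ^+ 2 <= evidS S b x)).
  by apply: tame_indb; apply: measurable_ge; exact: tame_measurable (tame_evidS S b).
have t2 : tame (fun x => ind (evidS xpredT b x <= r)).
  by apply: tame_indb; apply: measurable_le; exact: tame_measurable (tame_evidS _ b).
have p2 : mean (fun x => ind (evidS xpredT b x <= r)) <= r.
  apply: (le_trans _ (planted_evid_small b r (ltW r0))).
  by under eq_fun do rewrite evidS_T.
apply: (@le_trans _ _ (mean (fun x => ind (r ^+ 2 <= evidS S b x) +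
    (ind (evidS xpredT b x <= r) + r)))); last first.
  rewrite meanD//; last by apply: tameD => //; exact: tame_cst.
  by rewrite meanD ?mean_cst ?lerD2l ?lerD2r//; exact: tame_cst.
apply: le_mean.
- exact: tame_gavc (properT b).
- by apply: tameD => //; apply: tameD => //; exact: tame_cst.
move=> x; rewrite /gavS gavT_ind.
have eT := evidT_gt0 b x; have eS := evidS_ge0 S b x.
have le1 : evidS S b x / evidS xpredT b x <= 1.
  rewrite -gavT_ind -[leRHS](gav_cst (m := m) _ b 1 x (properT b)).
  by apply: le_gav => [|t _]; [exact: properT|case: (S _)].
have [h1|h1] := leP (r ^+ 2) (evidS S b x).
  by apply: (le_trans le1); rewrite lerDl addr_ge0 ?ler0n// ltW.
have [h2|h2] := leP (evidS xpredT b x) r.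
  by apply: (le_trans le1); rewrite add0r lerDl ltW.
rewrite !add0r ler_pdivrMr//; apply: (le_trans (ltW h1)).
by rewrite expr2 ler_wpM2l// ltW.
Qed.

End planted.

Arguments unif {R} Sp.
Arguments card_Sp_gt0 {R I Sp m}.
Arguments unif_gt0 {R I Sp m}.
Arguments unif_sum {R I Sp m}.
Arguments lik {R I Sp} m b t x.
Arguments prior {R I Sp} m b _.
Arguments evid {R I Sp} m b x.
Arguments post {R I Sp} m b x t.
Arguments flip {R I Sp} m u x _.
Arguments lik_gt0 {R I Sp m}.
Arguments tame_lik {R I Sp m}.
Arguments proper_prior {R I Sp m}.
Arguments evidE {R I Sp m}.
Arguments evid_gt0 {R I Sp m}.
Arguments tame_evid {R I Sp m}.
Arguments post_evid {R I Sp m}.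
Arguments ham_flip {R I Sp m}.
Arguments reindex_act {R I Sp m}.
Arguments evid_flip {R I Sp m}.
Arguments post_flip {R I Sp m}.
Arguments measurable_shift {R I Sp m}.
Arguments flip_shift {R I Sp m}.
Arguments planted_avg {R I Sp m}.
Arguments mean_lik {R I Sp m}.
Arguments mean_evid {R I Sp m}.
Arguments planted_evid_le {R I Sp m}.
Arguments planted_evid_small {R I Sp m}.
Arguments null_evid_large {R I Sp m}.
Arguments wS {R I Sp} m S b t.
Arguments evidS {R I Sp} m S b x.
Arguments part {R I Sp} m S b x u.
Arguments evidS_shift {R I Sp m}.
Arguments evidS_T {R I Sp m}.
Arguments part_flip {R I Sp m}.
Arguments wS_ge0 {R I Sp m}.
Arguments properS {R I Sp m}.
Arguments properT {R I Sp m}.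
Arguments tame_evidS {R I Sp m}.
Arguments evidS_ge0 {R I Sp m}.
Arguments evidT_gt0 {R I Sp m}.
Arguments wgtT {R I Sp m}.
Arguments gavT_ind {R I Sp m}.
Arguments nishimori {R I Sp m}.
Arguments psi {R I Sp} m b.
Arguments psi_large_null_small {R I Sp m}.
Arguments gav_ovl_ge0 {R I Sp m}.
Arguments tame_gavc {R I Sp m}.
Arguments tame_gav2 {R I Sp m}.
Arguments ovlC {R I Sp m}.
Arguments ovl_growth {R I Sp m}.
Arguments wS_growth {R I Sp m}.
Arguments psi_growth {R I Sp m}.
Arguments psi_nondecreasing {R I Sp m}.
Arguments gavS {R I Sp} m S b f x.
Arguments evidS_growth {R I Sp m}.
Arguments gavS_pair_le {R I Sp m}.
Arguments gavT_part_le {R I Sp m}.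

(** * Exponential smallness of large overlaps below the threshold *)

Lemma near_expR_le (R : realType) (c e : R) : 0 < c -> 0 < e ->
  \forall n \near \oo, expR (- (c * n.+1%:R)) <= e.
Proof.
move=> c0 e0; near=> n.
have n0 : (0 : R) < n.+1%:R by rewrite ltr0n.
have cn0 : 0 < c * n.+1%:R by rewrite mulr_gt0.
rewrite expRN -[leRHS]invrK lef_pV2 ?posrE ?expR_gt0 ?invr_gt0//.
apply: (le_trans _ (expR_ge1Dx _)).
have h : (c * e)^-1 <= n%:R by near: n; exact: nbhs_infty_ger.
have : e^-1 <= c * n%:R.
  by rewrite -ler_pdivrMl// -invfM.
have : c * n%:R <= c * n.+1%:R by rewrite ler_pM2l// ler_nat.
lra.
Unshelve. all: by end_near. Qed.

Section sequence.
Context (R : realType) (I Sp : nat -> finType) (m : forall n, spin_model R (I n) (Sp n)).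
Hypothesis snrE : forall n, snr (m n) = n.+1%:R / 2.

Definition null_nondegenerate b := forall d : R, 0 < d ->
  \forall n \near \oo, 1 / 2 <= mean (fun x => ind (expR (- (d * n.+1%:R)) <= evid (m n) b x)).

Definition psi_sublinear b := forall d : R, 0 < d ->
  \forall n \near \oo, psi (m n) b <= d * n.+1%:R.

(** A linearly large [psi] would make the null evidence exponentially small with probability above
    one half. *)
Lemma null_nondegenerate_psi b : 0 < b -> null_nondegenerate b -> psi_sublinear b.
Proof.
move=> b0 H d d0.
(* Half of the rate in [psi_large_null_small] when [snr] is [n.+1 / 2], so that its second term
   becomes [expR (- (c * n.+1))]. *)
pose c := d ^+ 2 / (16 * b ^+ 2).
have b2 : 0 < b ^+ 2 by rewrite exprn_gt0.
have c0 : 0 < c by rewrite divr_gt0 ?exprn_gt0// mulr_gt0.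
have d20 : 0 < d / 2 by rewrite divr_gt0.
near=> n.
rewrite leNgt; apply/negP => /ltW hpsi.
have n0 : (0 : R) < n.+1%:R by rewrite ltr0n.
have dn0 : 0 <= d * n.+1%:R by rewrite mulr_ge0// ltW.
have h1 : 1 / 2 <= mean (fun x => ind (expR (- (c * n.+1%:R)) <= evid (m n) b x)).
  by near: n; exact: H.
have := psi_large_null_small b (d * n.+1%:R) (c * n.+1%:R) (lt0r_neq0 b0) dn0 hpsi.
rewrite snrE.
have -> : c * n.+1%:R - (d * n.+1%:R) ^+ 2 / (16 * b ^+ 2 * (n.+1%:R / 2)) = - (c * n.+1%:R).
  by rewrite /c; field; rewrite gt_eqF// gt_eqF.
have h2 : expR (- (c * n.+1%:R)) <= 1 / 8 by near: n; exact: near_expR_le.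
have h3 : expR (- (d / 2 * n.+1%:R)) <= 1 / 8 by near: n; exact: near_expR_le.
rewrite (mulrAC d) => h4; lra.
Unshelve. all: by end_near. Qed.

Lemma psi_sublinear_le b b' : 0 <= b -> b <= b' -> psi_sublinear b' -> psi_sublinear b.
Proof.
move=> b0 bb' H d d0; near=> n; apply: (@le_trans _ _ (psi (m n) b')).
  exact: psi_nondecreasing.
by near: n; exact: H.
Unshelve. all: by end_near. Qed.

Definition above (v r : R) : bool := v <= r.

(** One rate serves for the level and for the probability. Decreasing it weakens both, so rates can
    be combined by a minimum. *)
Definition exp_small b v := exists2 c : R, 0 < c &
  \forall n \near \oo, mean (fun x => ind (expR (- (c * n.+1%:R)) <= evidS (m n) (above v) b x)) <=
    expR (- (c * n.+1%:R)).

Lemma exp_small_gt1 b v : 1 < v -> exp_small b v.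
Proof.
move=> v1; exists 1 => //; near=> n.
rewrite (_ : (fun x => _) = fun=> 0) ?mean_cst ?expR_ge0//; apply/funext => x.
rewrite leNgt (_ : evidS _ _ _ _ = 0) ?expR_gt0//.
rewrite /evidS /Z big1// => t _; rewrite /wS /above.
have := ovl_le1 _ _ _ (m n) t (base (m n)); rewrite ler_norml => /andP[_ h].
by rewrite leNgt (le_lt_trans h v1)/= mulr0n mulr0 !mul0r.
Unshelve. all: by end_near. Qed.

(** A dichotomy on the mean [Phi] of the log-evidence of the shell [S]. If [Phi] is below [- d * N],
    concentration makes the shell exponentially small. Otherwise the shell measure is dominated by
    the posterior at an exponential cost that the smallness above [v'] pays for; its pairs then
    rarely exceed [v'], and [evidS_growth] contradicts the sublinearity of [psi] at [b1]. *)
Lemma exp_small_step b b' v : 0 < b -> b < b' -> psi_sublinear b' -> 0 < v ->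
  exp_small b (5 / 4 * v) -> exp_small b v.
Proof.
move=> b0 bb' Hpsi v0 [c' c'0 Hc'].
pose v' := 5 / 4 * v.
pose S r : bool := (v <= r) && (r < v').
(* The increment is at most [b * v], so the term [(b1 - b) / 2] of [evidS_growth] costs at most
   [b * v / 2]. *)
pose b1 := Num.min b' (b + b * v).
have bv0 : 0 < b * v by rewrite mulr_gt0.
have bb1 : b < b1 by rewrite lt_min bb' ltrDl.
have b1b : b1 - b <= b * v by rewrite lerBlDl ge_min lexx orbT.
(* From [2 * v - 5 / 4 * v] the increment takes [v / 2] and the exceptional pairs [v / 8]. The
   remaining [b * v / 8] times [(b1 - b) * snr] is [c0 * N]. *)
pose c0 := (b1 - b) * (b * v) / 16.
have c00 : 0 < c0 by rewrite divr_gt0// mulr_gt0// subr_gt0.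
(* The bound [c0 / 2] lets the growth exceed the starting deficit [d * N]; the bound [c' / 24] keeps
   the squared comparison ratio [expR (6 * d * N)] below half of the available decay [c' / 2]. *)
pose d := Num.min (c0 / 2) (c' / 24).
have d0 : 0 < d by rewrite lt_min; apply/andP; split; lra.
have dc0 : d <= c0 / 2 by rewrite ge_min lexx.
have dc' : 6 * d <= c' / 4.
  have : d <= c' / 24 by rewrite ge_min lexx orbT.
  lra.
have b2 : 0 < b ^+ 2 by rewrite exprn_gt0.
(* Concentration rate of a deviation [d / 2 * N]. *)
pose k := d ^+ 2 / (8 * b ^+ 2).
have k0 : 0 < k by rewrite divr_gt0 ?exprn_gt0// mulr_gt0.
(* [2 * c] is below every available rate, which leaves room to add two error terms. *)
pose c := Num.min (Num.min (d / 2) c') k / 2.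
have c0' : 0 < c.
  by rewrite divr_gt0// !lt_min k0 c'0 andbT andbT; lra.
have c_d : 2 * c <= d / 2 by rewrite /c mulrC divfK// !ge_min lexx.
have c_c' : 2 * c <= c' by rewrite /c mulrC divfK// !ge_min lexx orbT.
have c_k : 2 * c <= k by rewrite /c mulrC divfK// !ge_min lexx !orbT.
exists c => //.
have Hpsib : psi_sublinear b by apply: (psi_sublinear_le b b') => //; exact: ltW.
have Hpsib1 : psi_sublinear b1.
  apply: (psi_sublinear_le b1 b') => //; last by rewrite ge_min lexx.
  by apply: ltW; exact: lt_trans bb1.
near=> n.
set N : R := n.+1%:R.
have N0 : 0 < N by rewrite ltr0n.
have M0 := snr_gt0 _ _ _ (m n).
have Nexp r r' : r <= r' -> expR (- (r' * N)) <= expR (- (r * N)).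
  by move=> rr'; rewrite ler_expR lerN2 ler_pM2r.
have tail_eq r : (r * N) ^+ 2 / (4 * b ^+ 2 * snr (m n)) = (r ^+ 2 / (2 * b ^+ 2)) * N.
  by rewrite snrE; field; rewrite gt_eqF// gt_eqF.
have Hv' : mean (fun x => ind (expR (- (c' * N)) <= evidS (m n) (above v') b x)) <= expR (- (c' * N)).
  by rewrite /N; near: n.
have mS Q : measurable_fun setT (evidS (m n) Q b) := tame_measurable _ _ _ (tame_evidS Q b).
have tge Q e : tame (fun x => ind (e <= evidS (m n) Q b x)).
  by apply: tame_indb; exact: measurable_ge.
have tle Q e : tame (fun x => ind (evidS (m n) Q b x <= e)).
  by apply: tame_indb; exact: measurable_le.
have shell : mean (fun x => ind (expR (- (d / 2 * N)) <= evidS (m n) S b x)) <= expR (- (k * N)).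
  have [[t0 St0]|noS] := pselect (exists t0, S (ovl (m n) t0 (base (m n)))); last first.
    rewrite (_ : (fun x => _) = fun=> 0) ?mean_cst ?expR_ge0//; apply/funext => x.
    rewrite leNgt (_ : evidS _ _ _ _ = 0) ?expR_gt0//.
    rewrite /evidS /Z big1// => t _; rewrite /wS; case: (boolP (S _)) => [St|_].
      by case: noS; exists t.
    by rewrite mulr0n mulr0 !mul0r.
  have pS b'' := properS S b'' t0 St0.
  set Phi := mean (fun x => ln (evidS (m n) S b x)).
  have [Phi_le|Phi_gt] := leP Phi (- (d * N)).
    have dN0 : 0 <= d / 2 * N by rewrite mulr_ge0// ltW// divr_gt0.
    have := lnZ_upper_tail (m := m n) _ b _ (pS b) (lt0r_neq0 b0) dN0.
    rewrite tail_eq (_ : (d / 2) ^+ 2 / (2 * b ^+ 2) = k); last by rewrite /k; field; rewrite gt_eqF.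
    apply: le_trans; apply: le_mean => [||x].
    - exact: tge.
    - by apply: tame_indb; apply: measurable_ge; exact: measurable_lnZ.
    apply: ind_le => // h.
    have l1 : - (d / 2 * N) <= ln (evidS (m n) S b x).
      by rewrite -ler_expR lnK// posrE (lt_le_trans (expR_gt0 _) h).
    have l2 : Phi + d / 2 * N <= ln (evidS (m n) S b x) by clear -snrE l1 Phi_le; lra.
    by have -> : (mean (fun x0 => ln (Z (m n) (wS (m n) S b) b x0)) + d / 2 * N <=
      ln (Z (m n) (wS (m n) S b) b x)) = true := l2.
  exfalso.
  have psib : psi (m n) b <= d / 2 * N.
    by rewrite /N; near: n; apply: Hpsib; rewrite divr_gt0.
  have psib1 : psi (m n) b1 <= c0 / 4 * N.
    by rewrite /N; near: n; apply: Hpsib1; rewrite divr_gt0.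
  have dN0 : 0 <= d * N by rewrite mulr_ge0// ltW.
  have dN20 : 0 <= d / 2 * N by rewrite mulr_ge0// ltW// divr_gt0.
  (* Up to exponentially small probability the shell evidence exceeds [r1], because [Phi > - d * N],
     and the full evidence stays below [r2], because [psi] is sublinear at [b]. *)
  pose r1 := expR (- (2 * d * N)); pose r2 := expR (d * N).
  have th_le : mean (fun x => gavS (m n) S b (fun t => gavS (m n) S b (fun s => ind (v' <= ovl (m n) t s)) x) x) <= v / 8.
    have gT : mean (fun x => gavS (m n) xpredT b (fun t => gavS (m n) xpredT b (fun s => ind (v' <= ovl (m n) t s)) x) x) <=
        3 * expR (- (c' / 2 * N)).
      (* Two posterior samples are traded for one sample and the planted spin, whose overlaps above
         [v'] are covered by the assumption. *)
      rewrite -(nishimori b (fun r => ind (v' <= r))); last by move=> t s; rewrite ler0n.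
      apply: (le_trans (gavT_part_le (above v') b (expR (- (c' / 2 * N))) (expR_gt0 _))).
      rewrite -expRM_natl (_ : 2 * - (c' / 2 * N) = - (c' * N)); last by field.
      have : expR (- (c' * N)) <= expR (- (c' / 2 * N)) by apply: Nexp; clear -snrE c'0; lra.
      apply: (fun h => le_trans (lerD Hv' (lexx _)) _).
      move: (expR _) (expR _) => p q pq; clear -snrE pq; lra.
    have pl : mean (fun x => ind (evidS (m n) S b x <= r1)) <= expR (- (k * N)).
      have := lnZ_lower_tail (m := m n) _ b _ (pS b) (lt0r_neq0 b0) dN0.
      rewrite tail_eq => h; apply: (le_trans _ (le_trans h _)); last first.
        apply: Nexp; rewrite /k ler_pdivlMr ?mulr_gt0// mulrAC ler_pdivrMr ?mulr_gt0//.
        have h0 : 0 <= d ^+ 2 * b ^+ 2 by rewrite mulr_ge0// ?sqr_ge0.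
        by clear -snrE h0; lra.
      apply: le_mean => [||x].
      - exact: tle.
      - by apply: tame_indb; apply: measurable_le; exact: measurable_lnZ.
      apply: ind_le => // hx.
      have eS : 0 < evidS (m n) S b x := Z_gt0 _ _ _ (pS b).
      have l1 : ln (evidS (m n) S b x) <= - (2 * d * N) by rewrite -ler_expR lnK ?posrE.
      have l2 : ln (evidS (m n) S b x) <= Phi - d * N by clear -snrE l1 Phi_gt; lra.
      by have -> : (ln (Z (m n) (wS (m n) S b) b x) <=
        mean (fun x0 => ln (Z (m n) (wS (m n) S b) b x0)) - d * N) = true := l2.
    have pu : mean (fun x => ind (r2 <= evidS (m n) xpredT b x)) <= expR (- (k * N)).
      have := lnZ_upper_tail (m := m n) _ b _ (properT (m := m n) b) (lt0r_neq0 b0) dN20.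
      rewrite tail_eq (_ : (d / 2) ^+ 2 / (2 * b ^+ 2) = k); last by rewrite /k; field; rewrite gt_eqF.
      apply: le_trans; apply: le_mean => [||x].
      - exact: tge.
      - by apply: tame_indb; apply: measurable_ge; exact: measurable_lnZ.
      apply: ind_le => // hx.
      have l1 : d * N <= ln (evidS (m n) xpredT b x).
        by rewrite -ler_expR lnK// posrE evidT_gt0.
      have l2 : psi (m n) b + d / 2 * N <= ln (evidS (m n) xpredT b x) by clear -snrE l1 psib; lra.
      by have -> : (mean (fun x0 => ln (Z (m n) (wS (m n) xpredT b) b x0)) + d / 2 * N <=
        ln (Z (m n) (wS (m n) xpredT b) b x)) = true := l2.
    have gt2 Q : proper (wS (m n) Q b) ->
      tame (fun x => gavS (m n) Q b (fun t => gavS (m n) Q b (fun s => ind (v' <= ovl (m n) t s)) x) x).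
      by move=> pQ; exact: (tame_gav2 _ _ _ pQ).
    have H1 : mean (fun x => gavS (m n) S b (fun t => gavS (m n) S b (fun s => ind (v' <= ovl (m n) t s)) x) x) <=
       (r2 / r1) ^+ 2 * (3 * expR (- (c' / 2 * N))) + (expR (- (k * N)) + expR (- (k * N))).
      apply: (@le_trans _ _ (mean (fun x => (r2 / r1) ^+ 2 *
         gavS (m n) xpredT b (fun t => gavS (m n) xpredT b (fun s => ind (v' <= ovl (m n) t s)) x) x +
         (ind (evidS (m n) S b x <= r1) + ind (r2 <= evidS (m n) xpredT b x))))).
        apply: le_mean => [||x].
        - exact: gt2.
        - apply: tameD; last exact: tameD.
          by apply: tameZ; apply: gt2; exact: properT.
        - exact: (gavS_pair_le S b r1 r2 _ t0 x St0 (expR_gt0 _)).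
      rewrite meanD; last 2 first.
      - by apply: tameZ; apply: gt2; exact: properT.
      - exact: tameD.
      rewrite meanD// meanZ; last by apply: gt2; exact: properT.
      apply: lerD; last exact: lerD.
      by rewrite ler_wpM2l ?sqr_ge0.
    apply: (le_trans H1).
    have -> : (r2 / r1) ^+ 2 * (3 * expR (- (c' / 2 * N))) = 3 * expR (- ((c' / 2 - 6 * d) * N)).
      rewrite /r1 /r2 -expRN -expRD -expRM_natl mulrCA -expRD; congr (_ * expR _); ring.
    have e1 : expR (- ((c' / 2 - 6 * d) * N)) <= expR (- (c' / 4 * N)) by apply: Nexp; clear -snrE dc'; lra.
    have e2 : expR (- (c' / 4 * N)) <= v / 100 by rewrite /N; near: n; apply: near_expR_le; rewrite divr_gt0.
    have e3 : expR (- (k * N)) <= v / 100 by rewrite /N; near: n; apply: near_expR_le => //; rewrite divr_gt0.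
    move: e1 e2 e3.
    move: (expR _) (expR _) (expR _) => p q r e1 e2 e3; clear -snrE e1 e2 e3 v0; lra.
  have v'0 : 0 <= v' by rewrite /v'; clear -snrE v0; lra.
  have Sv t : S (ovl (m n) t (base (m n))) -> v <= ovl (m n) t (base (m n)) by case/andP.
  have := evidS_growth S b b1 v v' t0 (ltW b0) (ltW bb1) St0 v'0 Sv.
  set th := mean _ in th_le * => gr.
  have gr2 : c0 * N <= (b1 - b) * snr (m n) * ((b1 + b) * v - (b1 - b) / 2 - b * (v' + th)).
    have -> : c0 * N = (b1 - b) * snr (m n) * (b * v / 8) by rewrite snrE /c0 -/N; field.
    apply: ler_wpM2l; first by rewrite mulr_ge0// ?subr_ge0 ltW.
    have h1 : b * th <= b * (v / 8) by rewrite ler_pM2l.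
    have h2 : 0 <= (b1 - b) * v by rewrite mulr_ge0// ltW// subr_gt0.
    by rewrite /v'; clear -snrE h1 h2 b1b; lra.
  (* The shell evidence is at most the full one, so its mean logarithm at [b1] cannot exceed
     [psi]. *)
  have le_psi : mean (fun x => ln (evidS (m n) S b1 x)) <= psi (m n) b1.
    apply: le_mean => [||x].
    - exact: tame_lnZ (pS b1).
    - exact: tame_lnZ (properT b1).
    rewrite ler_ln ?posrE; [|exact: Z_gt0 (pS b1)|exact: evidT_gt0].
    apply: ler_sum => t _; rewrite ler_wpM2r ?expR_ge0//.
    by rewrite /wS ler_wpM2r ?expR_ge0// ler_wpM2l ?(ltW (unif_gt0 (m := m n)))//; case: (S _).
  have cN0 : 0 < c0 * N by rewrite mulr_gt0.
  have dcN : d * N <= c0 / 2 * N by rewrite ler_pM2r.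
  move: (le_trans gr2 gr) le_psi psib1 Phi_gt dcN cN0.
  rewrite -/Phi; move: (mean _) (psi _ _) => p q h1 h2 h3 h4 h5 h6; clear -snrE h1 h2 h3 h4 h5 h6; lra.
have split x : evidS (m n) (above v) b x = evidS (m n) S b x + evidS (m n) (above v') b x.
  rewrite /evidS /Z -big_split/=; apply: eq_bigr => t _; rewrite -mulrDl; congr (_ * _).
  rewrite /wS -mulrDl; congr (_ * _); rewrite -mulrDr; congr (_ * _).
  rewrite /above /S; case: (leP v' (ovl (m n) t _)) => h.
    by rewrite andbF mulr0n add0r (le_trans _ h)// /v'; clear -snrE v0; lra.
  by rewrite andbT addr0.
have half : expR (- (c * N)) <= 1 / 2 by rewrite /N; near: n; apply: near_expR_le.
have c2 : expR (- (2 * c * N)) = expR (- (c * N)) * expR (- (c * N)).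
  by rewrite -expRD; congr expR; ring.
have e0 := expR_gt0 (- (c * N)).
have c2' : expR (- (2 * c * N)) <= expR (- (c * N)) * (1 / 2).
  by rewrite c2 ler_pM2l.
apply: (@le_trans _ _ (mean (fun x => ind (expR (- (d / 2 * N)) <= evidS (m n) S b x) +
    ind (expR (- (c' * N)) <= evidS (m n) (above v') b x)))).
  apply: le_mean => [||x]; [exact: tge|exact: tameD|].
  apply: ind_le => [|h]; first by rewrite addr_ge0 ?ler0n.
  have [h1|h1] := leP (expR (- (d / 2 * N))) (evidS (m n) S b x).
    by rewrite lerDl ler0n.
  have [h2|h2] := leP (expR (- (c' * N))) (evidS (m n) (above v') b x).
    by rewrite lerDr ler0n.
  exfalso; rewrite split in h.
  have g1 : expR (- (d / 2 * N)) <= expR (- (2 * c * N)) by exact: Nexp.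
  have g2 : expR (- (c' * N)) <= expR (- (2 * c * N)) by exact: Nexp.
  move: h h1 h2 g1 g2 c2'.
  move: (expR (- (c * N))) (expR (- (d / 2 * N))) (expR (- (2 * c * N))) (expR (- (c' * N)))
    (evidS (m n) S b x) (evidS (m n) _ b x) => w1 w2 w3 w4 w5 w6 h1 h2 h3 h4 h5 h6; clear -snrE h1 h2 h3 h4 h5 h6; lra.
rewrite meanD//.
have g1 : expR (- (k * N)) <= expR (- (2 * c * N)) by exact: Nexp.
have g2 : expR (- (c' * N)) <= expR (- (2 * c * N)) by exact: Nexp.
move: shell Hv' g1 g2 c2'.
move: (expR (- (c * N))) (expR (- (2 * c * N))) (expR (- (c' * N))) (expR (- (k * N))) (mean _) (mean _) => w1 w2 w3 w4 w5 w6 h1 h2 h3 h4 h5; clear -snrE h1 h2 h3 h4 h5; lra.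
Unshelve. all: by end_near. Qed.

Lemma psi_sublinear_exp_small b b' v : 0 < b -> b < b' -> psi_sublinear b' -> 0 < v ->
  exp_small b v.
Proof.
move=> b0 bb' Hpsi v0.
suff H k : forall v, 0 < v -> 1 < (5 / 4) ^+ k * v -> exp_small b v.
  (* Bernoulli's inequality bounds [(5 / 4) ^+ k] below by [1 + k / 4], so [k > 4 / v] steps lead
     above 1. *)
  pose k := (Num.truncn (4 / v)).+1.
  apply: (H k) => //.
  have h' j : 1 + j%:R / 4 <= (5 / 4 : R) ^+ j.
    elim: j => [|j IH]; first by rewrite mul0r addr0 expr0.
    rewrite exprS; apply: (@le_trans _ _ (5 / 4 * (1 + j%:R / 4))); last by rewrite ler_pM2l.
    by rewrite -natr1; have : (0 : R) <= j%:R by []; lra.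
  have h := h' k.
  have h2 : 4 / v < k%:R by exact: truncnS_gt.
  rewrite -ltr_pdivrMr// (lt_le_trans _ h)//.
  by move: h2; rewrite -!(mulrC v^-1); lra.
elim: k => [|k IH] w w0 h.
  by apply: exp_small_gt1; rewrite expr0 mul1r in h.
apply: (exp_small_step b b' w b0 bb' Hpsi w0); apply: IH; first by rewrite mulr_gt0.
by rewrite mulrA -exprSr.
Qed.

End sequence.

Arguments above {R} v r.
Arguments null_nondegenerate {R I Sp} m b.
Arguments psi_sublinear {R I Sp} m b.
Arguments exp_small {R I Sp} m b v.

(** * Second moment methods *)

Section second_moment.
Context (R : realType) (I Sp : finType) (m : spin_model R I Sp).
Local Notation M := (snr m).
Local Notation rho := (ovl m).
Local Notation u0 := (base m).
Local Notation K := (unif (R := R) Sp).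
Local Notation V := (vect R I).
Implicit Types (b v e eta r d : R) (x : V) (t s u : Sp).

(* The Bayes average of f over pairs (planted spin, posterior sample). *)
Definition bayes2 b (f : Sp -> Sp -> R) : R :=
  K * \sum_u mean (fun x => lik m b u x * \sum_t post m b x t * f t u).

Lemma unif_Sp_gt0 : 0 < K. Proof. exact: (unif_gt0 (m := m)). Qed.

Lemma mean_lik2 b t u : mean (fun x => lik m b u x * lik m b t x) = expR (b ^+ 2 * M * rho t u).
Proof.
have := lik_mean (m := m) b u (lik m b t) (tame_measurable _ _ _ (tame_lik b t)) (fun x => ltW (lik_gt0 b t x)).
have -> : (fun x => lik m b t x * expR (b * ham m u x - b ^+ 2 * M / 2)) = (fun x => lik m b u x * lik m b t x).
  by apply/funext => x; rewrite mulrC.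
move=> <-.
have -> : (fun x => lik m b t (shift m b u x)) = (fun x => expR (b ^+ 2 * M * rho t u) * lik m b t x).
  by apply/funext => x; rewrite /lik ham_shift -expRD; congr expR; ring.
by rewrite meanZ ?mean_lik ?mulr1//; exact: tame_lik.
Qed.

(** The null mean of the part of [evid ^+ 2] that comes from pairs weighted by [f]; for [f = 1] it
    is the full second moment. *)
Definition pair_sum b (f : Sp -> Sp -> R) : R :=
  K * \sum_u K * \sum_t f t u * expR (b ^+ 2 * M * rho t u).

Lemma mean_pair_sum b (f : Sp -> Sp -> R) :
  mean (fun x => K * \sum_u lik m b u x * (K * \sum_t f t u * lik m b t x)) = pair_sum b f.
Proof.
have tl u t : tame (fun x => lik m b u x * lik m b t x) by apply: tameM; exact: tame_lik.
have -> : (fun x => K * \sum_u lik m b u x * (K * \sum_t f t u * lik m b t x)) =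
    (fun x => K * \sum_u K * \sum_t f t u * (lik m b u x * lik m b t x)).
  apply/funext => x; congr (_ * _); apply: eq_bigr => u _.
  rewrite mulrCA; congr (_ * _); rewrite mulr_sumr; apply: eq_bigr => t _; ring.
have tf u t : tame (fun x => f t u * (lik m b u x * lik m b t x)) by exact: tameZ.
have ts u : tame (fun x => \sum_t f t u * (lik m b u x * lik m b t x)) by exact: tame_sum.
rewrite meanZ; last by apply: tame_sum => u; exact: tameZ.
rewrite mean_sum; last by move=> u; exact: tameZ.
congr (_ * _); apply: eq_bigr => u _; rewrite meanZ// mean_sum//.
by congr (_ * _); apply: eq_bigr => t _; rewrite meanZ// mean_lik2.
Qed.

Lemma measurable_part S b u : tame (fun x => part m S b x u).
Proof.
apply: tameZ; apply: tame_sum => t; apply: tameZ; exact: tame_lik.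
Qed.

Lemma normr_le_eta (y eta : R) : 0 < eta -> `|y| <= eta + y ^+ 2 / eta.
Proof.
move=> e0; rewrite -(real_normK (num_real y)).
have y0 := normr_ge0 y; set z := `|y| in y0 *.
have -> : eta + z ^+ 2 / eta = (eta ^+ 2 + z ^+ 2) / eta.
  by field; rewrite gt_eqF.
rewrite ler_pdivlMr//.
have := sqr_ge0 (eta - z); rewrite sqrrB.
have : 0 <= z * eta by rewrite mulr_ge0// ltW.
rewrite -mulr_natl; lra.
Qed.

(* The evidence is truncated to the spins u for which the spins of overlap at
   least v with u contribute at most e: this keeps its second moment bounded. *)
Lemma truncated_second_moment b v e eta : 0 < eta -> 0 < e ->
  mean (fun x => ind (e <= evidS m (above v) b x)) <= e ->
  mean (fun x => `|1 - evid m b x| + (1 - evid m b x)) <=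
  2 * (eta + (pair_sum b (fun t u => ind (rho t u < v)) - 1 + 3 * e) / eta).
Proof.
move=> eta0 e0 He.
pose good x u : bool := part m (above v) b x u < e.
pose Lt x := K * \sum_u lik m b u x * ind (good x u).
have mp u := tame_measurable _ _ _ (measurable_part (above v) b u).
have mgood u : measurable_fun setT (fun x => good x u) by exact: measurable_fun_ltr.
have tgood u : tame (fun x => ind (good x u)) by exact: tame_indb.
have tlg u : tame (fun x => lik m b u x * ind (good x u)) by apply: tameM => //; exact: tame_lik.
have tLt : tame Lt by apply: tameZ; exact: tame_sum.
have Lt0 x : 0 <= Lt x.
  rewrite mulr_ge0 ?(ltW unif_Sp_gt0)//; apply: sumr_ge0 => u _.
  by rewrite mulr_ge0 ?ler0n// ltW// lik_gt0.
have LtL x : Lt x <= evid m b x.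
  rewrite evidE ler_wpM2l ?(ltW unif_Sp_gt0)//; apply: ler_sum => u _.
  by rewrite ler_piMr ?(ltW (lik_gt0 _ _ _))//; case: (good x u).
(* The missing mass [1 - mean Lt] is the planted probability that the overlaps at least [v]
   contribute at least [e]. *)
have mLt : 1 - e <= mean Lt.
  have -> : mean Lt = mean (fun x => ind (good (shift m b u0 x) u0)).
    rewrite (planted_avg b (fun x u => ind (good x u))).
    - rewrite meanZ; last exact: tame_sum.
      rewrite mean_sum//; congr (_ * _); apply: eq_bigr => u _; congr mean.
      by apply/funext => x; rewrite mulrC.
    - by move=> u; exact: measurable_indb.
    - by move=> x u; rewrite ler0n.
    - by move=> u t x; rewrite /good part_flip.
  rewrite lerBlDr -lerBlDl; apply: le_trans He.
  have -> : 1 - mean (fun x => ind (good (shift m b u0 x) u0)) =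
      mean (fun x => 1 - ind (good (shift m b u0 x) u0)).
    rewrite meanB ?mean_cst//; first exact: tame_cst.
    apply: tame_indb; exact: measurableT_comp (mgood u0) (measurable_shift b u0).
  apply: le_mean.
  - apply: tameB; first exact: tame_cst.
    apply: tame_indb; exact: measurableT_comp (mgood u0) (measurable_shift b u0).
  - by apply: tame_indb; apply: measurable_ge; exact: tame_measurable (tame_evidS _ b).
  move=> x; rewrite /good -evidS_shift.
  by case: leP => h; rewrite ?subr0 ?subrr.
(* One factor [Lt] is replaced by the evidence and split: around a good [u] the overlaps at least
   [v] contribute less than [e], and the others form [pair_sum]. *)
have mLt2 : mean (fun x => Lt x * Lt x) <= e + pair_sum b (fun t u => ind (rho t u < v)).
  have eE : e = mean (fun x => e * evid m b x).
    by rewrite meanZ ?mean_evid ?mulr1//; exact: tame_evid.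
  rewrite -mean_pair_sum [X in _ <= X + _]eE.
  have tps : tame (fun x => K * \sum_u lik m b u x * (K * \sum_t ind (rho t u < v) * lik m b t x)).
    apply: tameZ; apply: tame_sum => u; apply: tameM; first exact: tame_lik.
    by apply: tameZ; apply: tame_sum => t; apply: tameZ; exact: tame_lik.
  rewrite -meanD//; last by apply: tameZ; exact: tame_evid.
  apply: le_mean; [exact: tameM|by apply: tameD => //; apply: tameZ; exact: tame_evid|].
  move=> x; apply: (@le_trans _ _ (Lt x * evid m b x)); first by rewrite ler_wpM2l.
  rewrite /Lt evidE -mulrA (mulrCA e) -mulrDr; apply: ler_wpM2l; first exact: ltW unif_Sp_gt0.
  rewrite [e * _]mulr_sumr -big_split/= mulr_suml; apply: ler_sum => u _.
  rewrite -mulrA (mulrC e) -mulrDr; apply: ler_wpM2l; first exact: ltW (lik_gt0 _ _ _).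
  have -> : K * \sum_t lik m b t x =
      part m (above v) b x u + K * \sum_t ind (rho t u < v) * lik m b t x.
    rewrite /part -mulrDr -big_split/=; congr (_ * _); apply: eq_bigr => t _.
    by rewrite -mulrDl /above; case: leP => h; rewrite ?addr0 ?add0r mul1r.
  have P0 : 0 <= K * \sum_t ind (rho t u < v) * lik m b t x.
    rewrite mulr_ge0 ?(ltW unif_Sp_gt0)//; apply: sumr_ge0 => t _.
    by rewrite mulr_ge0 ?ler0n// ltW// lik_gt0.
  rewrite /good; case: ltP => h; first by rewrite mul1r lerD2r ltW.
  by rewrite mul0r addr_ge0// ltW.
have key : mean (fun x => (1 - Lt x) ^+ 2) <= pair_sum b (fun t u => ind (rho t u < v)) - 1 + 3 * e.
  have -> : (fun x => (1 - Lt x) ^+ 2) = (fun x => (1 + (-2) * Lt x) + Lt x * Lt x).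
    by apply/funext => x; ring.
  have t2 : tame (fun x => 1 + (-2) * Lt x) by apply: tameD; [exact: tame_cst|exact: tameZ].
  rewrite meanD//; last exact: tameM.
  have -> : mean (fun x => 1 + (-2) * Lt x) = 1 + (-2) * mean Lt.
    by rewrite meanD; [rewrite mean_cst meanZ|exact: tame_cst|exact: tameZ].
  move: mLt mLt2; move: (mean _) (mean _) (pair_sum _ _) => p q z h1 h2; lra.
(* The left side is twice the positive part of [1 - evid], which [Lt <= evid] bounds by the modulus
   of [1 - Lt]. *)
apply: (@le_trans _ _ (mean (fun x => 2 * (eta + eta^-1 * (1 - Lt x) ^+ 2)))); last first.
  have tsq : tame (fun x => (1 - Lt x) ^+ 2).
    by apply: tameM; apply: tameB => //; exact: tame_cst.
  have te : tame (fun x => eta + eta^-1 * (1 - Lt x) ^+ 2) by apply: tameD; [exact: tame_cst|exact: tameZ].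
  rewrite meanZ// meanD ?mean_cst; [|exact: tame_cst|exact: tameZ].
  rewrite meanZ// ler_pM2l// lerD2l mulrC ler_wpM2r// invr_ge0 ltW//.
have t1L : tame (fun x => 1 - evid m b x) by apply: tameB; [exact: tame_cst|exact: tame_evid].
apply: le_mean.
- apply: tameD => //; apply: (tame_le _ _ _ _ _ t1L) => [|x]; last by rewrite normr_id.
  by apply: measurableT_comp => //; exact: tame_measurable t1L.
- apply: tameZ; apply: tameD; first exact: tame_cst.
  by apply: tameZ; apply: tameM; apply: tameB => //; exact: tame_cst.
move=> x; have := normr_le_eta (1 - Lt x) eta eta0.
rewrite [X in _ <= _ + X]mulrC => h1; have h2 := ler_norm (1 - Lt x); have h3 := LtL x.
have n0 := normr_ge0 (1 - Lt x).
have [h|/ltW h] := leP 0 (1 - evid m b x).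
  rewrite ger0_norm//; clear h; move: h1 h2 h3 n0.
  move: (evid m b x) (Lt x) => L l; move: (eta^-1 * _) (`|1 - l|) => q z g1 g2 g3 g4.
  clear -m g1 g2 g3 g4; lra.
rewrite ler0_norm// addNr; move: h1 n0; move: (eta^-1 * _) (`|1 - Lt x|) => q z g1 g2.
clear -m g1 g2; lra.
Qed.

Lemma bayes2E b f : bayes2 b f =
  mean (fun x => evid m b x * \sum_u post m b x u * \sum_t post m b x t * f t u).
Proof.
have tp t : tame (fun x => post m b x t) := tame_wgt _ _ _ (proper_prior b).
have tlf u : tame (fun x => lik m b u x * \sum_t post m b x t * f t u).
  apply: tameM; first exact: tame_lik.
  by apply: tame_sum => t; apply: tameM => //; exact: tame_cst.
rewrite /bayes2 -mean_sum// -meanZ; last exact: tame_sum.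
congr mean; apply/funext => x; rewrite mulr_sumr mulr_sumr; apply: eq_bigr => u _.
by rewrite mulrA -post_evid; ring.
Qed.

Lemma post_ge0 b x t : 0 <= post m b x t.
Proof. exact: wgt_ge0 (proper_prior b). Qed.

Lemma post_sum b x : \sum_t post m b x t = 1.
Proof. exact: sum_wgt (proper_prior b). Qed.

Lemma bayes2_above b v : bayes2 b (fun t u => ind (above v (rho t u))) =
  mean (fun x => gavS m xpredT b (fun t => ind (above v (rho t u0))) x).
Proof.
have tp t : tame (fun x => post m b x t) := tame_wgt _ _ _ (proper_prior b).
pose f x u := \sum_t post m b x t * ind (above v (rho t u)).
transitivity (mean (fun x => f (shift m b u0 x) u0)); last first.
  by congr mean; apply/funext => x; apply: eq_bigr => t _; rewrite wgtT.
rewrite (planted_avg b f).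
- congr (_ * _); apply: eq_bigr => u _; congr mean; apply/funext => x.
  by rewrite mulrC.
- move=> u; apply: tame_measurable; apply: tame_sum => t; apply: tameM => //; exact: tame_cst.
- by move=> x u; apply: sumr_ge0 => t _; rewrite mulr_ge0 ?ler0n// post_ge0.
- move=> u t x; rewrite /f -(reindex_act (m := m) u); apply: eq_bigr => s _.
  by rewrite post_flip ovl_act.
Qed.

Lemma bayes2_le b f g : (forall t u, f t u <= g t u) -> bayes2 b f <= bayes2 b g.
Proof.
move=> fg.
have tp t : tame (fun x => post m b x t) := tame_wgt _ _ _ (proper_prior b).
have tlf (h : Sp -> Sp -> R) u : tame (fun x => lik m b u x * \sum_t post m b x t * h t u).
  apply: tameM; first exact: tame_lik.
  by apply: tame_sum => t; apply: tameM => //; exact: tame_cst.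
rewrite ler_wpM2l ?(ltW unif_Sp_gt0)//; apply: ler_sum => u _; apply: le_mean => // x.
rewrite ler_wpM2l ?(ltW (lik_gt0 _ _ _))//; apply: ler_sum => t _.
by rewrite ler_wpM2l// post_ge0.
Qed.

Lemma bayes2D b f g : bayes2 b (fun t u => f t u + g t u) = bayes2 b f + bayes2 b g.
Proof.
have tp t : tame (fun x => post m b x t) := tame_wgt _ _ _ (proper_prior b).
have tlf (h : Sp -> Sp -> R) u : tame (fun x => lik m b u x * \sum_t post m b x t * h t u).
  apply: tameM; first exact: tame_lik.
  by apply: tame_sum => t; apply: tameM => //; exact: tame_cst.
rewrite /bayes2 -mulrDr -big_split/=; congr (_ * _); apply: eq_bigr => u _.
rewrite -meanD//; congr mean; apply/funext => x; rewrite -mulrDr -big_split/=.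
by congr (_ * _); apply: eq_bigr => t _; rewrite mulrDr.
Qed.

(** The posterior pair average [Y] lies between 0 and 1. Where [evid <= r] the integrand is at most
    [r]; elsewhere a factor [evid / r >= 1] is inserted, and the null mean of [evid ^+ 2 * Y] is
    [pair_sum]. *)
Lemma bayes2_pair_sum b f r : 0 < r -> (forall t u, 0 <= f t u <= 1) ->
  bayes2 b f <= r + pair_sum b f / r.
Proof.
move=> r0 f01.
have tp t : tame (fun x => post m b x t) := tame_wgt _ _ _ (proper_prior b).
have tY : tame (fun x => \sum_u post m b x u * \sum_t post m b x t * f t u).
  apply: tame_sum => u; apply: tameM => //; apply: tame_sum => t.
  by apply: tameM => //; exact: tame_cst.
rewrite bayes2E -mean_pair_sum -[X in X + _](mean_cst R I) mulrC.
have tps : tame (fun x => K * \sum_u lik m b u x * (K * \sum_t f t u * lik m b t x)).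
  apply: tameZ; apply: tame_sum => u; apply: tameM; first exact: tame_lik.
  by apply: tameZ; apply: tame_sum => t; apply: tameZ; exact: tame_lik.
rewrite -meanZ// -meanD; [|exact: tame_cst|exact: tameZ].
apply: le_mean.
- by apply: tameM => //; exact: tame_evid.
- by apply: tameD; [exact: tame_cst|exact: tameZ].
move=> x; set Y := \sum_u _.
have Y0 : 0 <= Y.
  apply: sumr_ge0 => u _; rewrite mulr_ge0 ?post_ge0//; apply: sumr_ge0 => t _.
  by rewrite mulr_ge0 ?post_ge0//; have /andP[] := f01 t u.
have Y1 : Y <= 1.
  rewrite -(post_sum b x); apply: ler_sum => u _; rewrite ler_piMr ?post_ge0//.
  rewrite -(post_sum b x); apply: ler_sum => t _; rewrite ler_piMr ?post_ge0//.
  by have /andP[] := f01 t u.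
have E : K * (\sum_u lik m b u x * (K * \sum_t f t u * lik m b t x)) = evid m b x ^+ 2 * Y.
  rewrite /Y !mulr_sumr; apply: eq_bigr => u _.
  rewrite mulrA -post_evid.
  have pe t : K * (f t u * lik m b t x) = f t u * (post m b x t * evid m b x) by rewrite mulrCA post_evid.
  move: pe; move: (evid m b x) => L pe; rewrite !mulr_sumr; apply: eq_bigr => t _.
  by rewrite pe; ring.
rewrite E; have L0 := evid_gt0 (m := m) b x.
have [h|h] := leP (evid m b x) r.
  apply: (@le_trans _ _ r); first by rewrite (le_trans _ h)// ler_piMr// ltW.
  by rewrite lerDl mulr_ge0 ?invr_ge0 ?(ltW r0)// mulr_ge0// sqr_ge0.
apply: (@le_trans _ _ (r^-1 * (evid m b x ^+ 2 * Y))); last by rewrite lerDr ltW.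
have -> : r^-1 * (evid m b x ^+ 2 * Y) = r^-1 * evid m b x * (evid m b x * Y) by ring.
rewrite ler_peMl ?mulr_ge0 ?(ltW L0)//.
by rewrite mulrC ler_pdivlMr// mul1r ltW.
Qed.

(** Overlaps at least [v] are controlled by their posterior mass, smaller ones by a restricted
    second moment. *)
Lemma bayes2_overlap b v r r' (w : Sp -> Sp -> R) : 0 < r -> 0 < r' -> (forall t u, 0 <= w t u <= 1) ->
  bayes2 b w <= mean (fun x => ind (r ^+ 2 <= evidS m (above v) b x)) + (r + r) +
    (r' + pair_sum b (fun t u => ind (rho t u < v) * w t u) / r').
Proof.
move=> r0 r'0 w01.
apply: (@le_trans _ _ (bayes2 b (fun t u => ind (above v (rho t u)) + ind (rho t u < v) * w t u))).
  apply: bayes2_le => t u; have /andP[w0 w1] := w01 t u; rewrite /above.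
  by case: leP => h; rewrite ?mul0r ?mul1r ?addr0 ?add0r.
rewrite bayes2D; apply: lerD.
  by rewrite bayes2_above; exact: gavT_part_le.
apply: bayes2_pair_sum => // t u; have /andP[w0 w1] := w01 t u.
by case: ltP => h; rewrite ?mul1r ?mul0r ?w0 ?w1 ?lexx ?ler01.
Qed.

(** Half of the null mass lies below [expR (- (2 * c))], so [lnZ_two_level] makes the level
    [expR (- c)] unlikely. For the planted law, the density is at most [expR d] on the part of that
    event where [evid <= expR d]. *)
Lemma null_small_planted_large b c d : b != 0 -> 0 <= c ->
  1 / 2 <= mean (fun x => ind (evid m b x <= expR (- (2 * c)))) ->
  mean (fun x => ind (expR (- c) <= evid m b x)) <= 2 * expR (- (c ^+ 2 / (4 * b ^+ 2 * M))) /\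
  mean (fun x => ind (evid m b x <= expR d) * evid m b x) <=
    expR (- c) + 2 * expR (d - c ^+ 2 / (4 * b ^+ 2 * M)).
Proof.
move=> b0 c0 H.
have me := tame_measurable _ _ _ (tame_evid (m := m) b).
have tge e : tame (fun x => ind (e <= evid m b x)) by apply: tame_indb; exact: measurable_ge.
have tle e : tame (fun x => ind (evid m b x <= e)) by apply: tame_indb; exact: measurable_le.
have P1 : mean (fun x => ind (expR (- c) <= evid m b x)) <= 2 * expR (- (c ^+ 2 / (4 * b ^+ 2 * M))).
  have := lnZ_two_level (m := m) _ b (- (2 * c)) c (proper_prior (m := m) b) b0 c0.
  have -> : (fun x => ind (- (2 * c) + c <= ln (Z m (prior m b) b x))) =
      (fun x => ind (expR (- c) <= evid m b x)) :> (V -> R).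
    apply/funext => x; congr ((nat_of_bool _)%:R).
    rewrite -[LHS]ler_expR lnK ?posrE ?evid_gt0//; congr (_ <= _); congr expR; ring.
  have -> : (fun x => ind (ln (Z m (prior m b) b x) <= - (2 * c))) =
      (fun x => ind (evid m b x <= expR (- (2 * c)))) :> (V -> R).
    apply/funext => x; congr ((nat_of_bool _)%:R).
    by rewrite -[LHS]ler_expR lnK ?posrE ?evid_gt0.
  have p0 : 0 <= mean (fun x => ind (expR (- c) <= evid m b x)) by apply: mean_ge0 => x; rewrite ler0n.
  move=> h; have : mean (fun x => ind (expR (- c) <= evid m b x)) * (1 / 2) <= 
     expR (- (c ^+ 2 / (4 * b ^+ 2 * M))).
    by apply: le_trans h; rewrite ler_wpM2l.
  move: (mean _) (expR (- (_ / _))) => q1 q2 h1; clear -m h1; lra.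
split=> //.
apply: (@le_trans _ _ (mean (fun x => expR (- c) + expR d * ind (expR (- c) <= evid m b x)))).
  apply: le_mean.
  - by apply: tameM => //; exact: tame_evid.
  - by apply: tameD; [exact: tame_cst|exact: tameZ].
  move=> x; have L0 := evid_gt0 (m := m) b x.
  have [h1|h1] := leP (evid m b x) (expR d); last first.
    by rewrite mul0r addr_ge0 ?mulr_ge0 ?expR_ge0 ?ler0n.
  rewrite mul1r; have [h2|h2] := leP (expR (- c)) (evid m b x).
    by rewrite mulr1 (le_trans h1)// lerDr expR_ge0.
  by rewrite mulr0 addr0 ltW.
rewrite meanD ?mean_cst; [|exact: tame_cst|exact: tameZ].
rewrite meanZ// lerD2l expRD mulrCA ler_wpM2l ?expR_ge0//.
Qed.

(** If the posterior average of [w] is at most [eps / 2], Markov puts half of the posterior on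
    [w <= eps]. Unless the evidence is below [expR d], these spins then contribute at least
    [expR d / 2] to it, while [pair_sum] is their planted mean contribution. *)
Lemma gibbs_overlap_large b d eps (w : Sp -> Sp -> R) : 0 < eps -> (forall t u, 0 <= w t u) ->
  K * \sum_u mean (fun x => lik m b u x * ind (\sum_t post m b x t * w t u <= eps / 2)) <=
  mean (fun x => ind (evid m b x <= expR d) * evid m b x) +
  2 * expR (- d) * pair_sum b (fun t u => ind (w t u <= eps)).
Proof.
move=> eps0 w0.
have me := tame_measurable _ _ _ (tame_evid (m := m) b).
have tle e : tame (fun x => ind (evid m b x <= e)) by apply: tame_indb; exact: measurable_le.
have tp t : tame (fun x => post m b x t) := tame_wgt _ _ _ (proper_prior b).
have tw u : tame (fun x => \sum_t post m b x t * w t u).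
  by apply: tame_sum => t; apply: tameM => //; exact: tame_cst.
have tiw u : tame (fun x => lik m b u x * ind (\sum_t post m b x t * w t u <= eps / 2)).
  apply: tameM; first exact: tame_lik.
  by apply: tame_indb; apply: measurable_le; exact: tame_measurable (tw u).
have tps : tame (fun x => K * \sum_u lik m b u x * (K * \sum_t ind (w t u <= eps) * lik m b t x)).
  apply: tameZ; apply: tame_sum => u; apply: tameM; first exact: tame_lik.
  by apply: tameZ; apply: tame_sum => t; apply: tameZ; exact: tame_lik.
have tie : tame (fun x => ind (evid m b x <= expR d) * evid m b x).
  by apply: tameM => //; exact: tame_evid.
rewrite -mean_sum// -meanZ; last exact: tame_sum.
rewrite -mean_pair_sum -meanZ// -meanD//; last exact: tameZ.
apply: le_mean.
- by apply: tameZ; exact: tame_sum.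
- by apply: tameD => //; exact: tameZ.
move=> x; have L0 := evid_gt0 (m := m) b x.
rewrite [X in ind _ * X]evidE mulrCA [X in _ <= _ + X]mulrCA -mulrDr.
rewrite ler_wpM2l ?(ltW unif_Sp_gt0)// !mulr_sumr -big_split/=; apply: ler_sum => u _.
rewrite [X in _ <= X + _]mulrC [X in _ <= _ + X]mulrCA -mulrDr.
rewrite ler_wpM2l ?(ltW (lik_gt0 _ _ _))//.
have P0 : 0 <= K * \sum_t ind (w t u <= eps) * lik m b t x.
  rewrite mulr_ge0 ?(ltW unif_Sp_gt0)//; apply: sumr_ge0 => t _.
  by rewrite mulr_ge0 ?ler0n// ltW// lik_gt0.
apply: ind_le => [|h]; first by rewrite addr_ge0 ?ler0n// mulr_ge0// mulr_ge0// expR_ge0.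
have [h1|h1] := leP (evid m b x) (expR d).
  by rewrite lerDl mulr_ge0// mulr_ge0// expR_ge0.
rewrite add0r.
pose q := \sum_t post m b x t * ind (w t u <= eps).
have hq : 1 / 2 <= q.
  have : eps * (1 - q) <= eps / 2.
    apply: le_trans h; rewrite /q -[X in X - _](post_sum b x) -sumrB mulr_sumr; apply: ler_sum => t _.
    have -> : post m b x t - post m b x t * ind (w t u <= eps) = post m b x t * (1 - ind (w t u <= eps)).
      by rewrite mulrBr mulr1.
    rewrite mulrCA ler_wpM2l ?post_ge0//.
    case: (leP (w t u) eps) => h2; first by rewrite subrr mulr0.
    by rewrite subr0 mulr1 ltW.
  rewrite ler_pM2l//; move: (q) => q1 hq1; clear -m hq1; lra.
have qE : K * (\sum_t ind (w t u <= eps) * lik m b t x) = q * evid m b x.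
  rewrite /q mulr_suml mulr_sumr; apply: eq_bigr => t _.
  by rewrite mulrCA -post_evid; ring.
rewrite qE.
apply: (@le_trans _ _ (2 * expR (- d) * (1 / 2 * expR d))).
  rewrite (_ : _ * _ = expR (- d) * expR d); last by field.
  by rewrite -expRD addNr expR0.
rewrite ler_pM2l ?mulr_gt0 ?expR_gt0//; apply: ler_pM => //.
exact: ltW.
Qed.

End second_moment.

(** * The pure p-spin model *)

Section spin_overlaps.
Context (R : realType).

Lemma sgn_sqr b : (sgn b : R) ^+ 2 = 1.
Proof. by case: b; rewrite /sgn ?expr1n// sqrrN expr1n. Qed.

Lemma sgnM b c : sgn (b == c) = sgn b * sgn c :> R.
Proof. by case: b; case: c; rewrite /sgn ?mulr1 ?mul1r ?mulrNN ?mulr1. Qed.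

Lemma normr_sgn b : `|sgn b : R| = 1.
Proof. by case: b; rewrite /sgn ?normrN normr1. Qed.

Definition overlap n (t s : spin n.+1) : R := dotv (vecS t) (vecS s).

(** The coordinatewise product of spins in Boolean form, with unit [ones]: this group structure
    supplies the gauge symmetry. *)
Definition xnor n (u t : spin n) : spin n := [ffun k => u k == t k].

Definition ones n : spin n := [ffun=> true].

Lemma overlapE n (t s : spin n.+1) :
  overlap n t s = (\sum_k sgn (t k) * sgn (s k)) / n.+1%:R.
Proof.
rewrite /overlap /dotv mulr_suml; apply: eq_bigr => k _.
rewrite /vecS mulrACA -invfM -expr2 sqr_sqrtr//.
Qed.

Lemma overlap_diag n (t : spin n.+1) : overlap n t t = 1.
Proof.
rewrite overlapE (eq_bigr (fun=> 1)) => [|k _]; last by rewrite -expr2 sgn_sqr.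
by rewrite sumr_const card_ord divff.
Qed.

Lemma overlap_le1 n (t s : spin n.+1) : `|overlap n t s| <= 1.
Proof.
rewrite overlapE normrM normfV [`|n.+1%:R|]ger0_norm// ler_pdivrMr// mul1r.
apply: le_trans (ler_norm_sum _ _ _) _.
rewrite (eq_bigr (fun=> 1)) => [|k _]; last by rewrite normrM !normr_sgn mulr1.
by rewrite sumr_const card_ord.
Qed.

Lemma overlap_xnor n (u t s : spin n.+1) : overlap n (xnor n.+1 u t) (xnor n.+1 u s) = overlap n t s.
Proof.
rewrite !overlapE; congr (_ / _); apply: eq_bigr => k _; rewrite !ffunE !sgnM.
by rewrite mulrACA -expr2 sgn_sqr mul1r.
Qed.

Lemma xnor_ones n (u : spin n) : xnor n u (ones n) = u.
Proof. by apply/ffunP => k; rewrite !ffunE eqb_id. Qed.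

Lemma xnorK n (u t : spin n) : xnor n u (xnor n u t) = t.
Proof. by apply/ffunP => k; rewrite !ffunE; case: (u k); case: (t k). Qed.

Lemma xnor_inj n (u : spin n) : injective (xnor n u).
Proof. exact: can_inj (xnorK n u). Qed.

Lemma card_spin n : #|{: spin n}| = (2 ^ n)%N.
Proof. by rewrite card_ffun card_bool card_ord. Qed.

Lemma unif_spin n : unif (spin n) = 2 ^- n :> R.
Proof. by rewrite /unif card_spin natrX. Qed.

Lemma average_overlap n (u : spin n.+1) (f : R -> R) :
  \sum_t f (overlap n t u) = \sum_t f (overlap n t (ones n.+1)).
Proof.
rewrite (reindex_inj (xnor_inj n.+1 u)); apply: eq_bigr => t _.
by rewrite -{2}(xnor_ones n.+1 u) overlap_xnor.
Qed.

(** The sharp constant in the exponent is [1 / 2]. The value 2 follows from [expR_taylor2] for small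
    [w] and from [|w| <= 2 * w ^+ 2] otherwise. *)
Lemma cosh_le (w : R) : expR w + expR (- w) <= 2 * expR (2 * w ^+ 2).
Proof.
have h1 := expR_taylor2 R w; have h2 := expR_taylor2 R (- w).
move: h2; rewrite normrN sqrrN => h2.
have := real_normK (num_real w); have w0 := normr_ge0 w.
have l1 : w <= `|w| := ler_norm w.
have l2 : - w <= `|w| by rewrite -normrN ler_norm.
move: w0 l1 l2 h1 h2; set z := `|w| => w0 l1 l2 h1 h2 zw.
have [z1|z1] := leP z (1 / 2).
  have e2 : expR z <= 2.
    have := expR_ge1Dx (- z); have := expRN z; have := expR_gt0 z => e0 -> h.
    have : expR z * (1 / 2) <= expR z * (expR z)^-1 by rewrite ler_pM2l//; lra.
    rewrite divff ?gt_eqF//; lra.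
  have : w ^+ 2 * expR z <= w ^+ 2 * 2 by rewrite ler_wpM2l ?sqr_ge0.
  have := expR_ge1Dx (2 * w ^+ 2); lra.
have zz : z <= 2 * w ^+ 2.
  rewrite -zw expr2 mulrA ler_peMl//; lra.
have a1 : expR w <= expR (2 * w ^+ 2) by rewrite ler_expR; lra.
have a2 : expR (- w) <= expR (2 * w ^+ 2) by rewrite ler_expR; lra.
lra.
Qed.

Lemma sum_spin_expR n (y : R) :
  \sum_(t : spin n) expR (y * \sum_k sgn (t k)) = (expR y + expR (- y)) ^+ n.
Proof.
have -> : (expR y + expR (- y)) ^+ n = \prod_(k < n) \sum_(b : bool) expR (y * sgn b).
  by rewrite big_bool /sgn mulr1 mulrN1 prodr_const card_ord.
rewrite bigA_distr_bigA; apply: eq_bigr => t _.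
by rewrite mulr_sumr expR_sum.
Qed.

(* Gaussian linearization of the square: e^(c^2/2) is the Gaussian average of e^(c x). *)
Lemma unif_overlap_sqr n (u : spin n.+1) :
  unif (spin n.+1) * \sum_t expR (n.+1%:R * overlap n t u ^+ 2 / 16) <= 2 :> R.
Proof.
rewrite (average_overlap n u (fun r => expR (n.+1%:R * r ^+ 2 / 16))).
(* The 8 is tuned to [cosh_le]: [2 * n.+1 * (s8 * x) ^+ 2] is [x ^+ 2 / 4], whose exponential has
   Gaussian mean [Num.sqrt 2]. *)
pose s8 : R := (Num.sqrt (8 * n.+1%:R))^-1.
have s8E : s8 ^+ 2 = (8 * n.+1%:R)^-1 by rewrite /s8 exprVn sqr_sqrtr.
have N0 : n.+1%:R != 0 :> R by [].
have mexp (c : R) : measurable_fun setT (fun x : R => (expR (c * x))%:E).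
  by apply/measurable_EFinP; apply: measurableT_comp => //; exact: mulrl_measurable.
have e1 (t : spin n.+1) : (expR (n.+1%:R * overlap n t (ones n.+1) ^+ 2 / 16))%:E =
   (\int[gauss1 R]_x (expR (s8 * (\sum_k sgn (t k)) * x))%:E)%E.
  rewrite gauss1_expR exprMn s8E overlapE.
  rewrite (eq_bigr (fun k => sgn (t k))) => [|k _]; last by rewrite ffunE /sgn mulr1.
  by congr (expR _)%:E; field.
have K0 : 0 <= unif (spin n.+1) :> R by rewrite unif_spin invr_ge0 exprn_ge0.
rewrite -lee_fin EFinM -sumEFin (eq_bigr _ (fun t _ => e1 t)).
have msum : measurable_fun setT (fun x : R => \sum_t (expR (s8 * (\sum_k sgn ((t : spin n.+1) k)) * x))%:E)%E.
  by apply: emeasurable_sum.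
rewrite -(ge0_integral_sum (gauss1 R) measurableT
  (f := fun (t : spin n.+1) (x : R) => (expR (s8 * (\sum_k sgn (t k)) * x))%:E)); last 2 first.
- by move=> t; exact: mexp.
- by move=> t x _; rewrite lee_fin expR_ge0.
rewrite -gauss1Zl ?lee_fin//; last by move=> x; apply: sume_ge0 => t _; rewrite lee_fin expR_ge0.
apply: (@le_trans _ _ (\int[gauss1 R]_x (expR (x ^+ 2 / 4))%:E)%E); last first.
  rewrite gauss1_expR_sqr lee_fin -(@ler_pXn2r R 2) ?nnegrE ?sqrtr_ge0 ?ler0n// sqr_sqrtr ?ler0n//; lra.
apply: ge0_le_integral => //.
- by move=> x _; rewrite mule_ge0 ?lee_fin//; apply: sume_ge0 => t _; rewrite lee_fin expR_ge0.
- exact: measurable_funeM.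
- apply/measurable_EFinP; apply: measurableT_comp => //.
  by apply: measurable_funM => //; exact: exprn_measurable.
move=> x _; rewrite sumEFin -EFinM lee_fin.
rewrite (eq_bigr (fun t : spin n.+1 => expR ((s8 * x) * \sum_k sgn (t k)))) => [|t _]; last first.
  by congr expR; ring.
rewrite sum_spin_expR unif_spin mulrC ler_pdivrMr ?exprn_gt0//.
apply: le_trans (_ : (2 * expR (2 * (s8 * x) ^+ 2)) ^+ n.+1 <= _).
  by rewrite lerXn2r ?nnegrE ?addr_ge0 ?mulr_ge0 ?expR_ge0 ?cosh_le.
rewrite exprMn mulrC -expRM_natl ler_wpM2r ?exprn_ge0// ler_expR exprMn s8E.
rewrite le_eqVlt; apply/orP; left; apply/eqP; move: (n.+1%:R) N0 => N N0; field.
exact: N0.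
Qed.

End spin_overlaps.

Section pspin_model.
Context (R : realType) (p : nat) (hp : (3 <= p)%N) (n : nat).
Local Notation N := (n.+1%:R : R).
Local Notation Sp := (spin n.+1).
Local Notation I := (idx p n.+1).

Definition sgnprod (t : Sp) (i : I) : R := \prod_(j < p) sgn (t (i j)).

(** The normalization for which [ham] is [HN] divided by [Num.sqrt 2] and [snr] is half the
    dimension. *)
Definition kappa : R := (Num.sqrt 2 * Num.sqrt N ^+ (p - 1))^-1.

Definition pcoef (t : Sp) (i : I) : R := kappa * sgnprod t i.

Lemma sgnprod_sqr t i : sgnprod t i ^+ 2 = 1.
Proof. by rewrite /sgnprod -prodrXl big1// => j _; rewrite sgn_sqr. Qed.

Lemma kappa_gt0 : 0 < kappa.
Proof. by rewrite invr_gt0 mulr_gt0 ?exprn_gt0 ?sqrtr_gt0. Qed.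

Lemma kappa_sqr : kappa ^+ 2 * N ^+ p = N / 2.
Proof.
have N0 : N != 0 by [].
rewrite /kappa exprVn exprMn sqr_sqrtr// -exprM mulnC exprM sqr_sqrtr//.
rewrite -[in N ^+ p](@subnK 1 p) ?(leq_trans _ hp)// exprD expr1.
have : N ^+ (p - 1) != 0 by rewrite expf_neq0.
by move: (N ^+ (p - 1)) (N) N0 => q r r0 q0; field; rewrite ?r0 ?q0//.
Qed.

Lemma pcoef_dot t s : \sum_i pcoef t i * pcoef s i = N / 2 * overlap R n t s ^+ p.
Proof.
have -> : \sum_i pcoef t i * pcoef s i =
    kappa ^+ 2 * \sum_(i : I) \prod_(j < p) (sgn (t (i j)) * sgn (s (i j))).
  rewrite mulr_sumr; apply: eq_bigr => i _.
  by rewrite big_split/= mulrACA.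
rewrite -(bigA_distr_bigA (fun (_ : 'I_p) k => sgn (t k) * sgn (s k))) prodr_const card_ord.
rewrite -kappa_sqr -mulrA; congr (_ * _); rewrite -exprMn overlapE mulrC divfK//.
Qed.

Lemma pcoef_amp : \sum_(i : I) kappa ^+ 2 = N / 2.
Proof.
rewrite sumr_const card_ffun !card_ord -kappa_sqr -natrX mulr_natr//.
Qed.

Lemma normr_pcoef t i : `|pcoef t i| = kappa.
Proof.
rewrite normrM gtr0_norm ?kappa_gt0// /sgnprod normr_prod big1 ?mulr1// => j _.
exact: normr_sgn.
Qed.

Lemma sgnprod_xnor u t i : sgnprod (xnor n.+1 u t) i = sgnprod u i * sgnprod t i.
Proof. by rewrite /sgnprod -big_split/=; apply: eq_bigr => j _; rewrite ffunE sgnM. Qed.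

Lemma pspin_diag t : overlap R n t t ^+ p = 1.
Proof. by rewrite overlap_diag expr1n. Qed.

Lemma pspin_le1 t s : `|overlap R n t s ^+ p| <= 1.
Proof. by rewrite normrX exprn_ile1// overlap_le1. Qed.

Lemma pspin_snr_gt0 : 0 < N / 2. Proof. by rewrite divr_gt0. Qed.

Lemma pspin_ovl_xnor u t s : overlap R n (xnor n.+1 u t) (xnor n.+1 u s) ^+ p = overlap R n t s ^+ p.
Proof. by rewrite overlap_xnor. Qed.

Lemma pcoef_xnor u t i : pcoef (xnor n.+1 u t) i = sgnprod u i * pcoef t i.
Proof. by rewrite /pcoef sgnprod_xnor mulrCA. Qed.

Definition pspin : spin_model R I Sp :=
  SpinModel R I Sp pcoef (fun=> kappa) (N / 2) (fun t s => overlap R n t s ^+ p)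
    (xnor n.+1) sgnprod (ones n.+1) pcoef_dot pspin_diag pspin_le1 pspin_snr_gt0
    normr_pcoef pcoef_amp (xnor_ones n.+1) (xnor_inj n.+1) pspin_ovl_xnor pcoef_xnor sgnprod_sqr.

Lemma unif_average_le (c : R) (f : Sp -> R) : (forall u, f u <= c) -> unif Sp * \sum_u f u <= c.
Proof.
move=> fc; rewrite -[leRHS](unif_sum (m := pspin)) ler_wpM2l ?ler_sum//.
exact: ltW (unif_gt0 (m := pspin)).
Qed.

Lemma pair_sum_le b (f h : Sp -> Sp -> R) (c : R) :
  (forall t u, f t u * expR (b ^+ 2 * (N / 2) * overlap R n t u ^+ p) <= h t u) ->
  (forall u, unif Sp * \sum_t h t u <= c) ->
  pair_sum R I Sp pspin b f <= c.
Proof.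
move=> fh hc; apply: unif_average_le => u; apply: le_trans (hc u).
by rewrite ler_wpM2l ?(ltW (unif_gt0 (m := pspin)))//; apply: ler_sum => t _; exact: fh.
Qed.

(** The worst exponent bounds the uniform average, since [p >= 1] and overlaps of modulus at most 1
    give [overlap ^+ p <= eps]. This is enough against an exponentially large evidence. *)
Lemma pair_sum_small_overlap b eps : 0 <= eps <= 1 ->
  pair_sum R I Sp pspin b (fun t u => ind (`|overlap R n t u| <= eps)) <=
  expR (b ^+ 2 / 2 * eps * N).
Proof.
move=> /andP[e0 e1].
apply: (pair_sum_le b _ (fun _ _ => expR (b ^+ 2 / 2 * eps * N))) => [t u|u]; last by rewrite (unif_sum (m := pspin)).
case: (leP `|overlap R n t u| eps) => h; last by rewrite mul0r expR_ge0.
rewrite mul1r ler_expR.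
have : overlap R n t u ^+ p <= eps.
  apply: le_trans (ler_norm _) _; rewrite normrX; apply: le_trans h.
  by apply: ler_iXnr; rewrite ?(leq_trans _ hp)// ?overlap_le1.
have : 0 <= b ^+ 2 * (N / 2) by rewrite mulr_ge0 ?sqr_ge0.
move=> q0 h2; have := ler_wpM2l q0 h2; move: (N) => M; lra.
Qed.

End pspin_model.

(** * Second moments restricted to small overlaps *)

Section small_overlap_bounds.
Context (R : realType) (p : nat) (hp : (3 <= p)%N).

Lemma norm_le_expR_sqr (q : R) : `|q| <= 4 * expR (q ^+ 2 / 64).
Proof.
have := expR_ge1Dx (q ^+ 2 / 64); have := sqr_ge0 (`|q| / 8 - 1).
rewrite -(real_normK (num_real q)) => h1 h2; lra.
Qed.

(* With x = overlap and S = sqrt N: the exponent N x^p is at most eps (S x)^2 on the range x^p < eps^p. *)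
Lemma small_overlap_exponent (b eps x S : R) : 0 <= S -> 0 < eps <= 1 -> 32 * b ^+ 2 * eps <= 1 -> `|x| <= 1 ->
  x ^+ p < eps ^+ p -> 0 <= x ^+ p ->
  b ^+ 2 * (S ^+ 2 / 2) * x ^+ p <= (S * x) ^+ 2 / 64 /\
  x ^+ p <= `|x| ^+ 3 .
Proof.
move=> S0 /andP[e0 e1] be x1 xp x0.
have p0 : (p > 0)%N by exact: leq_trans hp.
have xe : `|x| <= eps.
  by rewrite -(ler_pXn2r p0) ?nnegrE ?(ltW e0)// -normrX ger0_norm// ltW.
have x3 : x ^+ p <= `|x| ^+ 3.
  apply: le_trans (ler_norm _) _; rewrite normrX; exact: ler_wiXn2l.
split=> //.
have x2 : x ^+ p <= eps * x ^+ 2.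
  apply: (le_trans x3); rewrite exprS real_normK ?num_real//.
  by rewrite ler_wpM2r ?sqr_ge0.
have q0 : 0 <= b ^+ 2 * (S ^+ 2 / 2) by rewrite mulr_ge0 ?sqr_ge0// divr_ge0 ?sqr_ge0.
apply: le_trans (ler_wpM2l q0 x2) _.
have : 0 <= S ^+ 2 * x ^+ 2 by rewrite mulr_ge0 ?sqr_ge0.
rewrite exprMn; move: be; move: (b ^+ 2) (S ^+ 2) (x ^+ 2) => B T X be TX.
have := ler_wpM2r TX be; nra.
Qed.

(** For the exponent [y] one has [expR y - 1 <= y * expR y], and the cubic bound on [x ^+ p] gives
    [y <= b ^+ 2 / (2 * S) * |S * x| ^+ 3]. The decay [1 / S] is what [p >= 3] provides. Negative
    exponents are bounded by 1 directly. *)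
Lemma small_overlap_excess (b eps x S : R) : 0 < S -> 0 < eps <= 1 -> 32 * b ^+ 2 * eps <= 1 -> `|x| <= 1 ->
  ind (x ^+ p < eps ^+ p) * expR (b ^+ 2 * (S ^+ 2 / 2) * x ^+ p) <=
  1 + 32 * b ^+ 2 / S * expR (S ^+ 2 * x ^+ 2 / 16).
Proof.
move=> S0 he be x1.
have c0 : 0 <= 32 * b ^+ 2 / S * expR (S ^+ 2 * x ^+ 2 / 16).
  apply: mulr_ge0; last exact: expR_ge0. by rewrite divr_ge0 ?(ltW S0)// mulr_ge0 ?sqr_ge0.
case: (ltP (x ^+ p) (eps ^+ p)) => xp; last by rewrite mul0r addr_ge0.
rewrite mul1r; have [x0|x0] := leP 0 (x ^+ p); last first.
  rewrite (@le_trans _ _ 1)// ?lerDl// -expR0 ler_expR.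
  by rewrite mulr_ge0_le0 ?(ltW x0)// mulr_ge0 ?sqr_ge0// divr_ge0 ?sqr_ge0.
have [h1 h2] := small_overlap_exponent b eps x S (ltW S0) he be x1 xp x0.
have := expR_sub1_le R (b ^+ 2 * (S ^+ 2 / 2) * x ^+ p).
set y := _ * x ^+ p in h1 *; rewrite lerBlDl => /le_trans; apply; rewrite lerD2l.
have y0 : 0 <= y by rewrite /y mulr_ge0// mulr_ge0 ?sqr_ge0// divr_ge0 ?sqr_ge0.
set q := S * x in h1 *.
(* Of the four units [q ^+ 2 / 64], three absorb the cube of [|q|] and one absorbs [expR y]. *)
have -> : S ^+ 2 * x ^+ 2 / 16 = 3 * (q ^+ 2 / 64) + q ^+ 2 / 64.
  rewrite /q exprMn; move: (S ^+ 2 * x ^+ 2) => z; lra.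
rewrite expRD mulrA; apply: ler_pM; rewrite ?expR_ge0 ?ler_expR//.
rewrite expRM_natl.
have -> : 32 * b ^+ 2 / S * expR (q ^+ 2 / 64) ^+ 3 =
    (b ^+ 2 / (2 * S)) * (4 * expR (q ^+ 2 / 64)) ^+ 3.
  rewrite exprMn; move: (expR _) => z; field; rewrite gt_eqF//.
apply: (@le_trans _ _ (b ^+ 2 / (2 * S) * `|q| ^+ 3)); last first.
  rewrite ler_wpM2l ?divr_ge0 ?sqr_ge0 ?mulr_ge0 ?(ltW S0)//.
  by rewrite lerXn2r ?nnegrE ?mulr_ge0 ?expR_ge0// norm_le_expR_sqr.
have -> : b ^+ 2 / (2 * S) * `|q| ^+ 3 = b ^+ 2 * (S ^+ 2 / 2) * `|x| ^+ 3.
  by rewrite /q normrM gtr0_norm//; field; rewrite gt_eqF.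
rewrite /y ler_wpM2l//; rewrite mulr_ge0 ?sqr_ge0// divr_ge0 ?sqr_ge0//.
Qed.

(** Here the decay comes from [|x| = |S * x| / S]; the modulus of [S * x] is absorbed by a Gaussian
    exponential. *)
Lemma small_overlap_moment (b eps x S : R) : 0 < S -> 0 < eps <= 1 -> 32 * b ^+ 2 * eps <= 1 -> `|x| <= 1 ->
  ind (x ^+ p < eps ^+ p) * `|x| * expR (b ^+ 2 * (S ^+ 2 / 2) * x ^+ p) <=
  4 / S * expR (S ^+ 2 * x ^+ 2 / 16).
Proof.
move=> S0 he be x1.
have c0 : 0 <= 4 / S * expR (S ^+ 2 * x ^+ 2 / 16).
  by rewrite mulr_ge0 ?expR_ge0 ?divr_ge0 ?(ltW S0).
case: (ltP (x ^+ p) (eps ^+ p)) => xp; last by rewrite !mul0r.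
set q := S * x.
have q0 : 0 <= q ^+ 2 / 64 by rewrite divr_ge0 ?sqr_ge0.
have h : b ^+ 2 * (S ^+ 2 / 2) * x ^+ p <= q ^+ 2 / 64.
  have [x0|x0] := leP 0 (x ^+ p).
    by have [] := small_overlap_exponent b eps x S (ltW S0) he be x1 xp x0.
  apply: le_trans q0.
  by rewrite mulr_ge0_le0 ?(ltW x0)// mulr_ge0 ?sqr_ge0// divr_ge0 ?sqr_ge0.
have E : `|x| = `|q| / S by rewrite /q normrM gtr0_norm// mulrAC divff ?mul1r// gt_eqF.
rewrite mul1r E; apply: (@le_trans _ _ (4 * expR (q ^+ 2 / 64) / S * expR (q ^+ 2 / 64))).
  apply: ler_pM; rewrite ?expR_ge0 ?ler_expR//; first by rewrite mulr_ge0// invr_ge0 ltW.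
  by rewrite ler_pM2r ?invr_gt0// norm_le_expR_sqr.
have -> : 4 * expR (q ^+ 2 / 64) / S * expR (q ^+ 2 / 64) = 4 / S * expR (q ^+ 2 / 64 + q ^+ 2 / 64).
  by rewrite expRD; ring.
by rewrite ler_wpM2l ?divr_ge0 ?(ltW S0)// ler_expR -exprMn -/q; lra.
Qed.

Lemma pair_sum_excess n b eps : 0 < eps <= 1 -> 32 * b ^+ 2 * eps <= 1 ->
  pair_sum R _ _ (pspin R p hp n) b (fun t u => ind (overlap R n t u ^+ p < eps ^+ p)) <=
  1 + 64 * b ^+ 2 / Num.sqrt n.+1%:R.
Proof.
move=> he be; set S := Num.sqrt _.
have S0 : 0 < S by rewrite sqrtr_gt0.
have SE : n.+1%:R = S ^+ 2 by rewrite /S sqr_sqrtr.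
apply: (pair_sum_le R p hp n b _ (fun t u => 1 + 32 * b ^+ 2 / S * expR (S ^+ 2 * overlap R n t u ^+ 2 / 16))).
  by move=> t u; rewrite SE; exact: small_overlap_excess (overlap_le1 _ _ _ _).
move=> u; rewrite big_split/= mulrDr (unif_sum (m := pspin R p hp n)) lerD2l.
rewrite -mulr_sumr mulrCA -SE.
have := unif_overlap_sqr R n u; move: (_ * \sum_t _) => z hz.
have : 0 <= 32 * b ^+ 2 / S by rewrite divr_ge0 ?(ltW S0)// mulr_ge0// sqr_ge0.
by move=> h; have := ler_wpM2l h hz; lra.
Qed.

Lemma pair_sum_moment n b eps : 0 < eps <= 1 -> 32 * b ^+ 2 * eps <= 1 ->
  pair_sum R _ _ (pspin R p hp n) b
    (fun t u => ind (overlap R n t u ^+ p < eps ^+ p) * `|overlap R n t u|) <=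
  8 / Num.sqrt n.+1%:R.
Proof.
move=> he be; set S := Num.sqrt _.
have S0 : 0 < S by rewrite sqrtr_gt0.
have SE : n.+1%:R = S ^+ 2 by rewrite /S sqr_sqrtr.
apply: (pair_sum_le R p hp n b _ (fun t u => 4 / S * expR (S ^+ 2 * overlap R n t u ^+ 2 / 16))).
  by move=> t u; rewrite SE; exact: small_overlap_moment (overlap_le1 _ _ _ _).
move=> u; rewrite -mulr_sumr mulrCA -SE.
have := unif_overlap_sqr R n u; move: (_ * \sum_t _) => z hz.
have : 0 <= 4 / S by rewrite divr_ge0 ?(ltW S0).
by move=> h; have := ler_wpM2l h hz; lra.
Qed.

End small_overlap_bounds.

(** * Laws of the observed tensors *)

Section normal_scaling.
Context (R : realType).
Local Notation mu := (@lebesgue_measure R).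

Lemma lebesgue_measureZ (s : {posnum R}) (A : set R) : measurable A ->
  (s%:num%:E * pushforward mu ((fun x : R => s%:num * x)%R : _ -> measurableTypeR R) A)%E = mu A.
Proof.
move=> mA; apply/esym.
refine (@lebesgue_measure_unique R (mscale (s%:num%:nng) (pushforward mu
  ((fun x : R => s%:num * x) : _ -> measurableTypeR R))) _ A mA).
Unshelve.
  2: exact: mulrl_measurable.
move=> _ [[a b]] _ <-.
have pre : (fun x : R => s%:num * x) @^-1` `]a, b]%classic = `]a / s%:num, b / s%:num]%classic.
  by apply/seteqP; split => x /=; rewrite !in_itv/= ltr_pdivrMr// ler_pdivlMr// mulrC.
change (mu `]a, b]%classic = (s%:num%:E * mu ((fun x : R => (s%:num * x)%R) @^-1` `]a, b]%classic))%E); rewrite pre.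
rewrite !lebesgue_measure_itv/= !lte_fin ltr_pM2r ?invr_gt0//; case: ifP => _; last by rewrite mule0.
by rewrite -!EFinB -EFinM; congr EFin; field.
Qed.

Lemma normal_pdf_scale (s x : R) : 0 < s -> s * normal_pdf 0 s (s * x) = normal_pdf 0 1 x.
Proof.
move=> s0; rewrite !normal_pdfE ?gt_eqF ?oner_eq0// /normal_peak /normal_fun.
rewrite !subr0 exprMn expr1n mul1r.
have -> : s ^+ 2 * (pi : R) *+ 2 = s ^+ 2 * (pi *+ 2) by ring.
rewrite sqrtrM ?sqr_ge0// sqrtr_sqr gtr0_norm// invfM mulrA mulrA divff ?gt_eqF// mul1r.
congr (_ * expR _); field.
by rewrite gt_eqF.
Qed.

Lemma normal_prob_scale (s : R) (A : set R) : 0 < s -> measurable A ->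
  normal_prob 0 s ((fun y => s^-1 * y) @^-1` A) = gauss1 R A.
Proof.
move=> s0 mA.
have mB : measurable ((fun y : R => s^-1 * y) @^-1` A).
  by rewrite -[_ @^-1` _]setTI; exact: mulrl_measurable.
pose g (y : R) : \bar R := ((normal_pdf 0 s y)%:E * (\1_A (s^-1 * y))%:E)%E.
have mg : measurable_fun setT g.
  apply: emeasurable_funM; apply/measurable_EFinP; first exact: measurable_normal_pdf.
  have mA1 : measurable_fun setT (\1_A : R -> R) by exact: measurable_indic.
  exact: (measurableT_comp mA1 (mulrl_measurable s^-1)).
have g0 x : (0 <= g x)%E by rewrite mule_ge0// lee_fin ?normal_pdf_ge0.
have -> : normal_prob 0 s ((fun y => s^-1 * y) @^-1` A) = (\int[mu]_y g y)%E.
  rewrite /normal_prob integral_mkcond; apply: eq_integral => y _.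
  rewrite patchE /g indicE; have -> : (y \in (fun y => s^-1 * y) @^-1` A) = (s^-1 * y \in A).
    by apply/idP/idP; rewrite !inE.
  by case: (_ \in A); rewrite ?mule1 ?mule0.
pose phi : R -> measurableTypeR R := fun x => s * x.
have mphi : measurable_fun setT phi by exact: mulrl_measurable.
have -> : (\int[mu]_y g y)%E = (s%:E * \int[pushforward mu phi]_y g y)%E.
  rewrite -(ge0_integral_mscale (pushforward mu phi) measurableT (PosNum s0)%:num%:nng)//.
  apply: eq_measure_integral => B mB' _.
  exact: (esym (lebesgue_measureZ (PosNum s0) B mB')).
rewrite ge0_integral_pushforward// preimage_setT.
rewrite -ge0_integralZl ?lee_fin ?(ltW s0)//; last 2 first.
- exact: (measurableT_comp mg (mulrl_measurable s)).
- by move=> x _; exact: g0.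
rewrite /gauss1 /normal_prob [RHS]integral_mkcond; apply: eq_integral => x _.
have -> : (g \o phi) x = ((normal_pdf 0 s (s * x))%:E * (\1_A x)%:E)%E.
  by rewrite /= /g /phi mulKf ?gt_eqF.
rewrite patchE indicE muleA -EFinM normal_pdf_scale//.
by case: ifPn => [xA|xA]; rewrite ?xA ?(negbTE xA) ?mulr1 ?mulr0.
Qed.

End normal_scaling.

Section laws.
Context (R : realType) (d : measure_display) (Om : measurableType d) (P : probability Om R).

(** Independence of the planted spin and the noise is used through joint probabilities with the
    event [E], on which the law of [X] is a multiple of [gauss]. *)
Lemma gauss_law_on (I : finType) (X : Om -> vect R I) (E : set Om) (c : {nonneg R}) :
  measurable_fun setT X -> measurable E ->
  (forall A : I -> set R, (forall i, measurable (A i)) ->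
    P ((fun w => forall i, A i (X w i)) `&` E) = (c%:num%:E * \prod_i gauss1 R (A i))%E) ->
  forall D, measurable D -> P (X @^-1` D `&` E) = (c%:num%:E * gauss R I D)%E.
Proof.
move=> mX mE H D mD.
refine (gauss_unique R I (pushforward (mrestr P mE) X) c _ D mD).
Unshelve. all: try exact: mX.
exact: H.
Qed.

Lemma probability_partition (S : finType) (u : Om -> S) (F : S -> set Om) :
  (forall s, measurable (F s `&` [set w | u w = s])) ->
  P [set w | F (u w) w] = (\sum_(s : S) P (F s `&` [set w | u w = s]))%E.
Proof.
move=> mF.
have -> : [set w | F (u w) w] = \bigcup_(s in [set` enum S]) (F s `&` [set w | u w = s]).
  apply/seteqP; split => w /=; first by move=> h; exists (u w) => //=; rewrite mem_enum.
  by move=> [s _ [h /= us]]; rewrite us.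
rewrite measure_fin_bigcup//; last first.
  by move=> s t _ _ [w [[_ /= <-] [_ /= <-]]].
by rewrite -fsbig_seq ?enum_uniq// big_enum.
Qed.

End laws.

Section spiked_tensor.
Context (R : realType) (p : nat) (hp : (3 <= p)%N) (n : nat).
Local Notation N := (n.+1%:R : R).
Local Notation I := (idx p n.+1).
Local Notation Sp := (spin n.+1).
Local Notation m := (pspin R p hp n).
Implicit Types (x : vect R I) (b : R) (s : Sp).

(* The observed symmetric tensor as a function of the standardized noise. *)
Definition obs x : tensor R p n.+1 := symmetrize (fun i => Num.sqrt (2 / N) * x i).

Definition pairing (w : tensor R p n.+1) s : R := \sum_i w i * outer p (vecS s) i.

Lemma outer_perm (v : 'I_n.+1 -> R) (i : I) (pi : 'S_p) : outer p v [ffun j => i (pi j)] = outer p v i.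
Proof.
rewrite /outer [RHS](reindex_inj (@perm_inj _ pi)); apply: eq_bigr => j _.
by rewrite ffunE.
Qed.

Lemma fact_neq0 : p`!%:R != 0 :> R.
Proof. by rewrite pnatr_eq0 -lt0n fact_gt0. Qed.

Lemma symmetrize_sym (Y : tensor R p n.+1) : sym_tensor p n.+1 (symmetrize Y).
Proof.
move=> pi; apply/funext => i; rewrite /Defs.tperm /symmetrize; congr (_ * _).
rewrite [RHS](reindex_inj (mulIg pi)); apply: eq_bigr => rho _.
rewrite /Defs.tperm; congr Y; apply/ffunP => j; by rewrite !ffunE permM.
Qed.

(** A tensor power is invariant under permutations of its indices, so each permuted copy of [Y]
    pairs with it as [Y] does. *)
Lemma symmetrize_pairing (Y : tensor R p n.+1) s : pairing (symmetrize Y) s = pairing Y s.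
Proof.
rewrite /pairing /symmetrize.
under eq_bigr do rewrite -mulrA mulr_suml.
rewrite -mulr_sumr exchange_big/= (eq_bigr (fun=> \sum_i Y i * outer p (vecS s) i)) => [|pi _].
  rewrite sumr_const card_Sn -[X in _ * X]mulr_natl mulKf ?fact_neq0//.
pose h (i : I) : I := [ffun j => i (pi j)].
have hi : injective h.
  move=> i i' /ffunP e; apply/ffunP => j; have := e (pi^-1%g j).
  by rewrite !ffunE permKV.
rewrite [RHS](reindex_inj hi); apply: eq_bigr => i _.
by rewrite /Defs.tperm outer_perm.
Qed.

Lemma kappa_outer s (i : I) : Num.sqrt (2 / N) * pcoef R p n s i = outer p (vecS s) i.
Proof.
have N0 : Num.sqrt N != 0 by rewrite gt_eqF ?sqrtr_gt0.
have two : Num.sqrt 2 != 0 :> R by rewrite gt_eqF ?sqrtr_gt0.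
have -> : outer p (vecS s) i = sgnprod R p n s i / Num.sqrt N ^+ p.
  by rewrite /outer /vecS big_split/= prodr_const card_ord exprVn.
rewrite /pcoef /kappa sqrtrM// sqrtrV//.
have -> : Num.sqrt N ^+ p = Num.sqrt N ^+ (p - 1) * Num.sqrt N.
  by rewrite -exprSr subn1 prednK// (leq_trans _ hp).
have : Num.sqrt N ^+ (p - 1) != 0 by rewrite expf_neq0.
move: (Num.sqrt N ^+ (p - 1)) (Num.sqrt N) (Num.sqrt 2) N0 two => q r t r0 t0 q0.
by field; rewrite ?r0 ?t0 ?q0.
Qed.

Lemma obs_shift b s x : obs (shift m b s x) = (fun i => obs x i + b * outer p (vecS s) i).
Proof.
apply/funext => i; rewrite /obs /symmetrize /Defs.tperm.
have -> : \sum_(pi : 'S_p) Num.sqrt (2 / N) * shift m b s x [ffun j => i (pi j)] =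
   \sum_(pi : 'S_p) (Num.sqrt (2 / N) * x [ffun j => i (pi j)] + b * outer p (vecS s) i).
  apply: eq_bigr => pi _; rewrite /shift mulrDr mulrCA.
  by rewrite [Num.sqrt _ * coef m s _]kappa_outer outer_perm.
rewrite big_split/= mulrDr; congr (_ + _).
by rewrite sumr_const card_Sn -[X in _ * X = _]mulr_natl mulKf ?fact_neq0.
Qed.

(** The Hamiltonian depends on the noise only through its symmetrization. Hence the likelihood ratio
    and the posterior are functions of the observed tensor. *)
Lemma pairing_obs x s : N / 2 * pairing (obs x) s = ham m s x.
Proof.
rewrite /obs symmetrize_pairing /pairing mulr_sumr /ham; apply: eq_bigr => i _.
have e : Num.sqrt (2 / N) ^+ 2 = 2 / N by rewrite sqr_sqrtr// divr_ge0.
have N0 : N != 0 by [].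
rewrite -kappa_outer; transitivity (N / 2 * Num.sqrt (2 / N) ^+ 2 * (pcoef R p n s i * x i)); first by ring.
by rewrite e [N / 2 * _](_ : _ = 1) ?mul1r//; field.
Qed.

Lemma measurable_obs : measurable_fun setT (obs : vect R I -> vect R I).
Proof.
apply: measurable_vectP => i; apply: measurable_funM => //.
apply: measurable_sum => pi; rewrite /Defs.tperm; apply: measurable_funM => //.
exact: measurable_coord.
Qed.

Lemma measurable_pairing s : measurable_fun setT (pairing^~ s : vect R I -> R).
Proof.
apply: measurable_sum => i; apply: measurable_funM => //; exact: measurable_coord.
Qed.

Lemma measurable_sym : measurable (sym_tensor p n.+1 : set (vect R I)).
Proof.
have -> : sym_tensor p n.+1 = \bigcap_(q in [set` enum {: 'S_p * I}])
    [set Y : vect R I | Y [ffun j => q.2 (q.1 j)] - Y q.2 = 0].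
  apply/seteqP; split => [Y h [pi i] _ /=|Y h pi].
    by have /(congr1 (fun f => f i)) := h pi; rewrite /Defs.tperm => ->; rewrite subrr.
  apply/funext => i; have /= /eqP := h (pi, i) (mem_enum _ _).
  by rewrite subr_eq0 => /eqP.
rewrite bigcap_seq; apply: bigsetI_measurable => q _.
have mf : measurable_fun setT (fun Y : vect R I => Y [ffun j => q.2 (q.1 j)] - Y q.2).
  by apply: measurable_funB; exact: measurable_coord.
by rewrite -[X in measurable X]setTI; exact: mf (measurable_set1 0).
Qed.

End spiked_tensor.

Section spiked_law.
Context (R : realType) (p : nat) (hp : (3 <= p)%N) (d : measure_display) (Om : measurableType d)
  (P : probability Om R) (Y : forall N : nat, Om -> tensor R p N) (u : forall N : nat, Om -> spin N).
Hypothesis H : spiked_model P p Y u.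
Context (n : nat).
Local Notation N := (n.+1%:R : R).
Local Notation I := (idx p n.+1).
Local Notation Sp := (spin n.+1).
Local Notation m := (pspin R p hp n).

Definition noise (w : Om) : vect R I := fun i => (Num.sqrt (2 / N))^-1 * Y n.+1 w i.

Lemma spike_scale_gt0 : 0 < Num.sqrt (2 / N).
Proof. by rewrite sqrtr_gt0 divr_gt0. Qed.

Lemma measurable_noise : measurable_fun setT noise.
Proof.
have [mY _] := H n.+1 isT.
apply: measurable_vectP => i; apply: measurable_funM => //.
by have [] := mY i.
Qed.

Lemma Wt_obs w : Wt Y n.+1 w = obs R p n (noise w).
Proof.
rewrite /Wt /obs; congr symmetrize; apply/funext => i.
by rewrite /noise mulrA divff ?mul1r// gt_eqF ?spike_scale_gt0.
Qed.

Lemma Tt_obs b w : Tt b Y u n.+1 w = obs R p n (shift m b (u n.+1 w) (noise w)).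
Proof. by rewrite obs_shift -Wt_obs. Qed.

(** Split by the value of the planted spin; on each value, independence and box probabilities
    identify the law of the standardized noise. *)
Lemma spiked_law (D : Sp -> set (vect R I)) : (forall s, measurable (D s)) ->
  P [set w | D (u n.+1 w) (noise w)] = ((unif Sp)%:E * \sum_(s : Sp) gauss R I (D s))%E.
Proof.
move=> mD; have [mY [mu [Pu indY]]] := H n.+1 isT.
have mn := measurable_noise.
rewrite (probability_partition _ _ _ _ _ _ (fun s => noise @^-1` D s)); last first.
  by move=> s; apply: measurableI => //; rewrite -[X in measurable X]setTI; exact: mn.
rewrite ge0_sume_distrr//.
apply: eq_bigr => s _.
have u0 : 0 <= unif Sp :> R by rewrite unif_spin invr_ge0 exprn_ge0.
apply: (gauss_law_on _ _ _ _ _ _ _ (NngNum u0)) => // A mA.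
rewrite /= unif_spin -(Pu s).
have mB i : measurable ((fun y => (Num.sqrt (2 / N))^-1 * y) @^-1` A i).
  by rewrite -[X in measurable X]setTI; exact: mulrl_measurable.
transitivity (P [set w | (forall i, ((fun y => (Num.sqrt (2 / N))^-1 * y) @^-1` A i) (Y n.+1 w i)) /\ [set s] (u n.+1 w)]).
  by [].
rewrite (indY (fun i => (fun y => (Num.sqrt (2 / N))^-1 * y) @^-1` A i) [set s] mB).
rewrite muleC; congr (_ * _)%E; apply: eq_bigr => i _.
have [_ lawY] := mY i.
rewrite -(normal_prob_scale R _ _ spike_scale_gt0 (mA i)) -lawY//.
Qed.

Lemma spiked_prob (f : Sp -> vect R I -> bool) : (forall s, measurable_fun setT (f s)) ->
  Pr P [set w | f (u n.+1 w) (noise w)] = unif Sp * \sum_s mean (fun x => ind (f s x)).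
Proof.
move=> mf; rewrite /Pr (spiked_law (fun s => [set x | f s x])); last first.
  by move=> s; have := mf s measurableT [set true]; rewrite setTI; exact.
rewrite (eq_bigr (fun s => (mean (fun x => ind (f s x)))%:E)) => [|s _]; last by rewrite mean_prob.
by rewrite sumEFin.
Qed.

Lemma noise_prob (f : vect R I -> bool) : measurable_fun setT f ->
  Pr P [set w | f (noise w)] = mean (fun x => ind (f x)).
Proof. by move=> mf; rewrite (spiked_prob (fun=> f))// (unif_sum (m := m)). Qed.

Lemma planted_prob b (f : Sp -> vect R I -> bool) : (forall s, measurable_fun setT (f s)) ->
  Pr P [set w | f (u n.+1 w) (shift m b (u n.+1 w) (noise w))] =
  unif Sp * \sum_s mean (fun x => lik m b s x * ind (f s x)).
Proof.
move=> mf; rewrite (spiked_prob (fun s x => f s (shift m b s x))); last first.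
  by move=> s; exact: measurableT_comp (mf s) (measurable_shift b s).
congr (_ * _); apply: eq_bigr => s _.
rewrite (lik_mean (m := m) b s (fun x => ind (f s x))) => [||x]; last exact: ler0n.
  by congr mean; apply/funext => x; rewrite mulrC.
exact: measurable_indb.
Qed.

End spiked_law.

(** * The free energy as a normalized log-evidence *)

Section free_energy.
Context (R : realType) (p : nat) (hp : (3 <= p)%N) (d : measure_display) (Om : measurableType d)
  (P : probability Om R) (g : {ffun 'I_p -> nat} -> Om -> R).
Hypothesis hg : iid_std_gaussian_array P p g.

Definition disorder n (w : Om) : vect R (idx p n.+1) := fun i => g (embed_idx i) w.

Lemma measurable_disorder n : measurable_fun setT (disorder n).
Proof.
by apply: measurable_vectP => i; have [] := hg.1 (embed_idx i).
Qed.

Lemma disorder_law n (D : set (vect R (idx p n.+1))) : measurable D ->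
  P (disorder n @^-1` D) = gauss R (idx p n.+1) D.
Proof.
move=> mD.
suff K : forall A : idx p n.+1 -> set R, (forall i, measurable (A i)) ->
    P ((fun w => forall i, A i (disorder n w i)) `&` setT) = ((NngNum (@ler01 R))%:num%:E * \prod_i gauss1 R (A i))%E.
  have := gauss_law_on _ _ _ P _ (disorder n) setT (NngNum (@ler01 R)) (measurable_disorder n) measurableT K D mD.
  by rewrite setIT mul1e.
move=> A mA; rewrite setIT mul1e.
have := hg.2 n.+1 A mA.
have -> : \bigcap_(i in [set: idx p n.+1]) (g (embed_idx i) @^-1` A i) = (fun w => forall i, A i (disorder n w i)).
  by apply/seteqP; split => w h i; [exact: h|move=> _; exact: h].
move=> ->; apply: eq_bigr => i _.
by have [_ ->] := hg.1 (embed_idx i).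
Qed.

Lemma disorder_prob n (f : vect R (idx p n.+1) -> bool) : measurable_fun setT f ->
  Pr P [set w | f (disorder n w)] = mean (fun x => ind (f x)).
Proof.
move=> mf; rewrite /Pr (disorder_law n [set x | f x]) -?mean_prob//.
by have := mf measurableT [set true]; rewrite setTI; exact.
Qed.

Lemma FN_evid n b w : FN p n.+1 (fun i => g i w) b =
  n.+1%:R^-1 * ln (evid (pspin R p hp n) b (disorder n w)) + b ^+ 2 / 4.
Proof.
have N0 : n.+1%:R != 0 :> R by [].
have E : b ^+ 2 / 4 = n.+1%:R^-1 * (b ^+ 2 * (n.+1%:R / 2) / 2) :> R by field.
rewrite /FN E -mulrDr; congr (_ * _).
rewrite -[X in _ = _ + X]expRK -lnM ?posrE ?expR_gt0 ?evid_gt0//; congr ln.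
rewrite evidE -mulrA mulr_suml mulr_sumr; apply: eq_bigr => s _.
rewrite unif_spin; congr (_ * _); rewrite /lik -expRD; congr expR.
rewrite /= subrK -mulrA; congr (_ * _).
rewrite /HN mulrA -invfM; rewrite /ham mulr_sumr; apply: eq_bigr => i _.
by rewrite [g _ _ * _]mulrC mulrA.
Qed.

End free_energy.

(** * The free energy *)

(** Dominated convergence for the indicators of the deviation events. *)
Lemma ae_cvg_prob (R : realType) (d : measure_display) (Om : measurableType d)
  (P : probability Om R) (f : nat -> Om -> R) (l e r : R) :
  (forall n, measurable_fun setT (f n)) -> {ae P, forall w, f ^~ w @ \oo --> l} ->
  0 < e -> 0 < r -> \forall n \near \oo, Pr P [set w | e <= `|f n w - l|] <= r.
Proof.
move=> mf fl e0 r0.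
pose A n : set Om := [set w | e <= `|f n w - l|].
have mA n : measurable (A n).
  have mn : measurable_fun setT (fun w => `|f n w - l|).
    by apply: measurableT_comp => //; exact: measurable_funB.
  have := mn measurableT `[e, +oo[%classic (measurable_itv _).
  rewrite setTI; congr measurable; apply/seteqP; split => w /=; rewrite in_itv/= andbT//.
pose h n (w : Om) : \bar R := (\1_(A n) w)%:E.
have mh n : measurable_fun setT (h n) by apply/measurable_EFinP; exact: measurable_indic.
have [|||_ _] := @dominated_convergence _ _ _ P setT measurableT h (cst 0%E) (cst 1%E) mh (measurable_cst _).
- apply: filterS fl => w fw _; apply: cvg_near_cst.
  have /cvgr_dist_lt/(_ _ e0) := fw.
  apply: filterS => n; rewrite distrC => hn; rewrite /h indicE memNset//= /A/=.
  by apply/negP; rewrite -ltNge.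
- exact: finite_measure_integrable_cst.
- apply/aeW => w n _; rewrite /h /= lee_fin indicE; case: (_ \in _); rewrite ?normr1 ?normr0//.
rewrite integral0 => H.
have H2 : (fun n => P (A n)) @ \oo --> 0%E.
  have E n : P (A n) = (\int[P]_x h n x)%E by rewrite /h integral_indic// setIT.
  by rewrite (funext E).
have /fine_cvgP[_] := H2.
move=> /cvgr_lt/(_ _ r0).
by apply: filterS => n /ltW.
Qed.

Section free_energy_limit.
Context (R : realType) (p : nat) (hp : (3 <= p)%N) (d : measure_display) (Om : measurableType d)
  (P : probability Om R) (g : {ffun 'I_p -> nat} -> Om -> R).
Hypothesis hg : iid_std_gaussian_array P p g.
Context (F : R -> R).
Hypothesis hF : is_free_energy_limit P p g F.
Local Notation m := (pspin R p hp).
Implicit Types b : R.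

Definition log_evid n b (x : vect R (idx p n.+1)) : R := n.+1%:R^-1 * ln (evid (m n) b x).

Lemma measurable_log_evid n b : measurable_fun setT (log_evid n b).
Proof. by apply: measurable_funM => //; exact: measurable_lnZ. Qed.

Lemma log_evid_le n b x r : (log_evid n b x <= r) = (evid (m n) b x <= expR (r * n.+1%:R)).
Proof.
rewrite /log_evid mulrC ler_pdivrMr// -[LHS]ler_expR lnK ?posrE//; exact: evid_gt0.
Qed.

Lemma free_energy_prob b e r : 0 <= b -> 0 < e -> 0 < r ->
  \forall n \near \oo, mean (fun x => ind (e <= `|log_evid n b x + b ^+ 2 / 4 - F b|)) <= r.
Proof.
move=> b0 e0 r0.
have mq n : measurable_fun setT (fun x => log_evid n b x + b ^+ 2 / 4).
  by apply: measurable_funD => //; exact: measurable_log_evid.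
have := ae_cvg_prob R d Om P (fun n w => log_evid n b (disorder R p d Om g n w) + b ^+ 2 / 4) (F b) e r.
case=> //.
- by move=> n; exact: measurableT_comp (mq n) (measurable_disorder R p d Om P g hg n).
- apply: filterS (hF b b0) => w; rewrite -(cvg_shiftS (fun N => FN p N (fun i => g i w) b)).
  have -> : (fun N => FN p N.+1 (fun i => g i w) b) =
      (fun n => log_evid n b (disorder R p d Om g n w) + b ^+ 2 / 4); last by [].
  by apply/funext => n; exact: FN_evid.
move=> n0 _ hn; exists n0 => // n n0n /=.
have := hn n n0n; congr (_ <= _).
rewrite -(disorder_prob R p d Om P g hg n (fun x => e <= `|log_evid n b x + b ^+ 2 / 4 - F b|))//.
apply: measurable_fun_ler => //; apply: measurableT_comp => //.
by apply: measurable_funB.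
Qed.

(** Markov: the evidence has null mean 1, so it cannot be exponentially large with probability close
    to 1. *)
Lemma free_energy_le b : 0 <= b -> F b <= b ^+ 2 / 4.
Proof.
move=> b0; rewrite leNgt; apply/negP => h.
pose e := (F b - b ^+ 2 / 4) / 2.
have e0 : 0 < e by rewrite divr_gt0// subr_gt0.
suff : \forall n \near \oo, False by move=> [n _ /(_ n (leqnn n))].
near=> n.
have h1 : mean (fun x => ind (e <= `|log_evid n b x + b ^+ 2 / 4 - F b|)) <= 1 / 4.
  by near: n; apply: free_energy_prob.
have h2 := null_evid_large (m := m n) b (expR (e * n.+1%:R)) (expR_gt0 _).
have h3 : expR (- (e * n.+1%:R)) <= 1 / 4 by near: n; exact: near_expR_le.
rewrite -expRN in h2.
have t1 : tame (fun x => ind (e <= `|log_evid n b x + b ^+ 2 / 4 - F b|)).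
  apply: tame_indb; apply: measurable_fun_ler => //; apply: measurableT_comp => //.
  apply: measurable_funB => //; apply: measurable_funD => //; exact: measurable_log_evid.
have t2 : tame (fun x => ind (expR (e * n.+1%:R) <= evid (m n) b x)).
  by apply: tame_indb; apply: measurable_ge; exact: tame_measurable (tame_evid b).
have : 1 <= mean (fun x => ind (e <= `|log_evid n b x + b ^+ 2 / 4 - F b|) +
    ind (expR (e * n.+1%:R) <= evid (m n) b x)).
  rewrite -[leLHS](mean_cst R (idx p n.+1)); apply: le_mean => [||x].
  - exact: tame_cst.
  - exact: tameD.
  have [k|k] := leP (expR (e * n.+1%:R)) (evid (m n) b x); first by rewrite lerDr ler0n.
  rewrite addr0; suff -> : e <= `|log_evid n b x + b ^+ 2 / 4 - F b| by [].
  have : log_evid n b x <= e by rewrite log_evid_le ltW.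
  have := ler_norm (- (log_evid n b x + b ^+ 2 / 4 - F b)); rewrite normrN /e.
  by move: (log_evid _ _ _) (`|_|) => z y k1 k2; clear -hF k1 k2; lra.
rewrite meanD//; move: (le_trans h2 h3) h1; move: (mean _) (mean _) => y1 y2 k1 k2 k3.
clear -hF k1 k2 k3; lra.
Unshelve. all: by end_near. Qed.

Lemma critical_nondegenerate b : 0 <= b -> F b = b ^+ 2 / 4 ->
  null_nondegenerate m b.
Proof.
move=> b0 Fb e e0; near=> n.
have h1 : mean (fun x => ind (e <= `|log_evid n b x + b ^+ 2 / 4 - F b|)) <= 1 / 2.
  by near: n; apply: free_energy_prob.
have t1 : tame (fun x => ind (e <= `|log_evid n b x + b ^+ 2 / 4 - F b|)).
  apply: tame_indb; apply: measurable_fun_ler => //; apply: measurableT_comp => //.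
  apply: measurable_funB => //; apply: measurable_funD => //; exact: measurable_log_evid.
have t2 : tame (fun x => ind (expR (- (e * n.+1%:R)) <= evid (m n) b x)).
  by apply: tame_indb; apply: measurable_ge; exact: tame_measurable (tame_evid b).
have : 1 <= mean (fun x => ind (e <= `|log_evid n b x + b ^+ 2 / 4 - F b|) +
    ind (expR (- (e * n.+1%:R)) <= evid (m n) b x)).
  rewrite -[leLHS](mean_cst R (idx p n.+1)); apply: le_mean => [||x].
  - exact: tame_cst.
  - exact: tameD.
  have [k|k] := leP (expR (- (e * n.+1%:R))) (evid (m n) b x); first by rewrite lerDr ler0n.
  rewrite addr0; suff -> : e <= `|log_evid n b x + b ^+ 2 / 4 - F b| by [].
  have : log_evid n b x <= - e by rewrite log_evid_le mulNr ltW.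
  have := ler_norm (- (log_evid n b x + b ^+ 2 / 4 - F b)); rewrite normrN Fb.
  by move: (log_evid _ _ _) (`|_|) => z y k1 k2; clear -hF k1 k2; lra.
rewrite meanD//; move: h1; move: (mean _) (mean _) => y1 y2 k1 k2.
clear -hF k1 k2; lra.
Unshelve. all: by end_near. Qed.

Lemma supercritical_evid_small b : 0 <= b -> F b < b ^+ 2 / 4 ->
  exists2 c : R, 0 < c & \forall n \near \oo,
    1 / 2 <= mean (fun x => ind (evid (m n) b x <= expR (- (2 * (c * n.+1%:R))))).
Proof.
(* The normalized log-evidence tends to [- 4 * c], so a deviation below [c] leaves it under
   [- 2 * c]. *)
move=> b0 Fb; exists ((b ^+ 2 / 4 - F b) / 4); first by rewrite divr_gt0// subr_gt0.
set c := _ / 4; have c0 : 0 < c by rewrite divr_gt0// subr_gt0.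
have cE : b ^+ 2 / 4 - F b = 4 * c by rewrite /c; field.
near=> n.
have h1 : mean (fun x => ind (c <= `|log_evid n b x + b ^+ 2 / 4 - F b|)) <= 1 / 2.
  by near: n; apply: free_energy_prob.
have t1 : tame (fun x => ind (c <= `|log_evid n b x + b ^+ 2 / 4 - F b|)).
  apply: tame_indb; apply: measurable_fun_ler => //; apply: measurableT_comp => //.
  apply: measurable_funB => //; apply: measurable_funD => //; exact: measurable_log_evid.
have t2 : tame (fun x => ind (evid (m n) b x <= expR (- (2 * (c * n.+1%:R))))).
  by apply: tame_indb; apply: measurable_le; exact: tame_measurable (tame_evid b).
have : 1 <= mean (fun x => ind (c <= `|log_evid n b x + b ^+ 2 / 4 - F b|) +
    ind (evid (m n) b x <= expR (- (2 * (c * n.+1%:R))))).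
  rewrite -[leLHS](mean_cst R (idx p n.+1)); apply: le_mean => [||x].
  - exact: tame_cst.
  - exact: tameD.
  have [k|k] := leP (evid (m n) b x) (expR (- (2 * (c * n.+1%:R)))); first by rewrite lerDr ler0n.
  rewrite addr0; suff -> : c <= `|log_evid n b x + b ^+ 2 / 4 - F b| by [].
  have : ~~ (log_evid n b x <= - (2 * c)) by rewrite log_evid_le mulNr -ltNge -mulrA.
  rewrite -ltNge -addrA cE.
  have := ler_norm (log_evid n b x + 4 * c).
  by move: (log_evid _ _ _) (`|_|) => z y k1 k2; clear -hF k1 k2 c0; lra.
rewrite meanD//; move: h1; move: (mean _) (mean _) => y1 y2 k1 k2.
clear -hF k1 k2; lra.
Unshelve. all: by end_near. Qed.

End free_energy_limit.

(** * Both phases *)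

Lemma near_invsqrt_le (R : realType) (c e : R) : 0 < e ->
  \forall n \near \oo, c / Num.sqrt n.+1%:R <= e.
Proof.
move=> e0; near=> n.
rewrite ler_pdivrMr ?sqrtr_gt0// -ler_pdivrMl//.
have h : (e^-1 * c) ^+ 2 <= n%:R by near: n; exact: nbhs_infty_ger.
apply: le_trans (ler_norm _) _; rewrite -sqrtr_sqr ler_sqrt//.
by apply: le_trans h _; rewrite ler_nat.
Unshelve. all: by end_near. Qed.

Section sub_super_critical.
Context (R : realType) (p : nat) (hp : (3 <= p)%N).
Local Notation m := (pspin R p hp).
Implicit Types b c e : R.

Let snrE n : snr (m n) = n.+1%:R / 2. Proof. by []. Qed.

Lemma exp_small_le b v e : exp_small m b v -> 0 < e ->
  \forall n \near \oo, mean (fun x => ind (e <= evidS (m n) (above v) b x)) <= e.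
Proof.
move=> [c c0 H] e0; near=> n.
have h1 : expR (- (c * n.+1%:R)) <= e by near: n; exact: near_expR_le.
apply: (@le_trans _ _ (expR (- (c * n.+1%:R)))) => //.
have h2 : mean (fun x => ind (expR (- (c * n.+1%:R)) <= evidS (m n) (above v) b x)) <=
    expR (- (c * n.+1%:R)) by near: n; exact: H.
apply: le_trans h2.
have tg r : tame (fun x => ind (r <= evidS (m n) (above v) b x)).
  by apply: tame_indb; apply: measurable_ge; exact: tame_measurable (tame_evidS _ b).
apply: le_mean => // x; apply: ind_le => [|h]; first exact: ler0n.
by rewrite (le_trans h1 h).
Unshelve. all: by end_near. Qed.

(** The largest [eps <= 1] allowed by the small-overlap bounds. Its power [p] enters below because
    the model overlap is [overlap ^+ p]. *)
Definition cutoff b : R := Num.min 1 (32 * b ^+ 2)^-1.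

Lemma cutoffP b : 0 < b -> 0 < cutoff b <= 1 /\ 32 * b ^+ 2 * cutoff b <= 1.
Proof.
move=> b0; have b2 : 0 < 32 * b ^+ 2 by rewrite mulr_gt0// exprn_gt0.
split; first by rewrite lt_min ltr01 invr_gt0 b2 ge_min lexx.
by rewrite -ler_pdivlMl// mulr1 ge_min lexx orbT.
Qed.

Section subcritical.
Variables (b b' : R).
Hypotheses (b0 : 0 < b) (bb' : b < b') (psib' : psi_sublinear m b').

Lemma subcritical_exp_small : exp_small m b (cutoff b ^+ p).
Proof.
apply: (psi_sublinear_exp_small R _ _ m snrE b b') => //.
by have [/andP[h _] _] := cutoffP b b0; rewrite exprn_gt0.
Qed.

Lemma subcritical_evid e : 0 < e -> \forall n \near \oo,
  mean (fun x => `|1 - evid (m n) b x| + (1 - evid (m n) b x)) <= e.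
Proof.
move=> e0; have [c1 c2] := cutoffP b b0.
(* The excess of [pair_sum] and [3 * r] are each at most [e ^+ 2 / 32], and [eta] solves
   [2 * (eta + (e ^+ 2 / 16) / eta) = e]. *)
pose r := e ^+ 2 / 96; pose eta := e / 4.
have r0 : 0 < r by rewrite divr_gt0// exprn_gt0.
have eta0 : 0 < eta by rewrite divr_gt0.
near=> n.
have h1 : mean (fun x => ind (r <= evidS (m n) (above (cutoff b ^+ p)) b x)) <= r.
  by near: n; apply: exp_small_le => //; exact: subcritical_exp_small.
have h2 := pair_sum_excess R p hp n b (cutoff b) c1 c2.
have h3 : 64 * b ^+ 2 / Num.sqrt n.+1%:R <= e ^+ 2 / 32.
  by near: n; apply: near_invsqrt_le; rewrite divr_gt0// exprn_gt0.
apply: le_trans (truncated_second_moment R _ _ (m n) b _ r eta eta0 r0 h1) _.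
have -> : e = 2 * (eta + (e ^+ 2 / 16) / eta).
  by rewrite /eta; field; rewrite gt_eqF.
rewrite ler_pM2l// lerD2l ler_pM2r ?invr_gt0//.
have rE : 3 * r = e ^+ 2 / 32 by rewrite /r; field.
rewrite rE; move: h2 h3; rewrite /=.
move: (pair_sum _ _ _ _ _ _) (64 * _ / _) (e ^+ 2) => q1 q2 q3 k1 k2.
clear -psib' k1 k2; lra.
Unshelve. all: by end_near. Qed.

Lemma subcritical_overlap e : 0 < e -> \forall n \near \oo,
  bayes2 R _ _ (m n) b (fun t u => `|overlap R n t u|) <= e.
Proof.
move=> e0; have [c1 c2] := cutoffP b b0.
(* Five error terms of size at most [r] will be added; [r <= 1] gives [r ^+ 2 <= r] for one of
   them. *)
pose r := Num.min 1 (e / 8).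
have r0 : 0 < r by rewrite lt_min ltr01 divr_gt0.
have r1 : r <= 1 by rewrite ge_min lexx.
have re : r <= e / 8 by rewrite ge_min lexx orbT.
have r2 : 0 < r ^+ 2 by rewrite exprn_gt0.
near=> n.
have h1 : mean (fun x => ind (r ^+ 2 <= evidS (m n) (above (cutoff b ^+ p)) b x)) <= r ^+ 2.
  by near: n; apply: exp_small_le => //; exact: subcritical_exp_small.
have h2 := pair_sum_moment R p hp n b (cutoff b) c1 c2.
have h3 : 8 / Num.sqrt n.+1%:R <= r ^+ 2 by near: n; exact: near_invsqrt_le.
have w01 t u : 0 <= `|overlap R n t u| <= 1 by rewrite normr_ge0 overlap_le1.
apply: le_trans (bayes2_overlap R _ _ (m n) b (cutoff b ^+ p) r r _ r0 r0 w01) _.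
have h4 : pair_sum R _ _ (m n) b (fun t u => ind (ovl (m n) t u < cutoff b ^+ p) * `|overlap R n t u|) / r <= r.
  rewrite ler_pdivrMr// -expr2; exact: le_trans h2 h3.
have h5 : r ^+ 2 <= r by rewrite expr2 ler_piMr// ltW.
move: (le_trans h1 h5) h4; move: (mean _) (_ / r) => q1 q2 k1 k2.
clear -psib' k1 k2 re e0; lra.
Unshelve. all: by end_near. Qed.

End subcritical.

Section supercritical.
Variables (b c : R).
Hypotheses (b0 : 0 < b) (c0 : 0 < c) (small : \forall n \near \oo,
  1 / 2 <= mean (fun x => ind (evid (m n) b x <= expR (- (2 * (c * n.+1%:R)))))).

Let k : R := c ^+ 2 / (2 * b ^+ 2).
Let k0 : 0 < k. Proof. by rewrite divr_gt0 ?mulr_gt0 ?exprn_gt0. Qed.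
Let kE n : (c * n.+1%:R) ^+ 2 / (4 * b ^+ 2 * snr (m n)) = k * n.+1%:R.
Proof.
rewrite snrE /k; have N0 : n.+1%:R != 0 :> R by [].
have b1 : b != 0 by rewrite gt_eqF.
by move: (n.+1%:R) N0 => N N0; field; rewrite ?N0 ?b1.
Qed.

Lemma supercritical_null_evid e : 0 < e -> \forall n \near \oo,
  mean (fun x => ind (expR (- (c * n.+1%:R)) <= evid (m n) b x)) <= e.
Proof.
move=> e0; near=> n.
have h : 1 / 2 <= mean (fun x => ind (evid (m n) b x <= expR (- (2 * (c * n.+1%:R))))).
  by near: n; exact: small.
have cn : 0 <= c * n.+1%:R by rewrite mulr_ge0// ltW.
have [h1 _] := null_small_planted_large R _ _ (m n) b (c * n.+1%:R) 0 (lt0r_neq0 b0) cn h.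
apply: le_trans h1 _; rewrite kE mulrC -ler_pdivlMr//.
by near: n; apply: near_expR_le => //; rewrite divr_gt0.
Unshelve. all: by end_near. Qed.

Lemma supercritical_gibbs : exists2 eps : R, 0 < eps & forall e, 0 < e -> \forall n \near \oo,
  unif (spin n.+1) * \sum_u mean (fun x => lik (m n) b u x *
    ind (\sum_t post (m n) b x t * `|overlap R n t u| <= eps / 2)) <= e.
Proof.
(* At the level [expR (del * N)] the change of measure keeps the rate [k - del = del], and [eps] is
   such that weak overlaps weigh at most [expR (del / 2 * N)]. *)
pose del := k / 2.
have del0 : 0 < del by rewrite divr_gt0.
have b2 : 0 < b ^+ 2 by rewrite exprn_gt0.
pose eps := Num.min 1 (del / b ^+ 2).
have eps0 : 0 < eps by rewrite lt_min ltr01 divr_gt0.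
have eps1 : eps <= 1 by rewrite ge_min lexx.
have epsb : b ^+ 2 * eps <= del by rewrite -ler_pdivlMl// mulrC ge_min lexx orbT.
exists eps => // e e0; have e5 : 0 < e / 5 by rewrite divr_gt0.
have del2 : 0 < del / 2 by rewrite divr_gt0.
near=> n.
have N0 : 0 < n.+1%:R :> R by [].
have h : 1 / 2 <= mean (fun x => ind (evid (m n) b x <= expR (- (2 * (c * n.+1%:R))))).
  by near: n; exact: small.
have cn : 0 <= c * n.+1%:R by rewrite mulr_ge0// ltW.
have [_ h1] := null_small_planted_large R _ _ (m n) b (c * n.+1%:R) (del * n.+1%:R) (lt0r_neq0 b0) cn h.
apply: le_trans (gibbs_overlap_large R _ _ (m n) b (del * n.+1%:R) eps _ eps0 (fun _ _ => normr_ge0 _)) _.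
have h2 := pair_sum_small_overlap R p hp n b eps _.
rewrite eps1 (ltW eps0) in h2; have {}h2 := h2 isT.
rewrite kE in h1.
have -> : e = e / 5 + 2 * (e / 5) + 2 * (e / 5) by field.
apply: lerD.
  apply: le_trans h1 _; apply: lerD; first by near: n; apply: near_expR_le.
  rewrite ler_pM2l// -mulrBl -opprB mulNr.
  have -> : k - del = del by rewrite /del; field.
  by near: n; exact: near_expR_le.
rewrite -mulrA ler_pM2l//.
apply: (@le_trans _ _ (expR (- (del / 2 * n.+1%:R)))); last by near: n; apply: near_expR_le.
apply: le_trans (ler_wpM2l (expR_ge0 _) h2) _.
rewrite -expRD ler_expR.
have : b ^+ 2 * eps * n.+1%:R <= del * n.+1%:R by rewrite ler_pM2r.
move: (n.+1%:R) => N hN; clear -small hN; lra.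
Unshelve. all: by end_near. Qed.

End supercritical.

End sub_super_critical.

(** The models are indexed by [n] with dimension [n.+1], whereas the limits run over the
    dimension. *)
Lemma cvg_shiftS_near (R : realType) (f : nat -> R) (l : R) :
  (forall e, 0 < e -> \forall n \near \oo, `|l - f n.+1| <= e) -> f @ \oo --> l.
Proof. by move=> H; rewrite -(cvg_shiftS f); apply/cvgrPdist_le. Qed.

(** * Total variation through the likelihood ratio *)

Section total_variation.
Context (R : realType) (p : nat) (hp : (3 <= p)%N) (d : measure_display) (Om : measurableType d)
  (P : probability Om R) (Y : forall N : nat, Om -> tensor R p N) (u : forall N : nat, Om -> spin N).
Hypothesis H : spiked_model P p Y u.
Context (n : nat) (b : R).
Local Notation I := (idx p n.+1).
Local Notation Sp := (spin n.+1).
Local Notation m := (pspin R p hp n).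
Local Notation L := (evid m b).

Definition obs_in (A : set (tensor R p n.+1)) (x : vect R I) : bool := obs R p n x \in A.

Lemma measurable_obs_in A : tmeasurable p n.+1 A -> measurable_fun setT (obs_in A).
Proof.
move=> mA; apply: (measurable_fun_bool true).
have := measurable_obs R p n measurableT A mA; congr (measurable (_ `&` _)).
by apply/seteqP; split => x /= h; [exact: mem_set|exact: set_mem].
Qed.

Lemma Wt_prob A : tmeasurable p n.+1 A ->
  Pr P (Wt Y n.+1 @^-1` A) = mean (fun x => ind (obs_in A x)).
Proof.
move=> mA; rewrite -(noise_prob R p hp d Om P Y u H n _ (measurable_obs_in A mA)).
by congr Pr; apply/seteqP; split => w /=; rewrite Wt_obs /obs_in => h; [exact: mem_set|exact: set_mem].
Qed.

Lemma Tt_prob A : tmeasurable p n.+1 A ->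
  Pr P (Tt b Y u n.+1 @^-1` A) = mean (fun x => ind (obs_in A x) * L x).
Proof.
move=> mA.
have mi := measurable_obs_in A mA.
transitivity (unif Sp * \sum_s mean (fun x => lik m b s x * ind (obs_in A x))).
  rewrite -(planted_prob R p hp d Om P Y u H n b (fun=> obs_in A)) => [|s]; last exact: mi.
  by congr Pr; apply/seteqP; split => w /=; rewrite (Tt_obs R p hp) /obs_in => h; [exact: mem_set|exact: set_mem].
have ti s : tame (fun x => lik m b s x * ind (obs_in A x)).
  by apply: tameM; [exact: tame_lik|exact: tame_indb].
rewrite -mean_sum// -meanZ; last exact: tame_sum.
congr mean; apply/funext => x; rewrite evidE mulrCA; congr (_ * _); rewrite mulr_sumr.
by apply: eq_bigr => s _; rewrite mulrC.
Qed.

Let tind A : tmeasurable p n.+1 A -> tame (fun x => ind (obs_in A x)).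
Proof. by move=> mA; apply: tame_indb; exact: measurable_obs_in. Qed.

Let tindL A : tmeasurable p n.+1 A -> tame (fun x => ind (obs_in A x) * L x).
Proof. by move=> mA; apply: tameM; [exact: tind|exact: tame_evid]. Qed.

Lemma tame_abs_evid : tame (fun x => `|1 - L x| + (1 - L x)).
Proof.
have t1 : tame (fun x => 1 - L x) by apply: tameB; [exact: tame_cst|exact: tame_evid].
apply: tameD => //; apply: (tame_le _ _ _ _ _ t1) => [|x]; last by rewrite normr_id.
by apply: measurableT_comp => //; exact: tame_measurable t1.
Qed.

(** As [1 - L] has null mean 0, its positive and negative parts have the same mean, which bounds its
    integral over any set. *)
Lemma prob_diff_le A : tmeasurable p n.+1 A ->
  `|Pr P (Wt Y n.+1 @^-1` A) - Pr P (Tt b Y u n.+1 @^-1` A)| <=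
  mean (fun x => `|1 - L x| + (1 - L x)) / 2.
Proof.
move=> mA; rewrite Wt_prob// Tt_prob//.
have t1 := tind A mA; have t2 := tindL A mA; have tL := tame_evid (m := m) b.
have ta := tame_abs_evid.
have c1 : mean (fun x => ind (obs_in A x)) - mean (fun x => ind (obs_in A x) * L x) =
    mean (fun x => ind (obs_in A x) - ind (obs_in A x) * L x) by rewrite meanB.
rewrite ler_norml; apply/andP; split.
- have -> : mean (fun x => ind (obs_in A x)) - mean (fun x => ind (obs_in A x) * L x) =
      mean (fun x => (ind (obs_in A x) - ind (obs_in A x) * L x) - (1 - L x)).
    rewrite meanB; [|exact: tameB|by apply: tameB => //; exact: tame_cst].
    by rewrite -c1 [mean (fun x => 1 - L x)]meanB ?mean_cst ?mean_evid ?subrr ?subr0//; exact: tame_cst.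
  rewrite mulrC -mulNr -meanZ//; apply: le_mean => [||x].
  + exact: tameZ.
  + by apply: tameB; [exact: tameB|apply: tameB => //; exact: tame_cst].
  have h1 := ler_norm (1 - L x); have h2 := ler_norm (- (1 - L x)); rewrite normrN in h2.
  move: h1 h2; move: (L x) (`|_|) => l a h1 h2.
  by case: (obs_in A x) => /=; rewrite ?mul1r ?mul0r; clear -H h1 h2; lra.
- rewrite c1 mulrC -meanZ//; apply: le_mean => [||x]; [exact: tameB|exact: tameZ|].
  have h1 := ler_norm (1 - L x); have h2 := ler_norm (- (1 - L x)); rewrite normrN in h2.
  move: h1 h2; move: (L x) (`|_|) => l a h1 h2.
  by case: (obs_in A x) => /=; rewrite ?mul1r ?mul0r; clear -H h1 h2; lra.
Qed.

Local Notation diffs := [set r : R | exists A : set (tensor R p n.+1),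
  [/\ tmeasurable p n.+1 A, A `<=` sym_tensor p n.+1 &
      r = `| Pr P (Wt Y n.+1 @^-1` A) - Pr P (Tt b Y u n.+1 @^-1` A) |] ].

Lemma diffs_neq0 : diffs !=set0.
Proof.
exists (`| Pr P (Wt Y n.+1 @^-1` set0) - Pr P (Tt b Y u n.+1 @^-1` set0) |).
by exists set0; split => //; exact: (@measurable0 _ (vect R I)).
Qed.

Lemma dTV_le : dTV P p n.+1 (Wt Y n.+1) (Tt b Y u n.+1) <=
  mean (fun x => `|1 - L x| + (1 - L x)) / 2.
Proof.
apply: ge_sup; first exact: diffs_neq0.
by move=> _ [A [mA _ ->]]; exact: prob_diff_le.
Qed.

Lemma diffs_le1 : ubound diffs 1.
Proof.
move=> _ [A [mA _ ->]]; rewrite Wt_prob// Tt_prob//.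
have tL := tame_evid (m := m) b.
have a0 : 0 <= mean (fun x => ind (obs_in A x)) by apply: mean_ge0 => x; exact: ler0n.
have a1 : mean (fun x => ind (obs_in A x)) <= 1.
  rewrite -[leRHS](mean_cst R I); apply: le_mean => [||x]; [exact: tind|exact: tame_cst|].
  by case: (obs_in A x).
have b0 : 0 <= mean (fun x => ind (obs_in A x) * L x).
  by apply: mean_ge0 => x; rewrite mulr_ge0 ?ler0n// ltW// evid_gt0.
have b1 : mean (fun x => ind (obs_in A x) * L x) <= 1.
  rewrite -[leRHS](mean_evid (m := m) b); apply: le_mean => [||x]; [exact: tindL|exact: tL|].
  by rewrite ler_piMl ?(ltW (evid_gt0 _ _))//; case: (obs_in A x).
by rewrite ler_norml; apply/andP; split; clear -H a0 a1 b0 b1; lra.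
Qed.

Lemma le_dTV A : tmeasurable p n.+1 A -> A `<=` sym_tensor p n.+1 ->
  `|Pr P (Wt Y n.+1 @^-1` A) - Pr P (Tt b Y u n.+1 @^-1` A)| <=
  dTV P p n.+1 (Wt Y n.+1) (Tt b Y u n.+1).
Proof.
move=> mA sA; apply: ub_le_sup; first by exists 1; exact: diffs_le1.
by exists A.
Qed.

Lemma dTV_ge0 : 0 <= dTV P p n.+1 (Wt Y n.+1) (Tt b Y u n.+1).
Proof.
apply: le_trans (le_dTV set0 _ _); rewrite ?normr_ge0//.
exact: (@measurable0 _ (vect R I)).
Qed.

Lemma dTV_le1 : dTV P p n.+1 (Wt Y n.+1) (Tt b Y u n.+1) <= 1.
Proof. by apply: ge_sup; [exact: diffs_neq0|exact: diffs_le1]. Qed.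

(* The likelihood ratio as a function of the observed tensor. *)
Definition evid_obs (w : tensor R p n.+1) : R :=
  unif Sp * \sum_s expR (b * (n.+1%:R / 2 * pairing R p n w s) - b ^+ 2 * (n.+1%:R / 2) / 2).

Lemma evid_obsE x : evid_obs (obs R p n x) = L x.
Proof.
rewrite evidE /evid_obs; congr (_ * _); apply: eq_bigr => s _.
by rewrite (pairing_obs R p hp).
Qed.

Lemma measurable_evid_obs : measurable_fun setT (evid_obs : vect R I -> R).
Proof.
apply: measurable_funM => //; apply: measurable_sum => s.
apply: measurableT_comp => //; apply: measurable_funB => //.
by apply: measurable_funM => //; apply: measurable_funM => //; exact: measurable_pairing.
Qed.

(** The test set is [evid_obs < r] among symmetric tensors; its planted probability is at most [r]
    since the density is below [r] there. *)
Lemma dTV_ge (r : R) : 0 < r ->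
  1 - mean (fun x => ind (r <= L x)) - r <= dTV P p n.+1 (Wt Y n.+1) (Tt b Y u n.+1).
Proof.
move=> r0; pose A : set (tensor R p n.+1) := sym_tensor p n.+1 `&` [set w | evid_obs w < r].
have mA : tmeasurable p n.+1 A.
  apply: (@measurableI _ (vect R I)); first exact: measurable_sym.
  have := measurable_evid_obs measurableT `]-oo, r[%classic (measurable_itv _).
  by rewrite setTI; congr measurable; apply/seteqP; split => w /=; rewrite in_itv.
apply: le_trans (le_dTV A mA _); last by move=> w [].
apply: le_trans (ler_norm _); rewrite Wt_prob// Tt_prob//.
have inA x : obs_in A x = (L x < r).
  rewrite /obs_in -evid_obsE; apply/idP/idP; rewrite inE; first by case.
  by move=> h; split => //; exact: symmetrize_sym.
have tr : tame (fun x => ind (r <= L x)).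
  by apply: tame_indb; apply: measurable_ge; exact: tame_measurable (tame_evid b).
have -> : mean (fun x => ind (obs_in A x)) = 1 - mean (fun x => ind (r <= L x)).
  rewrite -[X in X - _](mean_cst R I) -meanB//; last exact: tame_cst.
  by congr mean; apply/funext => x; rewrite inA; case: (leP r (L x)); rewrite ?subrr ?subr0.
rewrite lerD2l lerN2 -[leRHS](mean_cst R I); apply: le_mean => [||x].
- exact: tindL.
- exact: tame_cst.
by rewrite inA; case: (leP r (L x)) => h; rewrite ?mul0r ?mul1r ltW.
Qed.

End total_variation.

(** * Weak recovery *)

Section overlap_moments.
Context (R : realType) (n : nat).
Local Notation Sp := (spin n.+1).
Implicit Types (w : Sp -> R) (s t u : Sp).

Lemma overlapC s t : overlap R n s t = overlap R n t s.
Proof. by rewrite !overlapE; congr (_ / _); apply: eq_bigr => k _; rewrite mulrC. Qed.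

Lemma sqr_average_le (w f : Sp -> R) : (forall s, 0 <= w s) -> \sum_s w s = 1 ->
  (\sum_s w s * f s) ^+ 2 <= \sum_s w s * f s ^+ 2.
Proof.
move=> w0 w1; set a := \sum_s w s * f s.
have : 0 <= \sum_s w s * (f s - a) ^+ 2.
  by apply: sumr_ge0 => s _; rewrite mulr_ge0 ?sqr_ge0.
have -> : \sum_s w s * (f s - a) ^+ 2 = \sum_s (w s * f s ^+ 2 + (- (2 * a)) * (w s * f s) + a ^+ 2 * w s).
  by apply: eq_bigr => s _; ring.
rewrite !big_split/= -!mulr_sumr w1 -/a; move: (\sum_s _) => q; rewrite mulr1 => h.
have : - (2 * a) * a + a ^+ 2 = - a ^+ 2 by ring.
lra.
Qed.

(** A feature map with kernel [overlap ^+ 2]. Squaring makes the kernel positive definite and blind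
    to the sign, as the recovery criterion is. *)
Definition tensor_square s (q : 'I_n.+1 * 'I_n.+1) : R := vecS s q.1 * vecS s q.2.

Lemma tensor_square_dot s t : \sum_q tensor_square s q * tensor_square t q = overlap R n s t ^+ 2.
Proof.
rewrite expr2 /overlap /dotv big_distrlr/= pair_big/=; apply: eq_bigr => q _.
by rewrite /tensor_square mulrACA.
Qed.

(* Cauchy-Schwarz for the second moment tensor of w against the rank-one tensor of u. *)
Lemma average_overlap_sqr w u :
  (\sum_s w s * overlap R n s u ^+ 2) ^+ 2 <=
  \sum_s w s * \sum_t w t * overlap R n s t ^+ 2.
Proof.
set a := \sum_s w s * overlap R n s u ^+ 2.
pose A q := \sum_s w s * tensor_square s q.
have : 0 <= \sum_q (A q - a * tensor_square u q) ^+ 2 by apply: sumr_ge0 => q _; exact: sqr_ge0.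
have -> : \sum_q (A q - a * tensor_square u q) ^+ 2 =
  \sum_q (A q ^+ 2 + (- (2 * a)) * (A q * tensor_square u q) + a ^+ 2 * (tensor_square u q * tensor_square u q)).
  by apply: eq_bigr => q _; ring.
rewrite !big_split/= -!mulr_sumr tensor_square_dot overlap_diag.
have -> : \sum_q A q * tensor_square u q = a.
  under eq_bigr do rewrite mulr_suml.
  rewrite exchange_big/=; apply: eq_bigr => s _; rewrite -tensor_square_dot mulr_sumr.
  by apply: eq_bigr => q _; rewrite mulrA.
have -> : \sum_q A q ^+ 2 = \sum_s w s * \sum_t w t * overlap R n s t ^+ 2.
  under eq_bigr do rewrite expr2 mulr_suml.
  rewrite exchange_big/=; apply: eq_bigr => s _.
  under eq_bigr do rewrite -mulrA.
  rewrite -mulr_sumr; congr (_ * _).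
  rewrite (eq_bigr (fun q => \sum_t tensor_square s q * (w t * tensor_square t q))) => [|q _]; last first.
    by rewrite mulr_sumr.
  rewrite exchange_big/=; apply: eq_bigr => t _.
  by rewrite -tensor_square_dot mulr_sumr; apply: eq_bigr => q _; rewrite mulrCA.
rewrite expr1n; move: (\sum_s _) => q h.
have : - (2 * a) * a + a ^+ 2 * 1 = - a ^+ 2 by ring.
lra.
Qed.

(** Jensen and [average_overlap_sqr] give [y ^+ 4 <= D] for the average [y] and the pair average
    [D], hence [y <= D / eta ^+ 3] once [y > eta]. *)
Lemma average_overlap_le w u (eta : R) : 0 < eta -> (forall s, 0 <= w s) -> \sum_s w s = 1 ->
  \sum_s w s * `|overlap R n s u| <=
  eta + (\sum_s w s * \sum_t w t * `|overlap R n t s|) / eta ^+ 3.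
Proof.
move=> e0 w0 w1; set y := \sum_s _; set D := \sum_s w s * \sum_t _.
have y0 : 0 <= y by apply: sumr_ge0 => s _; rewrite mulr_ge0.
have D0 : 0 <= D.
  by apply: sumr_ge0 => s _; rewrite mulr_ge0//; apply: sumr_ge0 => t _; rewrite mulr_ge0.
have h1 : y ^+ 2 <= \sum_s w s * overlap R n s u ^+ 2.
  apply: le_trans (sqr_average_le w _ w0 w1) _; apply: ler_sum => s _.
  by rewrite real_normK ?num_real.
have h2 : \sum_s w s * \sum_t w t * overlap R n s t ^+ 2 <= D.
  apply: ler_sum => s _; rewrite ler_wpM2l//; apply: ler_sum => t _; rewrite ler_wpM2l//.
  rewrite overlapC -real_normK ?num_real// expr2 ler_piMr//; exact: overlap_le1.
have h4 : y ^+ 4 <= D.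
  apply: le_trans h2; apply: le_trans (average_overlap_sqr w u).
  by rewrite (exprM y 2 2) lerXn2r ?nnegrE ?sqr_ge0//; exact: le_trans (sqr_ge0 _) h1.
have [h|h] := leP y eta; first by rewrite (le_trans h)// lerDl divr_ge0// exprn_ge0// ltW.
apply: (@le_trans _ _ (D / eta ^+ 3)); last by rewrite lerDr ltW.
rewrite ler_pdivlMr ?exprn_gt0//; apply: le_trans h4.
by rewrite (exprS y 3) ler_wpM2l// lerXn2r ?nnegrE ?(ltW e0)// ltW.
Qed.

End overlap_moments.

Section random_measures.
Context (R : realType) (p n : nat).
Local Notation I := (idx p n.+1).
Local Notation Sp := (spin n.+1).
Variable mu : tensor R p n.+1 -> set Sp -> R.
Hypothesis mu_rpm : random_prob_measure p n.+1 mu.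

Lemma rpm_ge0 w A : sym_tensor p n.+1 w -> 0 <= mu w A.
Proof. by move=> sw; have [/(_ A)/andP[]] := mu_rpm.2 w sw. Qed.

Lemma rpm_sum w : sym_tensor p n.+1 w -> \sum_t mu w [set t] = 1.
Proof.
move=> sw; have [_ [m1 mU]] := mu_rpm.2 w sw.
have m0 : mu w set0 = 0.
  have := mU set0 set0; rewrite setI0 setU0 => /(_ erefl) h; lra.
have K (s : seq Sp) : uniq s -> mu w [set` s] = \sum_(t <- s) mu w [set t].
  elim: s => [|t s IH].
    have -> : [set` ([::] : seq Sp)] = set0 by apply/seteqP; split.
    by rewrite big_nil m0.
  move=> /= /andP[ts us]; rewrite big_cons -IH//.
  have -> : [set` t :: s] = [set t] `|` [set` s].
    apply/seteqP; split => x /=; first by rewrite in_cons => /orP[/eqP|]; [left|right].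
    by rewrite in_cons => -[->|->]; rewrite ?eqxx ?orbT.
  by rewrite mU//; apply/seteqP; split => // x [/= -> h]; move: ts; rewrite h.
rewrite -big_enum -K ?enum_uniq//.
have -> : [set` enum Sp] = setT; last exact: m1.
by apply/seteqP; split => t //= _; rewrite mem_enum.
Qed.

Lemma rpm_measurable A : measurable_fun setT (fun x : vect R I => mu (obs R p n x) A).
Proof.
move=> _ B mB; rewrite setTI.
have := measurable_obs R p n measurableT _ (mu_rpm.1 A B mB); rewrite setTI.
congr measurable; apply/seteqP; split => x /=; first by case.
by move=> h; split => //; exact: symmetrize_sym.
Qed.

End random_measures.

Section weak_recovery.
Context (R : realType) (p : nat) (hp : (3 <= p)%N) (d : measure_display) (Om : measurableType d)
  (P : probability Om R) (Y : forall N : nat, Om -> tensor R p N) (u : forall N : nat, Om -> spin N).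
Hypothesis H : spiked_model P p Y u.
Context (n : nat) (b : R).
Local Notation I := (idx p n.+1).
Local Notation Sp := (spin n.+1).
Local Notation m := (pspin R p hp n).
Variable mu : tensor R p n.+1 -> set Sp -> R.
Hypothesis mu_rpm : random_prob_measure p n.+1 mu.

Definition recovered (s : Sp) (x : vect R I) : R := overlap_integral mu (obs R p n x) s.

Lemma measurable_recovered s : measurable_fun setT (recovered s).
Proof.
by apply: measurable_sum => t; apply: measurable_funM => //; exact: rpm_measurable.
Qed.

Lemma recovered_ge0 s x : 0 <= recovered s x.
Proof.
apply: sumr_ge0 => t _; rewrite mulr_ge0//; apply: (rpm_ge0 R p n mu mu_rpm).
exact: symmetrize_sym.
Qed.

Lemma recovery_prob c : Pr P [set w | c <= overlap_integral mu (Tt b Y u n.+1 w) (u n.+1 w)] =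
  unif Sp * \sum_s mean (fun x => lik m b s x * ind (c <= recovered s x)).
Proof.
rewrite -(planted_prob R p hp d Om P Y u H n b (fun s x => c <= recovered s x)).
  by congr Pr; apply/seteqP; split => w /=; rewrite (Tt_obs R p hp).
by move=> s; apply: measurable_ge; exact: measurable_recovered.
Qed.

(** Given the observation, the planted spin is a posterior sample independent of the estimator. For
    each fixed [t], [average_overlap_le] bounds the posterior average of its overlap with [t], and
    averaging over the estimator keeps the bound. Markov gives the factor [c^-1]. *)
Lemma recovery_prob_le (c eta : R) : 0 < c -> 0 < eta ->
  Pr P [set w | c <= overlap_integral mu (Tt b Y u n.+1 w) (u n.+1 w)] <=
  c^-1 * (eta + bayes2 R I Sp m b (fun t s => `|overlap R n t s|) / eta ^+ 3).
Proof.
move=> c0 e0; rewrite recovery_prob.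
have ti s : tame (fun x => lik m b s x * ind (c <= recovered s x)).
  apply: tameM; first exact: tame_lik.
  by apply: tame_indb; apply: measurable_ge; exact: measurable_recovered.
have tp t : tame (fun x => post m b x t) := tame_wgt _ _ _ (proper_prior b).
pose D (x : vect R I) := \sum_s post m b x s * \sum_t post m b x t * `|overlap R n t s|.
have tD : tame D.
  apply: tame_sum => s; apply: tameM => //; apply: tame_sum => t.
  by apply: tameM => //; exact: tame_cst.
have tL := tame_evid (m := m) b.
rewrite -mean_sum// -meanZ; last exact: tame_sum.
rewrite bayes2E -/D.
have -> : eta + mean (fun x => evid m b x * D x) / eta ^+ 3 =
    mean (fun x => evid m b x * (eta + (eta ^+ 3)^-1 * D x)).
  transitivity (mean (fun x => eta * evid m b x + (eta ^+ 3)^-1 * (evid m b x * D x))).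
    rewrite meanD; [|exact: tameZ|by apply: tameZ; exact: tameM].
    rewrite meanZ// mean_evid mulr1 meanZ; last exact: tameM.
    by congr (_ + _); rewrite mulrC.
  by congr mean; apply/funext => x; ring.
have te : tame (fun x => evid m b x * (eta + (eta ^+ 3)^-1 * D x)).
  by apply: tameM => //; apply: tameD; [exact: tame_cst|exact: tameZ].
rewrite -meanZ//; apply: le_mean => [||x]; [by apply: tameZ; exact: tame_sum|exact: tameZ|].
have sx : sym_tensor p n.+1 (obs R p n x) by exact: symmetrize_sym.
apply: (@le_trans _ _ (evid m b x * (\sum_s post m b x s * (c^-1 * recovered s x)))).
  rewrite !mulr_sumr; apply: ler_sum => s _.
  rewrite mulrA -post_evid [evid m b x * _]mulrCA mulrA ler_wpM2l//.
    by rewrite mulr_ge0 ?post_ge0 ?(ltW (evid_gt0 _ _)).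
  apply: ind_le => [|h]; first by rewrite mulr_ge0 ?recovered_ge0// invr_ge0 ltW.
  by rewrite mulrC ler_pdivlMr// mul1r.
rewrite mulrCA ler_wpM2l ?(ltW (evid_gt0 _ _))//.
under eq_bigr do rewrite mulrCA.
rewrite -mulr_sumr ler_wpM2l ?invr_ge0 ?(ltW c0)//.
have -> : \sum_s post m b x s * recovered s x =
    \sum_t mu (obs R p n x) [set t] * \sum_s post m b x s * `|overlap R n s t|.
  under eq_bigr do rewrite mulr_sumr.
  rewrite exchange_big/=; apply: eq_bigr => t _; rewrite mulr_sumr.
  by apply: eq_bigr => s _; rewrite /overlap; ring.
rewrite -[leRHS]mul1r -(rpm_sum R p n mu mu_rpm _ sx) mulr_suml; apply: ler_sum => t _.
rewrite ler_wpM2l ?rpm_ge0// [_^-1 * _]mulrC; apply: average_overlap_le => //.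
- by move=> s; exact: post_ge0.
- exact: post_sum.
Qed.

End weak_recovery.

Section gibbs_estimator.
Context (R : realType) (p : nat) (hp : (3 <= p)%N) (b : R).

Definition gibbs_weight n (w : tensor R p n.+1) (t : spin n.+1) : R :=
  expR (b * (n.+1%:R / 2 * pairing R p n w t)) /
  \sum_s expR (b * (n.+1%:R / 2 * pairing R p n w s)).

(** The posterior as a function of the observed tensor, with a default value in dimension 0. *)
Definition gibbs_measure N : tensor R p N -> set (spin N) -> R :=
  match N with
  | 0 => fun _ _ => 0
  | n.+1 => fun w A => \sum_(t : spin n.+1) gibbs_weight n w t * ind (t \in A)
  end.

Lemma gibbs_denom_gt0 n (w : tensor R p n.+1) :
  0 < \sum_(s : spin n.+1) expR (b * (n.+1%:R / 2 * pairing R p n w s)).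
Proof.
rewrite (bigD1 (ones n.+1))//= ltr_pwDl ?expR_gt0//.
by apply: sumr_ge0 => s _; exact: expR_ge0.
Qed.

Lemma gibbs_weight_ge0 n w t : 0 <= gibbs_weight n w t.
Proof. by rewrite divr_ge0 ?expR_ge0// ltW// gibbs_denom_gt0. Qed.

Lemma gibbs_weight_sum n w : \sum_t gibbs_weight n w t = 1.
Proof. by rewrite -mulr_suml divff// gt_eqF// gibbs_denom_gt0. Qed.

Lemma measurable_gibbs_weight n t :
  measurable_fun setT ((fun w => gibbs_weight n w t) : vect R (idx p n.+1) -> R).
Proof.
have me s : measurable_fun setT
    ((fun w => expR (b * (n.+1%:R / 2 * pairing R p n w s))) : vect R (idx p n.+1) -> R).
  apply: measurableT_comp => //; apply: measurable_funM => //; apply: measurable_funM => //.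
  exact: measurable_pairing.
apply: measurable_funM; first exact: me.
apply: measurable_fun_invr_gt0; last exact: gibbs_denom_gt0.
by apply: measurable_sum.
Qed.

Lemma gibbs_weight_post n (x : vect R (idx p n.+1)) t :
  gibbs_weight n (obs R p n x) t = post (pspin R p hp n) b x t.
Proof.
rewrite /gibbs_weight (pairing_obs R p hp).
under eq_bigr do rewrite (pairing_obs R p hp).
rewrite /post /wgt /Z /prior -mulr_sumr invfM mulrACA divff ?mul1r//.
by rewrite gt_eqF// mulr_gt0 ?expR_gt0// (unif_gt0 (m := pspin R p hp n)).
Qed.

Lemma gibbs_measure_rpm N : (0 < N)%N -> random_prob_measure p N (gibbs_measure N).
Proof.
case: N => // n _; split=> [A B mB|w sw].
  apply: (@measurableI _ (vect R (idx p n.+1))); first exact: measurable_sym.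
  have mg : measurable_fun setT ((fun w => gibbs_measure n.+1 w A) : vect R (idx p n.+1) -> R).
    by apply: measurable_sum => t; apply: measurable_funM => //; exact: measurable_gibbs_weight.
  by have := mg measurableT B mB; rewrite setTI.
split; [|split] => /=.
- move=> A; rewrite sumr_ge0/= => [|t _]; last by rewrite mulr_ge0 ?ler0n ?gibbs_weight_ge0.
  rewrite -[leRHS](gibbs_weight_sum n w); apply: ler_sum => t _.
  by rewrite ler_piMr ?gibbs_weight_ge0//; case: (_ \in _).
- rewrite -[RHS](gibbs_weight_sum n w); apply: eq_bigr => t _.
  by rewrite mem_set// mulr1.
move=> A B AB; rewrite -big_split/=; apply: eq_bigr => t _; rewrite -mulrDr; congr (_ * _).
rewrite in_setU; have [tA|tA] := boolP (t \in A) => /=; last by rewrite add0r.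
rewrite memNset ?addr0//= => tB.
have : (A `&` B) t by split=> //; exact: set_mem.
by rewrite AB.
Qed.

Lemma recovered_gibbs n s x : recovered R p n (gibbs_measure n.+1) s x =
  \sum_t post (pspin R p hp n) b x t * `|overlap R n t s|.
Proof.
apply: eq_bigr => t _; rewrite overlapC mulrC; congr (_ * _).
rewrite /= (bigD1 t)//= mem_set// mulr1 big1 ?addr0 ?gibbs_weight_post// => s' s't.
by rewrite memNset ?mulr0// => /= e; rewrite e eqxx in s't.
Qed.

End gibbs_estimator.

(** * The four limits *)

Section final.
Context (R : realType) (p : nat) (hp : (3 <= p)%N).
Local Notation m := (pspin R p hp).

Section spiked.
Context (d : measure_display) (Om : measurableType d) (P : probability Om R)
  (Y : forall N : nat, Om -> tensor R p N) (u : forall N : nat, Om -> spin N).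
Hypothesis H : spiked_model P p Y u.

Lemma indistinguishable b b' : 0 < b -> b < b' -> psi_sublinear m b' ->
  (fun N : nat => dTV P p N (Wt Y N) (Tt b Y u N)) @ \oo --> (0 : R).
Proof.
move=> b0 bb' psib'; apply: cvg_shiftS_near => e e0.
apply: filterS (subcritical_evid R p hp b b' b0 bb' psib' e e0) => n hn.
rewrite sub0r normrN ger0_norm; last exact: dTV_ge0.
apply: le_trans (dTV_le R p hp d Om P Y u H n b) _.
by rewrite ler_pdivrMr// (le_trans hn)// ler_peMr ?(ltW e0)// ler1n.
Qed.

Lemma recovery_impossible b b' (mu : forall N : nat, tensor R p N -> set (spin N) -> R) c :
  0 < b -> b < b' -> psi_sublinear m b' ->
  (forall N : nat, (0 < N)%N -> random_prob_measure p N (mu N)) -> 0 < c ->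
  (fun N : nat =>
     Pr P [set w | c <= overlap_integral (mu N) (Tt b Y u N w) (u N w)]) @ \oo --> (0 : R).
Proof.
move=> b0 bb' psib' hmu c0; apply: cvg_shiftS_near => e e0.
(* Chosen so that [c^-1 * (eta + eta) = e]. *)
pose eta := c * e / 2.
have eta0 : 0 < eta by rewrite divr_gt0// mulr_gt0.
have eta4 : 0 < eta ^+ 3 * eta by rewrite mulr_gt0// exprn_gt0.
apply: filterS (subcritical_overlap R p hp b b' b0 bb' psib' _ eta4) => n hn.
rewrite sub0r normrN ger0_norm; last by rewrite fine_ge0.
apply: le_trans (recovery_prob_le R p hp d Om P Y u H n b _ (hmu n.+1 isT) c eta c0 eta0) _.
rewrite mulrC ler_pdivrMr// [e * c](_ : _ = eta + eta); last by rewrite /eta; field.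
by rewrite lerD2l ler_pdivrMr ?exprn_gt0// mulrC.
Qed.

Lemma distinguishable b c : 0 < b -> 0 < c ->
  (\forall n \near \oo,
     1 / 2 <= mean (fun x => ind (evid (m n) b x <= expR (- (2 * (c * n.+1%:R)))))) ->
  (fun N : nat => dTV P p N (Wt Y N) (Tt b Y u N)) @ \oo --> (1 : R).
Proof.
move=> b0 c0 small; apply: cvg_shiftS_near => e e0.
have e2 : 0 < e / 2 by rewrite divr_gt0.
near=> n.
have h1 : mean (fun x => ind (expR (- (c * n.+1%:R)) <= evid (m n) b x)) <= e / 2.
  by near: n; exact: supercritical_null_evid.
have h2 : expR (- (c * n.+1%:R)) <= e / 2 by near: n; exact: near_expR_le.
have h3 := dTV_ge R p hp d Om P Y u H n b _ (expR_gt0 (- (c * n.+1%:R))).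
have h4 := dTV_le1 R p hp d Om P Y u H n b.
rewrite ger0_norm ?subr_ge0//; move: h1 h2 h3 h4.
move: (expR _) (mean _) (dTV _ _ _ _ _) => q1 q2 q3 k1 k2 k3 k4; clear -H k1 k2 k3 k4; lra.
Unshelve. all: by end_near. Qed.

Lemma recovery_possible b eps :
  (forall e, 0 < e -> \forall n \near \oo,
    unif (spin n.+1) * \sum_s mean (fun x => lik (m n) b s x *
      ind (\sum_t post (m n) b x t * `|overlap R n t s| <= eps / 2)) <= e) ->
  (fun N : nat => Pr P [set w | eps / 2 <=
     overlap_integral (gibbs_measure R p b N) (Tt b Y u N w) (u N w)]) @ \oo --> (1 : R).
Proof.
move=> Hb; apply: cvg_shiftS_near => e e0.
apply: filterS (Hb e e0) => n hn.
have mu_rpm := gibbs_measure_rpm R p b n.+1 isT.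
rewrite (recovery_prob R p hp d Om P Y u H n b _ mu_rpm).
set r := recovered _ _ _ _.
have mr s : measurable_fun setT (r s) by exact: measurable_recovered.
have tl s := tame_lik (m := m n) b s.
have tge s : tame (fun x => lik (m n) b s x * ind (eps / 2 <= r s x)).
  by apply: tameM => //; apply: tame_indb; exact: measurable_ge.
have tle s : tame (fun x => lik (m n) b s x * ind (r s x <= eps / 2)).
  by apply: tameM => //; apply: tame_indb; exact: measurable_le.
have le1 s : mean (fun x => lik (m n) b s x * ind (eps / 2 <= r s x)) <= 1.
  rewrite -[leRHS](mean_lik (m := m n) b s); apply: le_mean => // x.
  by rewrite ler_piMr ?(ltW (lik_gt0 _ _ _))//; case: (eps / 2 <= r s x).
(* The likelihood has mean 1, and the two closed half-lines at [eps / 2] cover all values of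
   [r s x]. *)
have ge1 s : 1 - mean (fun x => lik (m n) b s x * ind (r s x <= eps / 2)) <=
    mean (fun x => lik (m n) b s x * ind (eps / 2 <= r s x)).
  rewrite lerBlDr -[leLHS](mean_lik (m := m n) b s) -meanD//; apply: le_mean => // [|x].
    exact: tameD.
  rewrite -mulrDr ler_peMr ?(ltW (lik_gt0 _ _ _))//.
  by case: (leP (eps / 2) (r s x)) => h; [rewrite lerDl ler0n|rewrite (ltW h) add0r].
rewrite ger0_norm; last by rewrite subr_ge0; exact: (unif_average_le R p hp).
rewrite lerBlDr -lerBlDl.
have U0 : 0 <= unif (spin n.+1) :> R by exact: ltW (unif_gt0 (m := m n)).
apply: le_trans (ler_wpM2l U0 (ler_sum _ (fun s _ => ge1 s))).
rewrite sumrB mulrBr (unif_sum (m := m n)) lerD2l lerN2.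
apply: le_trans hn; rewrite ler_wpM2l// ler_sum// => s _.
have -> : r s = (fun x => \sum_t post (m n) b x t * `|overlap R n t s|); last by [].
by apply/funext => x; rewrite /r recovered_gibbs.
Qed.

End spiked.

End final.

Theorem mainTheorem1 (R : realType) (p : nat) (hp : (3 <= p)%N)
  (d0 : measure_display) (Om0 : measurableType d0) (P0 : probability Om0 R)
  (g : {ffun 'I_p -> nat} -> Om0 -> R) (hg : iid_std_gaussian_array P0 p g)
  (F : R -> R) (hF : is_free_energy_limit P0 p g F)
  (bp : R) (hbp : is_critical_temperature F bp) (beta : R) :
  (0 < beta < bp ->
     (forall (d : measure_display) (Om : measurableType d)
             (P : probability Om R) (Y : forall N : nat, Om -> tensor R p N)
             (u : forall N : nat, Om -> spin N),
         spiked_model P p Y u ->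
         (fun N : nat => dTV P p N (Wt Y N) (Tt beta Y u N)) @ \oo --> (0 : R)) /\
     (forall (mu : forall N : nat, tensor R p N -> set (spin N) -> R) (c : R),
         (forall N : nat, (0 < N)%N -> random_prob_measure p N (mu N)) ->
         0 < c ->
         forall (d : measure_display) (Om : measurableType d)
                (P : probability Om R) (Y : forall N : nat, Om -> tensor R p N)
                (u : forall N : nat, Om -> spin N),
           spiked_model P p Y u ->
           (fun N : nat =>
              Pr P [set w | c <= overlap_integral (mu N) (Tt beta Y u N w) (u N w)])
             @ \oo --> (0 : R))) /\
  (bp < beta ->
     (forall (d : measure_display) (Om : measurableType d)
             (P : probability Om R) (Y : forall N : nat, Om -> tensor R p N)
             (u : forall N : nat, Om -> spin N),
         spiked_model P p Y u ->
         (fun N : nat => dTV P p N (Wt Y N) (Tt beta Y u N)) @ \oo --> (1 : R)) /\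
     (exists (mu : forall N : nat, tensor R p N -> set (spin N) -> R) (c : R),
         (forall N : nat, (0 < N)%N -> random_prob_measure p N (mu N)) /\
         0 < c /\
         forall (d : measure_display) (Om : measurableType d)
                (P : probability Om R) (Y : forall N : nat, Om -> tensor R p N)
                (u : forall N : nat, Om -> spin N),
           spiked_model P p Y u ->
           (fun N : nat =>
              Pr P [set w | c <= overlap_integral (mu N) (Tt beta Y u N w) (u N w)])
             @ \oo --> (1 : R))).
Proof.
have [[bp0 Fbp] bpmax] := hbp; split.
  move=> /andP[b0 bbp].
  (* The critical temperature itself serves as the larger parameter [b']. *)
  have psib : psi_sublinear (pspin R p hp) bp.
    apply: null_nondegenerate_psi => //.
    exact: (critical_nondegenerate R p hp d0 Om0 P0 g hg F hF bp (ltW bp0) Fbp).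
  split=> [d Om P Y u H|mu c hmu c0 d Om P Y u H].
    exact: (indistinguishable R p hp d Om P Y u H beta bp).
  exact: (recovery_impossible R p hp d Om P Y u H beta bp).
move=> bpb; have b0 : 0 < beta by exact: lt_trans bpb.
(* Maximality of [bp] excludes equality, and [free_energy_le] gives the weak inequality. *)
have Fb : F beta < beta ^+ 2 / 4.
  rewrite lt_neqAle (free_energy_le R p hp d0 Om0 P0 g hg F hF _ (ltW b0)) andbT.
  by apply/negP => /eqP e; have := bpmax beta b0 e; rewrite leNgt bpb.
have [c c0 small] := supercritical_evid_small R p hp d0 Om0 P0 g hg F hF beta (ltW b0) Fb.
split=> [d Om P Y u H|].
  exact: (distinguishable R p hp d Om P Y u H beta c).
have [eps eps0 Heps] := supercritical_gibbs R p hp beta c b0 c0 small.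
exists (gibbs_measure R p beta), (eps / 2); split; first exact: gibbs_measure_rpm.
split=> [|d Om P Y u H]; first by rewrite divr_gt0.
exact: (recovery_possible R p hp d Om P Y u H beta eps Heps).
Qed.
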